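(* For every fixed $\sigma > \frac{309}{320}$ and every $\varepsilon > 0$, \[ \int_1^T|\zeta(1/2 + it)|^4|\zeta(\sigma + it)|^4\,dt \ll_{\varepsilon} T^{1 + \varepsilon}. \]
   Context: $\zeta(s)$ is the Riemann zeta-function. *)

(* Defs.v *)
From Stdlib Require Import Reals.
From Coquelicot Require Import Coquelicot.

Open Scope R_scope.

Definition Cexp (z : C) : C :=
  (exp (Re z) * cos (Im z), exp (Re z) * sin (Im z)).

(* [n ^ z] with the real logarithm; only meaningful for [0 < n]. *)
Definition nat_Cpow (n : nat) (z : C) : C := Cexp (z * RtoC (ln (INR n)))%C.

(* [zeta] is the Riemann zeta-function: the sum of n ^ (-s) over n >= 1 on the
   half-plane Re s > 1, continued holomorphically to the complex plane minus
   the point 1.  The plane minus a point is connected, so these conditions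
   determine [zeta s] for every s <> 1.  The value at the pole is left free. *)
Definition is_riemann_zeta (zeta : C -> C) : Prop :=
  (forall s : C, 1 < Re s ->
     @is_series C_AbsRing C_NormedModule
       (fun k : nat => nat_Cpow (S k) (- s)%C) (zeta s)) /\
  (forall s : C, s <> RtoC 1 -> @ex_derive C_AbsRing C_NormedModule zeta s).

(* Main.v *)
(* Let U = 2^u and t in [U^2, 4 U^2], so T = U^2.  The three ingredients are
   sup |zeta(1/2+it)|^4 << T^(3/4+eps), the fourth moment of zeta(1/2+it)
   << T^(1+eps), and, for sigma > 309/320, a Dirichlet polynomial of length T^(3/2)
   for zeta(sigma+it), cut into dyadic blocks.  On a short block of length T^delta
   the trivial bound and the fourth moment suffice.  For a longer block D of length
   Y take k >= 2 with T <= Y^k <= T^3; then |D|^4 <= 1 + |D|^(2k), and the mean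
   value theorem for D^k gives an integral << T^eps Y^(k (2 - 2 sigma))
   << T^(3 (2 - 2 sigma) + eps) <= T^(66/320 + eps), which the pointwise bound
   T^(3/4) of the other factor keeps below T.
   The approximate functional equation is replaced by a weaker inequality: the
   Poisson (sawtooth Fourier) expansion of the Euler-Maclaurin remainder, cut at
   length U, bounds zeta(1/2+it) by log T times the largest partial sum of
   n^(-1/2-it) with n < 2U.  The supremum bound then follows from two van der Corput
   differencings and the Kusmin-Landau inequality, and the fourth moment from the
   mean value theorem for the squares of the partial sums and the divisor bound.
   Since zeta is only given as a complex-differentiable extension of the series,
   Cauchy's theorem is what identifies it with its Euler-Maclaurin approximation
   to the left of Re s = 1. *)

(* The partial sums arise by reflection. Frequency k of the sawtooth series contributes 1/k times
   the integral of e^(2 pi i k y) y^(-3/2-it) over [U, X]. Substituting y/k for y turns this into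
   the conjugate of k^(-1/2-it) times the integral of one fixed kernel over [k U, k X]. Summation by
   parts in k then attaches to each block [j U, (j+1) U] a partial sum of length j. The blocks weigh
   O(U^(-2) log U) in total, against a factor |s| = O(U^2) in front, and the stationary point t / (2
   pi) lies below 2 U^2, which is why lengths below 2 U suffice. The length of the largest partial
   sum varies with t, so it cannot enter a mean value. A sum of fourth powers over all dyadic
   subblocks replaces it, at the cost of logarithms. In powers of U the final balance is 3/2 (the
   supremum) plus 6 (2 - 2 sigma) < 132/320 (the long blocks), together below 2. Working with powers
   of two makes the dyadic cuts exact and turns every logarithm into a polynomial in u, absorbed by
   2^(eps u). *)
Require Import Defs.
From Stdlib Require Import Reals Lra Lia Psatz List.
From Coquelicot Require Import Coquelicot.
From mathcomp Require all_boot.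

Open Scope R_scope.

(** * Complex-valued integrals over a real interval *)

Notation CInt := (@RInt C_R_CompleteNormedModule).
Notation ex_CInt := (@ex_RInt C_R_NormedModule).
Notation is_CInt := (@is_RInt C_R_NormedModule).
Notation Ccontinuous := (@continuous R_UniformSpace C_UniformSpace).

Lemma is_CInt_pair (f : R -> C) a b (u v : R) :
  is_RInt (fun t => fst (f t)) a b u -> is_RInt (fun t => snd (f t)) a b v ->
  is_CInt f a b (u, v).
Proof. intros Hu Hv. exact (is_RInt_fct_extend_pair f a b u v Hu Hv). Qed.

Lemma is_CInt_fst (f : R -> C) a b l : is_CInt f a b l ->
  is_RInt (fun t => fst (f t)) a b (fst l).
Proof. exact (is_RInt_fct_extend_fst f a b l). Qed.

Lemma is_CInt_snd (f : R -> C) a b l : is_CInt f a b l ->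
  is_RInt (fun t => snd (f t)) a b (snd l).
Proof. exact (is_RInt_fct_extend_snd f a b l). Qed.

Lemma CInt_pair (f : R -> C) a b : ex_CInt f a b ->
  CInt f a b = (RInt (fun t => fst (f t)) a b, RInt (fun t => snd (f t)) a b).
Proof.
  intros [l Hl].
  apply (@is_RInt_unique C_R_CompleteNormedModule), is_CInt_pair;
    apply (@RInt_correct R_CompleteNormedModule).
  - exists (fst l). exact (is_CInt_fst _ _ _ _ Hl).
  - exists (snd l). exact (is_CInt_snd _ _ _ _ Hl).
Qed.

Lemma is_CInt_Cmult (c : C) (f : R -> C) a b l :
  is_CInt f a b l -> is_CInt (fun t => (c * f t)%C) a b (c * l)%C.
Proof.
  intros Hf.
  pose proof (is_CInt_fst _ _ _ _ Hf) as H1. pose proof (is_CInt_snd _ _ _ _ Hf) as H2.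
  apply is_CInt_pair; simpl.
  - apply (is_RInt_minus (V := R_NormedModule)); apply (is_RInt_scal (V := R_NormedModule)); assumption.
  - apply (is_RInt_plus (V := R_NormedModule)); apply (is_RInt_scal (V := R_NormedModule)); assumption.
Qed.

Lemma CInt_Cmult (c : C) (f : R -> C) a b :
  ex_CInt f a b -> CInt (fun t => (c * f t)%C) a b = (c * CInt f a b)%C.
Proof.
  intros Hf. apply is_RInt_unique. apply is_CInt_Cmult. exact (@RInt_correct C_R_CompleteNormedModule f a b Hf).
Qed.

Lemma CInt_minus (f g : R -> C) a b : ex_CInt f a b -> ex_CInt g a b ->
  CInt (fun t => (f t - g t)%C) a b = (CInt f a b - CInt g a b)%C.
Proof. intros Hf Hg. exact (@RInt_minus C_R_CompleteNormedModule f g a b Hf Hg). Qed.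

Lemma CInt_Chasles (f : R -> C) a b c : ex_CInt f a b -> ex_CInt f b c ->
  (CInt f a b + CInt f b c)%C = CInt f a c.
Proof. intros Hf Hg. exact (@RInt_Chasles C_R_CompleteNormedModule f a b c Hf Hg). Qed.

Lemma Cmod_CInt_le (f : R -> C) (g : R -> R) a b : a <= b ->
  ex_CInt f a b -> ex_RInt g a b -> (forall t, a <= t <= b -> Cmod (f t) <= g t) ->
  Cmod (CInt f a b) <= RInt g a b.
Proof.
  intros Hab Hf Hg H. rewrite Cmod_norm.
  apply (@norm_RInt_le C_R_NormedModule f g a b); auto.
  - intros t Ht. pose proof (H t Ht) as E. rewrite Cmod_norm in E. exact E.
  - exact (@RInt_correct C_R_CompleteNormedModule f a b Hf).
  - exact (@RInt_correct R_CompleteNormedModule g a b Hg).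
Qed.

Lemma Cmod_CInt_le_const (f : R -> C) (M : R) a b : a <= b ->
  ex_CInt f a b -> (forall t, a <= t <= b -> Cmod (f t) <= M) ->
  Cmod (CInt f a b) <= (b - a) * M.
Proof.
  intros Hab Hf H.
  replace ((b - a) * M) with (RInt (fun _ => M) a b).
  - apply Cmod_CInt_le; auto. apply ex_RInt_const.
  - rewrite RInt_const. reflexivity.
Qed.

Lemma ex_CInt_continuous (f : R -> C) a b : a <= b ->
  (forall t, a <= t <= b -> Ccontinuous f t) -> ex_CInt f a b.
Proof.
  intros Hab H. apply (@ex_RInt_continuous C_R_CompleteNormedModule).
  intros z Hz. rewrite Rmin_left, Rmax_right in Hz by lra. exact (H z Hz).
Qed.

Lemma Ccontinuous_pair (f : R -> C) t :
  continuous (fun x => fst (f x)) t -> continuous (fun x => snd (f x)) t ->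
  Ccontinuous f t.
Proof.
  intros H1 H2. apply filterlim_locally. intros eps.
  pose proof (proj1 (filterlim_locally _ _) H1 eps) as H1e.
  pose proof (proj1 (filterlim_locally _ _) H2 eps) as H2e.
  generalize (filter_and _ _ H1e H2e). apply filter_imp. intros x [Ha Hb]. split; assumption.
Qed.

Lemma Ccontinuous_fst (f : R -> C) t : Ccontinuous f t -> continuous (fun x => fst (f x)) t.
Proof.
  intros H. apply filterlim_locally. intros eps.
  pose proof (proj1 (filterlim_locally _ _) H eps) as He.
  revert He. apply filter_imp. intros x [Ha Hb]. assumption.
Qed.

Lemma Ccontinuous_snd (f : R -> C) t : Ccontinuous f t -> continuous (fun x => snd (f x)) t.
Proof.
  intros H. apply filterlim_locally. intros eps.
  pose proof (proj1 (filterlim_locally _ _) H eps) as He.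
  revert He. apply filter_imp. intros x [Ha Hb]. assumption.
Qed.

Lemma Ccontinuous_Cmod (f : R -> C) t : Ccontinuous f t -> continuous (fun x => Cmod (f x)) t.
Proof.
  intros H. unfold Cmod.
  apply continuous_comp with (g := sqrt).
  - apply (continuous_plus (V := R_NormedModule)); simpl;
    apply (continuous_mult (K := R_AbsRing)); try (apply (continuous_mult (K := R_AbsRing)));
    try apply continuous_const; auto using Ccontinuous_fst, Ccontinuous_snd.
  - apply continuous_sqrt.
Qed.

Lemma Cmod_le_abs (z : C) : Cmod z <= Rabs (fst z) + Rabs (snd z).
Proof.
  unfold Cmod. pose proof (Rabs_pos (fst z)). pose proof (Rabs_pos (snd z)).
  apply Rle_trans with (sqrt ((Rabs (fst z) + Rabs (snd z)) ^ 2)).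
  - apply sqrt_le_1_alt. rewrite (pow2_abs (fst z)) || idtac.
    pose proof (pow2_abs (fst z)). pose proof (pow2_abs (snd z)). nra.
  - rewrite sqrt_pow2; lra.
Qed.

Lemma abs_fst_le_Cmod (z : C) : Rabs (fst z) <= Cmod z.
Proof. exact (re_le_Cmod z). Qed.

Lemma abs_snd_le_Cmod (z : C) : Rabs (snd z) <= Cmod z.
Proof. eapply Rle_trans; [apply Rmax_r | apply Rmax_Cmod]. Qed.

Lemma Cmod_minus_ge (x y : C) : Cmod x - Cmod y <= Cmod (x - y).
Proof.
  pose proof (Cmod_triangle (x - y) y). replace (x - y + y)%C with x in H by ring. lra.
Qed.

Lemma Cmod_minus_sym (x y : C) : Cmod (x - y) = Cmod (y - x).
Proof. rewrite <- Cmod_opp. f_equal. ring. Qed.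

Lemma Cmod_minus_le (x y : C) : Cmod (x - y) <= Cmod x + Cmod y.
Proof. unfold Cminus. rewrite <- (Cmod_opp y). apply Cmod_triangle. Qed.

Lemma is_RInt_antideriv (F f : R -> R) a b : a <= b ->
  (forall x, a <= x <= b -> is_derive F x (f x)) ->
  (forall x, a <= x <= b -> ex_derive f x) ->
  is_RInt f a b (F b - F a).
Proof.
  intros Hab HF Hf. apply (@is_RInt_derive R_CompleteNormedModule F f a b);
    intros x; rewrite Rmin_left, Rmax_right by lra; intros Hx.
  - exact (HF x Hx).
  - apply (ex_derive_continuous (K := R_AbsRing) (V := R_NormedModule)). exact (Hf x Hx).
Qed.

(** * Cauchy's theorem on rectangles *)

(** Complex differentiability with explicit moduli, in place of the filter-based [ex_derive] of the
    statement; [zeta_Cdiff] makes the transition. *)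
Definition Cdiff (f : C -> C) (z : C) : Prop :=
  exists l : C, forall eps, 0 < eps -> exists delta, 0 < delta /\
    forall z', Cmod (z' - z) < delta ->
      Cmod (f z' - f z - l * (z' - z))%C <= eps * Cmod (z' - z).

Definition Ccont (f : C -> C) (z : C) : Prop :=
  forall eps, 0 < eps -> exists delta, 0 < delta /\
    forall z', Cmod (z' - z) < delta -> Cmod (f z' - f z) < eps.

Lemma Cdiff_locally_bounded f z : Cdiff f z ->
  exists K delta, 0 < K /\ 0 < delta /\
    forall z', Cmod (z' - z) < delta -> Cmod (f z' - f z) <= K * Cmod (z' - z).
Proof.
  intros [l Hl]. destruct (Hl 1 Rlt_0_1) as [d [Hd H]].
  exists (Cmod l + 1), d. pose proof (Cmod_ge_0 l). split; [lra|]. split; [exact Hd|].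
  intros z' Hz. specialize (H z' Hz).
  replace (f z' - f z)%C with ((f z' - f z - l * (z' - z)) + l * (z' - z))%C by ring.
  eapply Rle_trans; [apply Cmod_triangle|]. rewrite Cmod_mult. lra.
Qed.

Lemma Cdiff_cont f z : Cdiff f z -> Ccont f z.
Proof.
  intros H. destruct (Cdiff_locally_bounded f z H) as [K [d [HK [Hd B]]]].
  intros eps He. exists (Rmin d (eps / (2 * K))). split.
  - apply Rmin_pos; auto. apply Rdiv_lt_0_compat; lra.
  - intros z' Hz. assert (H1 : Cmod (z' - z) < d) by (eapply Rlt_le_trans; [exact Hz|apply Rmin_l]).
    assert (H2 : Cmod (z' - z) < eps / (2 * K)) by (eapply Rlt_le_trans; [exact Hz|apply Rmin_r]).
    eapply Rle_lt_trans; [apply B; auto|].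
    apply Rle_lt_trans with (K * (eps / (2 * K))).
    + apply Rmult_le_compat_l; lra.
    + replace (K * (eps / (2 * K))) with (eps / 2) by (field; lra). lra.
Qed.

Lemma Ccont_comp_path (f : C -> C) (g : R -> C) t : Ccont f (g t) ->
  (forall t', Cmod (g t' - g t) <= Rabs (t' - t)) ->
  Ccontinuous (fun x => f (g x)) t.
Proof.
  intros Hf Hg. apply filterlim_locally. intros eps.
  destruct (Hf eps (cond_pos eps)) as [d [Hd H]].
  exists (mkposreal d Hd). intros t' Ht'. apply C_NormedModule_mixin_compat1.
  apply H. eapply Rle_lt_trans; [apply Hg|]. exact Ht'.
Qed.

Definition in_rect (a b c d : R) (z : C) : Prop := a <= fst z <= b /\ c <= snd z <= d.

Definition on_bdry (a b c d : R) (z : C) : Prop :=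
  (a <= fst z <= b /\ (snd z = c \/ snd z = d)) \/
  (c <= snd z <= d /\ (fst z = a \/ fst z = b)).

(** Counterclockwise: bottom, right, top and left side, with i dy on the vertical ones. *)
Definition oint (f : C -> C) (a b c d : R) : C :=
  (CInt (fun x => f (x, c)) a b + Ci * CInt (fun y => f (b, y)) c d
   - CInt (fun x => f (x, d)) a b - Ci * CInt (fun y => f (a, y)) c d)%C.

Lemma Cmod_real_diff (x x' y : R) : Cmod ((x', y) - (x, y))%C <= Rabs (x' - x).
Proof.
  eapply Rle_trans; [apply Cmod_le_abs|]. simpl.
  replace (y + - y) with 0 by ring. rewrite Rabs_R0. unfold Rminus. lra.
Qed.

Lemma Cmod_imag_diff (x y y' : R) : Cmod ((x, y') - (x, y))%C <= Rabs (y' - y).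
Proof.
  eapply Rle_trans; [apply Cmod_le_abs|]. simpl.
  replace (x + - x) with 0 by ring. rewrite Rabs_R0. unfold Rminus. lra.
Qed.

Lemma ex_CInt_hor f a b y : a <= b ->
  (forall x, a <= x <= b -> Ccont f (x, y)) -> ex_CInt (fun x => f (x, y)) a b.
Proof.
  intros Hab H. apply ex_CInt_continuous; auto. intros t Ht.
  apply Ccont_comp_path with (g := fun x => (x, y)); auto.
  intros t'. apply Cmod_real_diff.
Qed.

Lemma ex_CInt_ver f c d x : c <= d ->
  (forall y, c <= y <= d -> Ccont f (x, y)) -> ex_CInt (fun y => f (x, y)) c d.
Proof.
  intros Hab H. apply ex_CInt_continuous; auto. intros t Ht.
  apply Ccont_comp_path with (g := fun y => (x, y)); auto.
  intros t'. apply Cmod_imag_diff.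
Qed.

Ltac side_int := match goal with
  | |- ex_RInt (fun x => ?F (x, ?y)) _ _ => apply (ex_CInt_hor F)
  | |- ex_RInt (fun y => ?F (?x, y)) _ _ => apply (ex_CInt_ver F)
  end.

Lemma oint_split_h f a m b c d : a <= m <= b -> c <= d ->
  (forall z, on_bdry a b c d z -> Ccont f z) ->
  oint f a b c d = (oint f a m c d + oint f m b c d)%C.
Proof.
  intros Hm Hc H. unfold oint.
  rewrite <- (CInt_Chasles (fun x => f (x, c)) a m b), <- (CInt_Chasles (fun x => f (x, d)) a m b).
  1: ring.
  all: side_int; [lra|]; intros x Hx; apply H; left; simpl; split; [lra|tauto].
Qed.

Lemma oint_split_v f a b c m d : a <= b -> c <= m <= d ->
  (forall z, on_bdry a b c d z -> Ccont f z) ->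
  oint f a b c d = (oint f a b c m + oint f a b m d)%C.
Proof.
  intros Hm Hc H. unfold oint.
  rewrite <- (CInt_Chasles (fun y => f (a, y)) c m d), <- (CInt_Chasles (fun y => f (b, y)) c m d).
  1: ring.
  all: side_int; [lra|]; intros x Hx; apply H; right; simpl; split; [lra|tauto].
Qed.

Lemma oint_minus f g a b c d : a <= b -> c <= d ->
  (forall z, on_bdry a b c d z -> Ccont f z) -> (forall z, on_bdry a b c d z -> Ccont g z) ->
  oint (fun z => (f z - g z)%C) a b c d = (oint f a b c d - oint g a b c d)%C.
Proof.
  intros Hab Hcd Hf Hg. unfold oint.
  rewrite (CInt_minus (fun x => f (x, c)) (fun x => g (x, c))),
    (CInt_minus (fun x => f (x, d)) (fun x => g (x, d))),
    (CInt_minus (fun y => f (a, y)) (fun y => g (a, y))),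
    (CInt_minus (fun y => f (b, y)) (fun y => g (b, y))).
  1: ring.
  all: side_int; [lra|]; intros x Hx; first [apply Hf | apply Hg];
    unfold on_bdry; simpl; tauto.
Qed.

Lemma oint_Cmult k f a b c d : a <= b -> c <= d ->
  (forall z, on_bdry a b c d z -> Ccont f z) ->
  oint (fun z => (k * f z)%C) a b c d = (k * oint f a b c d)%C.
Proof.
  intros Hab Hcd Hf. unfold oint.
  rewrite (CInt_Cmult k (fun x => f (x, c))), (CInt_Cmult k (fun x => f (x, d))),
    (CInt_Cmult k (fun y => f (a, y))), (CInt_Cmult k (fun y => f (b, y))).
  1: ring.
  all: side_int; [lra|]; intros x Hx; apply Hf;
    unfold on_bdry; simpl; tauto.
Qed.

Lemma CInt_ext (f g : R -> C) a b : (forall x, Rmin a b < x < Rmax a b -> f x = g x) ->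
  CInt f a b = CInt g a b.
Proof. exact (@RInt_ext C_R_CompleteNormedModule f g a b). Qed.

Lemma oint_ext f g a b c d : a <= b -> c <= d ->
  (forall z, on_bdry a b c d z -> f z = g z) ->
  oint f a b c d = oint g a b c d.
Proof.
  intros Hab Hcd H. unfold oint.
  rewrite (CInt_ext (fun x => f (x, c)) (fun x => g (x, c))),
    (CInt_ext (fun x => f (x, d)) (fun x => g (x, d))),
    (CInt_ext (fun y => f (a, y)) (fun y => g (a, y))),
    (CInt_ext (fun y => f (b, y)) (fun y => g (b, y))); [reflexivity|..];
  intros x; rewrite Rmin_left, Rmax_right by lra; intros Hx; apply H; unfold on_bdry; simpl;
    assert (a <= x <= b \/ c <= x <= d) by lra; lra.
Qed.

Lemma oint_bound f M a b c d : a <= b -> c <= d ->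
  (forall z, on_bdry a b c d z -> Ccont f z) ->
  (forall z, on_bdry a b c d z -> Cmod (f z) <= M) ->
  Cmod (oint f a b c d) <= 2 * ((b - a) + (d - c)) * M.
Proof.
  intros Hab Hcd Hf HM. unfold oint.
  assert (H1 : Cmod (CInt (fun x => f (x, c)) a b) <= (b - a) * M).
  { apply Cmod_CInt_le_const; auto; [apply ex_CInt_hor; auto|]; intros;
      (apply Hf || apply HM); unfold on_bdry; simpl; tauto. }
  assert (H2 : Cmod (CInt (fun x => f (x, d)) a b) <= (b - a) * M).
  { apply Cmod_CInt_le_const; auto; [apply ex_CInt_hor; auto|]; intros;
      (apply Hf || apply HM); unfold on_bdry; simpl; tauto. }
  assert (H3 : Cmod (CInt (fun y => f (a, y)) c d) <= (d - c) * M).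
  { apply Cmod_CInt_le_const; auto; [apply ex_CInt_ver; auto|]; intros;
      (apply Hf || apply HM); unfold on_bdry; simpl; tauto. }
  assert (H4 : Cmod (CInt (fun y => f (b, y)) c d) <= (d - c) * M).
  { apply Cmod_CInt_le_const; auto; [apply ex_CInt_ver; auto|]; intros;
      (apply Hf || apply HM); unfold on_bdry; simpl; tauto. }
  eapply Rle_trans; [apply Cmod_minus_le|]. eapply Rle_trans; [apply Rplus_le_compat_r, Cmod_minus_le|].
  eapply Rle_trans; [apply Rplus_le_compat_r, Rplus_le_compat_r, Cmod_triangle|].
  rewrite !Cmod_mult, Cmod_Ci. lra.
Qed.

Lemma Cdiff_affine (p q : C) z : Cdiff (fun z => p + q * z)%C z.
Proof.
  exists q. intros eps He. exists 1. split; [lra|]. intros z' _.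
  replace (p + q * z' - (p + q * z) - q * (z' - z))%C with (RtoC 0) by ring.
  rewrite Cmod_0. apply Rmult_le_pos; [lra|apply Cmod_ge_0].
Qed.

Lemma is_RInt_affine (p q a b : R) : a <= b ->
  is_RInt (fun x => p + q * x) a b (p * (b - a) + q * (b ^ 2 - a ^ 2) / 2).
Proof.
  intros Hab.
  replace (p * (b - a) + q * (b ^ 2 - a ^ 2) / 2)
    with ((p * b + q * b ^ 2 / 2) - (p * a + q * a ^ 2 / 2)) by field.
  apply (is_RInt_antideriv (fun x => p * x + q * x ^ 2 / 2)); auto; intros x _.
  - auto_derive; auto. field.
  - auto_derive; auto.
Qed.

Lemma oint_affine (p q : C) a b c d : a <= b -> c <= d ->
  oint (fun z => p + q * z)%C a b c d = RtoC 0.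
Proof.
  intros Hab Hcd. destruct p as [p1 p2], q as [q1 q2]. unfold oint.
  assert (Hx : forall y, CInt (fun x => ((p1, p2) + (q1, q2) * (x, y))%C) a b =
    ((p1 - q2 * y) * (b - a) + q1 * (b ^ 2 - a ^ 2) / 2,
     (p2 + q1 * y) * (b - a) + q2 * (b ^ 2 - a ^ 2) / 2)).
  { intros y. apply (@is_RInt_unique C_R_CompleteNormedModule), is_CInt_pair.
    - eapply is_RInt_ext; [|apply is_RInt_affine; assumption]. intros x _. simpl. ring.
    - eapply is_RInt_ext; [|apply is_RInt_affine; assumption]. intros x _. simpl. ring. }
  assert (Hy : forall x, CInt (fun y => ((p1, p2) + (q1, q2) * (x, y))%C) c d =
    ((p1 + q1 * x) * (d - c) + (- q2) * (d ^ 2 - c ^ 2) / 2,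
     (p2 + q2 * x) * (d - c) + q1 * (d ^ 2 - c ^ 2) / 2)).
  { intros y. apply (@is_RInt_unique C_R_CompleteNormedModule), is_CInt_pair.
    - eapply is_RInt_ext; [|apply is_RInt_affine; assumption]. intros x _. simpl. ring.
    - eapply is_RInt_ext; [|apply is_RInt_affine; assumption]. intros x _. simpl. ring. }
  rewrite !Hx, !Hy. unfold Ci, RtoC, Cplus, Cminus, Cmult, Copp, Cplus. simpl.
  f_equal; field.
Qed.

Lemma nested_halving (x : nat -> R) (W : R) : 0 <= W ->
  (forall n, x n <= x (S n)) -> (forall n, x (S n) + W / 2 ^ (S n) <= x n + W / 2 ^ n) ->
  exists X, forall n, x n <= X <= x n + W / 2 ^ n.
Proof.
  intros HW H1 H2.
  assert (Hmono : forall n k, x n <= x (n + k)%nat).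
  { intros n k. induction k. - rewrite Nat.add_0_r. lra.
    - rewrite Nat.add_succ_r. eapply Rle_trans; [exact IHk|apply H1]. }
  assert (Hdec : forall n k, x (n + k)%nat + W / 2 ^ (n + k) <= x n + W / 2 ^ n).
  { intros n k. induction k. - rewrite Nat.add_0_r. lra.
    - rewrite Nat.add_succ_r. eapply Rle_trans; [apply H2|exact IHk]. }
  assert (Hpos : forall n, 0 <= W / 2 ^ n).
  { intros n. apply Rdiv_le_0_compat; auto. apply pow_lt; lra. }
  assert (Hub : forall n m, x m <= x n + W / 2 ^ n).
  { intros n m. pose proof (Hmono m n). pose proof (Hdec n m).
    rewrite (Nat.add_comm m n) in H. pose proof (Hpos (n + m)%nat). lra. }
  destruct (completeness (fun r => exists n, r = x n)) as [X [HX1 HX2]].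
  - exists (x 0%nat + W / 2 ^ 0). intros r [n ->]. apply Hub.
  - exists (x 0%nat), 0%nat. reflexivity.
  - exists X. intros n. split. + apply HX1. exists n; reflexivity.
    + apply HX2. intros r [m ->]. apply Hub.
Qed.

(** * Goursat's lemma by repeated quartering *)

Section Goursat.
Variables (f : C -> C) (a b c d : R).
Hypothesis Hab : a <= b.
Hypothesis Hcd : c <= d.
Hypothesis Hf : forall z, in_rect a b c d z -> Cdiff f z.

Let w n := (b - a) / 2 ^ n.
Let h n := (d - c) / 2 ^ n.
Let cell n (p : R * R) := oint f (fst p) (fst p + w n) (snd p) (snd p + h n).
(** The lower left corner of a quarter that carries at least a fourth of the integral. The upper
    right quarter is the default: if the other three fail, the triangle inequality makes it
    qualify. *)
Let next n (p : R * R) : R * R :=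
  let t := Cmod (cell n p) / 4 in
  let p2 := (fst p + w (S n), snd p) in
  let p3 := (fst p, snd p + h (S n)) in
  if Rle_dec t (Cmod (cell (S n) p)) then p
  else if Rle_dec t (Cmod (cell (S n) p2)) then p2
  else if Rle_dec t (Cmod (cell (S n) p3)) then p3
  else (fst p + w (S n), snd p + h (S n)).
Let corner := fix corner n := match n with O => (a, c) | S n => next n (corner n) end.

Local Lemma half_step x n : x / 2 ^ n = x / 2 ^ (S n) + x / 2 ^ (S n).
Proof. simpl. field. apply pow_nonzero. lra. Qed.

Local Lemma w_pos n : 0 <= w n.
Proof. apply Rdiv_le_0_compat; [lra|apply pow_lt; lra]. Qed.

Local Lemma h_pos n : 0 <= h n.
Proof. apply Rdiv_le_0_compat; [lra|apply pow_lt; lra]. Qed.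

Local Lemma next_spec n p :
  (fst (next n p) = fst p \/ fst (next n p) = fst p + w (S n)) /\
  (snd (next n p) = snd p \/ snd (next n p) = snd p + h (S n)).
Proof.
  unfold next. repeat destruct (Rle_dec _ _); simpl; auto.
Qed.

Local Lemma next_large n p :
  (forall z, in_rect (fst p) (fst p + w n) (snd p) (snd p + h n) z -> in_rect a b c d z) ->
  Cmod (cell n p) <= 4 * Cmod (cell (S n) (next n p)).
Proof.
  intros Hin.
  pose proof (w_pos (S n)) as Hw. pose proof (h_pos (S n)) as Hh.
  pose proof (half_step (b - a) n : w n = w (S n) + w (S n)) as Ew.
  pose proof (half_step (d - c) n : h n = h (S n) + h (S n)) as Eh.
  assert (Hc : forall z, in_rect (fst p) (fst p + w n) (snd p) (snd p + h n) z -> Ccont f z).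
  { intros z Hz. apply Cdiff_cont, Hf, Hin, Hz. }
  set (p2 := (fst p + w (S n), snd p)). set (p3 := (fst p, snd p + h (S n))).
  set (p4 := (fst p + w (S n), snd p + h (S n))).
  assert (E : cell n p = (cell (S n) p + cell (S n) p3 + (cell (S n) p2 + cell (S n) p4))%C).
  { unfold cell, p2, p3, p4. simpl fst. simpl snd.
    rewrite (oint_split_h f (fst p) (fst p + w (S n)) (fst p + w n)); try lra.
    rewrite (oint_split_v f (fst p) (fst p + w (S n)) (snd p) (snd p + h (S n)) (snd p + h n)); try lra.
    rewrite (oint_split_v f (fst p + w (S n)) (fst p + w n) (snd p) (snd p + h (S n)) (snd p + h n)); try lra.
    - rewrite Ew, Eh, <- !Rplus_assoc. reflexivity.
    - intros z Hz. apply Hc. unfold on_bdry in Hz. unfold in_rect. lra.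
    - intros z Hz. apply Hc. unfold on_bdry in Hz. unfold in_rect. lra.
    - intros z Hz. apply Hc. unfold on_bdry in Hz. unfold in_rect. lra. }
  assert (Ht : Cmod (cell n p) <= Cmod (cell (S n) p) + Cmod (cell (S n) p3)
     + (Cmod (cell (S n) p2) + Cmod (cell (S n) p4))).
  { rewrite E at 1. eapply Rle_trans; [apply Cmod_triangle|].
    apply Rplus_le_compat; apply Cmod_triangle. }
  unfold next. fold p2 p3 p4. repeat destruct (Rle_dec _ _); try lra.
Qed.

Local Lemma corner_in n z :
  in_rect (fst (corner n)) (fst (corner n) + w n) (snd (corner n)) (snd (corner n) + h n) z ->
  in_rect a b c d z.
Proof.
  revert z. induction n; intros z.
  - simpl. unfold w, h, in_rect. simpl. intros H. lra.
  - intros H. apply IHn. simpl in H.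
    pose proof (half_step (b - a) n : w n = w (S n) + w (S n)) as Ew.
    pose proof (half_step (d - c) n : h n = h (S n) + h (S n)) as Eh.
    pose proof (w_pos (S n)) as Hw. pose proof (h_pos (S n)) as Hh.
    destruct (next_spec n (corner n)) as [[E1|E1] [E2|E2]]; rewrite E1, E2 in H;
      unfold in_rect in *; lra.
Qed.

Local Lemma corner_large n : Cmod (oint f a b c d) <= 4 ^ n * Cmod (cell n (corner n)).
Proof.
  induction n.
  - unfold cell, w, h. simpl. replace (a + (b - a) / 1) with b by field.
    replace (c + (d - c) / 1) with d by field. lra.
  - eapply Rle_trans; [exact IHn|]. pose proof (next_large n (corner n) (corner_in n)).
    simpl. pose proof (pow_lt 4 n ltac:(lra)). nra.
Qed.

Lemma goursat : oint f a b c d = RtoC 0.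
Proof.
  destruct (nested_halving (fun n => fst (corner n)) (b - a)) as [X HX]; [lra|..].
  { intros n. simpl. pose proof (w_pos (S n)). destruct (next_spec n (corner n)) as [[E|E] _]; lra. }
  { intros n. pose proof (w_pos (S n)). simpl corner.
    pose proof (half_step (b - a) n). unfold w in *.
    destruct (next_spec n (corner n)) as [[E|E] _]; rewrite E; unfold w in *; lra. }
  destruct (nested_halving (fun n => snd (corner n)) (d - c)) as [Y HY]; [lra|..].
  { intros n. simpl. pose proof (h_pos (S n)). destruct (next_spec n (corner n)) as [_ [E|E]]; lra. }
  { intros n. pose proof (h_pos (S n)). simpl corner.
    pose proof (half_step (d - c) n). unfold h in *.
    destruct (next_spec n (corner n)) as [_ [E|E]]; rewrite E; unfold h in *; lra. }
  fold w in HX. fold h in HY.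
  set (zs := (X, Y) : C).
  assert (Hzs : forall n, in_rect (fst (corner n)) (fst (corner n) + w n) (snd (corner n)) (snd (corner n) + h n) zs).
  { intros n. split; simpl; [apply (HX n)|apply (HY n)]. }
  destruct (Hf zs (corner_in 0 zs (Hzs 0%nat))) as [l Hl].
  set (s := (b - a) + (d - c)).
  assert (Hs : 0 <= s) by (unfold s; lra).
  assert (Key : forall eps, 0 < eps -> Cmod (oint f a b c d) <= eps * (2 * s ^ 2)).
  { intros eps He. destruct (Hl eps He) as [delta [Hd Hdl]].
    assert (Hn : exists n, s / 2 ^ n < delta).
    { destruct (pow_lt_1_zero (/ 2) ltac:(rewrite Rabs_pos_eq; lra) (delta / (s + 1))
        ltac:(apply Rdiv_lt_0_compat; lra)) as [n Hn].
      exists n. specialize (Hn n (Nat.le_refl n)). rewrite pow_inv in Hn.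
      rewrite Rabs_pos_eq in Hn by (apply Rlt_le, Rinv_0_lt_compat, pow_lt; lra).
      apply (Rmult_lt_compat_r (s + 1)) in Hn; [|lra].
      replace (delta / (s + 1) * (s + 1)) with delta in Hn by (field; lra).
      pose proof (Rinv_0_lt_compat (2 ^ n) (pow_lt 2 n ltac:(lra))). unfold Rdiv. nra. }
    destruct Hn as [n Hn].
    eapply Rle_trans; [apply (corner_large n)|].
    set (p := corner n) in *. unfold cell.
    pose proof (w_pos n) as Hw. pose proof (h_pos n) as Hh.
    assert (Esn : w n + h n = s / 2 ^ n) by (unfold w, h, s; field; apply pow_nonzero; lra).
    (* Subtracting the tangent at the limit point [zs] leaves the integral unchanged, since affine
       functions integrate to 0. What remains is at most [eps] times the distance to [zs], so the
       bound is quadratic in the size of the cell and cancels the factor 4^n. *)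
    set (r := fun z => (f z - ((f zs - l * zs) + l * z))%C).
    assert (Hbr : forall z, on_bdry (fst p) (fst p + w n) (snd p) (snd p + h n) z ->
               in_rect (fst p) (fst p + w n) (snd p) (snd p + h n) z).
    { intros z. unfold on_bdry, in_rect. lra. }
    assert (Hr : oint r (fst p) (fst p + w n) (snd p) (snd p + h n)
      = oint f (fst p) (fst p + w n) (snd p) (snd p + h n)).
    { unfold r. rewrite oint_minus; try lra.
      - rewrite oint_affine by lra. ring.
      - intros z Hz. apply Cdiff_cont, Hf, (corner_in n), Hbr, Hz.
      - intros z Hz. apply Cdiff_cont, Cdiff_affine. }
    rewrite <- Hr.
    assert (Hb : Cmod (oint r (fst p) (fst p + w n) (snd p) (snd p + h n)) <=
       2 * (fst p + w n - fst p + (snd p + h n - snd p)) * (eps * (w n + h n))).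
    { apply oint_bound; try lra.
      - intros z Hz eta Heta.
        destruct (Cdiff_cont f z (Hf z (corner_in n z (Hbr z Hz))) (eta / 2) ltac:(lra)) as [d1 [Hd1 H1]].
        destruct (Cdiff_cont _ z (Cdiff_affine (f zs - l * zs)%C l z) (eta / 2) ltac:(lra)) as [d2 [Hd2 H2]].
        exists (Rmin d1 d2). split; [apply Rmin_pos; auto|]. intros z' Hz'.
        specialize (H1 z' (Rlt_le_trans _ _ _ Hz' (Rmin_l _ _))).
        specialize (H2 z' (Rlt_le_trans _ _ _ Hz' (Rmin_r _ _))).
        unfold r. match goal with |- Cmod ?x < _ =>
          replace x with ((f z' - f z) - ((f zs - l * zs + l * z') - (f zs - l * zs + l * z)))%C by ring end.
        eapply Rle_lt_trans; [apply Cmod_minus_le|]. lra.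
      - intros z Hz. specialize (Hbr z Hz). unfold r.
        replace (f z - (f zs - l * zs + l * z))%C with (f z - f zs - l * (z - zs))%C by ring.
        assert (Hdist : Cmod (z - zs) <= w n + h n).
        { eapply Rle_trans; [apply Cmod_le_abs|]. specialize (Hzs n). fold p in Hzs.
          unfold in_rect in *. simpl in *.
          apply Rplus_le_compat; apply Rabs_le; lra. }
        eapply Rle_trans; [apply Hdl; lra|].
        apply Rmult_le_compat_l; lra. }
    apply Rle_trans with (4 ^ n * (2 * (w n + h n) * (eps * (w n + h n)))).
    { apply Rmult_le_compat_l; [apply pow_le; lra|]. eapply Rle_trans; [exact Hb|]. apply Req_le. ring. }
    rewrite Esn. replace (4 ^ n) with (2 ^ n * 2 ^ n).
    - apply Req_le. field. apply pow_nonzero; lra.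
    - rewrite <- Rpow_mult_distr. f_equal. }
  apply Cmod_eq_0. apply Rle_antisym; [|apply Cmod_ge_0].
  apply le_epsilon. intros eps He. rewrite Rplus_0_l.
  eapply Rle_trans; [apply (Key (eps / (2 * s ^ 2 + 1)))|].
  - apply Rdiv_lt_0_compat; nra.
  - unfold Rdiv. rewrite Rmult_assoc. rewrite <- (Rmult_1_r eps) at 2.
    apply Rmult_le_compat_l; [lra|]. rewrite Rmult_comm. apply Rle_div_l; nra.
Qed.
End Goursat.


(** * Rules for continuity and complex differentiability *)

Lemma Ccont_const (k : C) z : Ccont (fun _ => k) z.
Proof.
  intros eps He. exists 1. split; [lra|]. intros z' _.
  replace (k - k)%C with (RtoC 0) by ring. now rewrite Cmod_0.
Qed.

Lemma Ccont_plus f g z : Ccont f z -> Ccont g z -> Ccont (fun z => f z + g z)%C z.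
Proof.
  intros Hf Hg eps He.
  destruct (Hf (eps / 2) ltac:(lra)) as [d1 [Hd1 H1]].
  destruct (Hg (eps / 2) ltac:(lra)) as [d2 [Hd2 H2]].
  exists (Rmin d1 d2). split; [apply Rmin_pos; auto|]. intros z' Hz'.
  specialize (H1 z' (Rlt_le_trans _ _ _ Hz' (Rmin_l _ _))).
  specialize (H2 z' (Rlt_le_trans _ _ _ Hz' (Rmin_r _ _))).
  replace (f z' + g z' - (f z + g z))%C with ((f z' - f z) + (g z' - g z))%C by ring.
  eapply Rle_lt_trans; [apply Cmod_triangle|]. lra.
Qed.

Lemma Ccont_mult f g z : Ccont f z -> Ccont g z -> Ccont (fun z => f z * g z)%C z.
Proof.
  intros Hf Hg eps He.
  set (A := Cmod (f z)). set (B := Cmod (g z)).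
  assert (HA : 0 <= A) by apply Cmod_ge_0. assert (HB : 0 <= B) by apply Cmod_ge_0.
  set (e := Rmin 1 (eps / (A + B + 2))).
  assert (He0 : 0 < e) by (apply Rmin_pos; [lra|apply Rdiv_lt_0_compat; lra]).
  assert (He1 : e <= 1) by apply Rmin_l.
  assert (He2 : e * (A + B + 2) <= eps).
  { apply Rle_trans with (eps / (A + B + 2) * (A + B + 2)).
    - apply Rmult_le_compat_r; [lra|apply Rmin_r].
    - apply Req_le. field. lra. }
  destruct (Hf e He0) as [d1 [Hd1 H1]].
  destruct (Hg e He0) as [d2 [Hd2 H2]].
  exists (Rmin d1 d2). split; [apply Rmin_pos; auto|]. intros z' Hz'.
  specialize (H1 z' (Rlt_le_trans _ _ _ Hz' (Rmin_l _ _))).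
  specialize (H2 z' (Rlt_le_trans _ _ _ Hz' (Rmin_r _ _))).
  replace (f z' * g z' - f z * g z)%C
    with ((f z' - f z) * (g z' - g z) + ((f z' - f z) * g z + f z * (g z' - g z)))%C by ring.
  eapply Rle_lt_trans; [apply Cmod_triangle|].
  eapply Rle_lt_trans; [apply Rplus_le_compat_l, Cmod_triangle|].
  rewrite !Cmod_mult. fold A B.
  pose proof (Cmod_ge_0 (f z' - f z)). pose proof (Cmod_ge_0 (g z' - g z)). nra.
Qed.

Lemma Ccont_comp f g z : Ccont f (g z) -> Ccont g z -> Ccont (fun z => f (g z)) z.
Proof.
  intros Hf Hg eps He. destruct (Hf eps He) as [d1 [Hd1 H1]].
  destruct (Hg d1 Hd1) as [d2 [Hd2 H2]]. exists d2. auto.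
Qed.

Lemma Ccont_inv z : z <> RtoC 0 -> Ccont Cinv z.
Proof.
  intros Hz eps He. pose proof (proj1 (Cmod_gt_0 z) Hz) as Hp.
  exists (Rmin (Cmod z / 2) (eps * Cmod z ^ 2 / 4)). split.
  { apply Rmin_pos; [lra|]. apply Rdiv_lt_0_compat; [|lra].
    apply Rmult_lt_0_compat; [exact He|apply pow_lt, Hp]. }
  intros z' Hd. pose proof (Rlt_le_trans _ _ _ Hd (Rmin_l _ _)) as H1.
  pose proof (Rlt_le_trans _ _ _ Hd (Rmin_r _ _)) as H2.
  assert (Hz' : Cmod z / 2 <= Cmod z').
  { pose proof (Cmod_minus_ge z z'). rewrite Cmod_minus_sym in H. lra. }
  assert (Hn : z' <> RtoC 0) by (apply Cmod_gt_0; lra).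
  replace (/ z' - / z)%C with (- (z' - z) * (/ z' * / z))%C by (field; auto).
  rewrite !Cmod_mult, Cmod_opp, !Cmod_inv by auto.
  apply Rle_lt_trans with (Cmod (z' - z) * (/ (Cmod z / 2) * / Cmod z)).
  - apply Rmult_le_compat_l; [apply Cmod_ge_0|]. apply Rmult_le_compat_r.
    + left. apply Rinv_0_lt_compat, Hp. + apply Rinv_le_contravar; lra.
  - replace (/ (Cmod z / 2) * / Cmod z) with (2 / Cmod z ^ 2) by (field; lra).
    apply Rlt_le_trans with (eps * Cmod z ^ 2 / 4 * (2 / Cmod z ^ 2)).
    + apply Rmult_lt_compat_r; [|exact H2]. apply Rdiv_lt_0_compat; [lra|apply pow_lt, Hp].
    + replace (eps * Cmod z ^ 2 / 4 * (2 / Cmod z ^ 2)) with (eps / 2) by (field; lra). lra.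
Qed.

(* Caratheodory's form of differentiability, for which the calculus rules are
   rules about continuity. *)
Lemma Cdiff_slope f z : Cdiff f z <->
  exists phi, Ccont phi z /\ forall z', f z' = (f z + phi z' * (z' - z))%C.
Proof.
  split.
  - intros [l Hl].
    exists (fun z' => if Ceq_dec z' z then l else ((f z' - f z) / (z' - z))%C). split.
    + intros eps He. destruct (Hl (eps / 2) ltac:(lra)) as [d [Hd H]].
      exists d. split; auto. intros z' Hz'.
      destruct (Ceq_dec z z) as [_|N]; [|congruence].
      destruct (Ceq_dec z' z) as [E|N].
      * replace (l - l)%C with (RtoC 0) by ring. now rewrite Cmod_0.
      * assert (N' : (z' - z)%C <> RtoC 0).
        { intros E. apply N. replace z' with ((z' - z) + z)%C by ring. rewrite E. ring. }
        replace ((f z' - f z) / (z' - z) - l)%C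
          with ((f z' - f z - l * (z' - z)) / (z' - z))%C by (field; auto).
        pose proof (proj1 (Cmod_gt_0 _) N').
        rewrite Cmod_div by auto. apply Rle_lt_trans with (eps / 2); [|lra].
        apply Rle_div_l; auto.
    + intros z'. destruct (Ceq_dec z' z) as [->|N]; [ring|]. field.
      intros E. apply N. replace z' with ((z' - z) + z)%C by ring. rewrite E. ring.
  - intros [phi [Hc Hp]]. exists (phi z). intros eps He.
    destruct (Hc eps He) as [d [Hd H]]. exists d. split; auto. intros z' Hz'.
    rewrite (Hp z'). replace (f z + phi z' * (z' - z) - f z - phi z * (z' - z))%C
      with ((phi z' - phi z) * (z' - z))%C by ring.
    rewrite Cmod_mult. apply Rmult_le_compat_r; [apply Cmod_ge_0|]. left. auto.
Qed.

Lemma Cdiff_plus f g z : Cdiff f z -> Cdiff g z -> Cdiff (fun z => f z + g z)%C z.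
Proof.
  rewrite !Cdiff_slope. intros [p [Hp Ep]] [q [Hq Eq]].
  exists (fun z' => p z' + q z')%C. split; [apply Ccont_plus; auto|].
  intros z'. rewrite (Ep z'), (Eq z'). ring.
Qed.

Lemma Cdiff_mult f g z : Cdiff f z -> Cdiff g z -> Cdiff (fun z => f z * g z)%C z.
Proof.
  intros Hf Hg. pose proof (Cdiff_cont g z Hg) as Cg. revert Hf Hg.
  rewrite !Cdiff_slope. intros [p [Hp Ep]] [q [Hq Eq]].
  exists (fun z' => p z' * g z' + f z * q z')%C. split.
  - apply Ccont_plus; apply Ccont_mult; auto using Ccont_const.
  - intros z'. rewrite (Ep z'), (Eq z'). ring.
Qed.

Lemma Cdiff_comp f g z : Cdiff f (g z) -> Cdiff g z -> Cdiff (fun z => f (g z)) z.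
Proof.
  intros Hf Hg. pose proof (Cdiff_cont g z Hg) as Cg. revert Hf Hg.
  rewrite !Cdiff_slope. intros [p [Hp Ep]] [q [Hq Eq]].
  exists (fun z' => p (g z') * q z')%C. split.
  - apply Ccont_mult; auto. apply Ccont_comp; auto.
  - intros z'. rewrite (Ep (g z')). rewrite (Eq z') at 2. ring.
Qed.

Lemma Cdiff_const k z : Cdiff (fun _ => k) z.
Proof.
  apply Cdiff_slope. exists (fun _ => RtoC 0). split; [apply Ccont_const|]. intros; ring.
Qed.

Lemma Cdiff_id z : Cdiff (fun z => z) z.
Proof.
  apply Cdiff_slope. exists (fun _ => RtoC 1). split; [apply Ccont_const|]. intros; ring.
Qed.

Lemma Cdiff_minus f g z : Cdiff f z -> Cdiff g z -> Cdiff (fun z => f z - g z)%C z.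
Proof.
  rewrite !Cdiff_slope. intros [p [Hp Ep]] [q [Hq Eq]].
  exists (fun z' => p z' + RtoC (-1) * q z')%C. split.
  - apply Ccont_plus; auto. apply Ccont_mult; auto using Ccont_const.
  - intros z'. rewrite (Ep z'), (Eq z'). ring.
Qed.

Lemma Cdiff_inv z : z <> RtoC 0 -> Cdiff Cinv z.
Proof.
  intros Hz.
  pose proof (proj1 (Cmod_gt_0 z) Hz) as Hp.
  assert (Hcont : Ccont (fun z' => RtoC (-1) * (/ z' * / z))%C z).
  { apply Ccont_mult; [apply Ccont_const|]. apply Ccont_mult; [|apply Ccont_const].
    now apply Ccont_inv. }
  exists (RtoC (-1) * (/ z * / z))%C. intros eps He.
  destruct (Hcont eps He) as [d [Hd H]].
  exists (Rmin d (Cmod z)). split; [apply Rmin_pos; auto|]. intros z' Hz'.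
  pose proof (Rlt_le_trans _ _ _ Hz' (Rmin_l _ _)) as H1.
  pose proof (Rlt_le_trans _ _ _ Hz' (Rmin_r _ _)) as H2.
  assert (Hn : z' <> RtoC 0).
  { intros ->. replace (RtoC 0 - z)%C with (- z)%C in H2 by ring. rewrite Cmod_opp in H2. lra. }
  specialize (H z' H1).
  replace (/ z' - / z - RtoC (-1) * (/ z * / z) * (z' - z))%C
    with ((RtoC (-1) * (/ z' * / z) - RtoC (-1) * (/ z * / z)) * (z' - z))%C.
  - rewrite Cmod_mult. apply Rmult_le_compat_r; [apply Cmod_ge_0|lra].
  - replace (RtoC (-1)) with (- RtoC 1)%C by (unfold RtoC, Copp; simpl; f_equal; ring).
    field. auto.
Qed.

(** * Cauchy's estimate at an interior point *)

(** A positive lower bound serves in place of the value 2 pi i. Each side contributes a nonnegative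
    imaginary part, and on the bottom side the integrand is bounded below by the squared diagonal in
    its denominator. *)
Lemma oint_inv_Im a b c d p q : a < p < b -> c < q < d ->
  (b - a) * ((q - c) / ((b - a) ^ 2 + (d - c) ^ 2))
  <= snd (oint (fun z => / (z - (p, q)))%C a b c d).
Proof.
  intros Hp Hq. unfold oint.
  assert (Hc : forall z, on_bdry a b c d z -> Ccont (fun z => / (z - (p, q)))%C z).
  { intros z Hz. apply (Ccont_comp Cinv (fun z => z - (p, q))%C).
    - apply Ccont_inv. intros E. apply (f_equal fst) in E as E1. apply (f_equal snd) in E as E2.
      simpl in E1, E2. unfold on_bdry in Hz. lra.
    - apply Cdiff_cont, Cdiff_minus; [apply Cdiff_id|apply Cdiff_const]. }
  assert (Eb : forall y, y = c \/ y = d -> ex_CInt (fun x => / ((x, y) - (p, q)))%C a b).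
  { intros y Hy. apply (ex_CInt_hor (fun z => / (z - (p, q)))%C); [lra|].
    intros x Hx. apply Hc. left. simpl. auto. }
  assert (Er : forall x, x = a \/ x = b -> ex_CInt (fun y => / ((x, y) - (p, q)))%C c d).
  { intros x Hx. apply (ex_CInt_ver (fun z => / (z - (p, q)))%C); [lra|].
    intros y Hy. apply Hc. right. simpl. auto. }
  assert (Pos : forall x y, x <> p \/ y <> q -> 0 < (x + - p) * ((x + - p) * 1) + (y + - q) * ((y + - q) * 1)).
  { intros x y Hxy.
    destruct Hxy as [Hx|Hy].
    - assert (0 < (x - p) ^ 2) by (apply pow2_gt_0; lra). assert (0 <= (y - q) ^ 2) by apply pow2_ge_0. lra.
    - assert (0 <= (x - p) ^ 2) by apply pow2_ge_0. assert (0 < (y - q) ^ 2) by (apply pow2_gt_0; lra). lra. }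
  rewrite (CInt_pair _ _ _ (Eb c (or_introl eq_refl))), (CInt_pair _ _ _ (Eb d (or_intror eq_refl))).
  rewrite (CInt_pair _ _ _ (Er a (or_introl eq_refl))), (CInt_pair _ _ _ (Er b (or_intror eq_refl))).
  assert (I : forall f u v, ex_CInt f u v -> ex_RInt (fun t => fst (f t)) u v /\ ex_RInt (fun t => snd (f t)) u v).
  { intros f u v [l Hl]. split; [exists (fst l)|exists (snd l)]; [now apply is_CInt_fst|now apply is_CInt_snd]. }
  assert (B1 : (b - a) * ((q - c) / ((b - a) ^ 2 + (d - c) ^ 2))
     <= RInt (fun t => snd (/ ((t, c) - (p, q)))%C) a b).
  { replace ((b - a) * ((q - c) / ((b - a) ^ 2 + (d - c) ^ 2)))
      with (RInt (fun _ => (q - c) / ((b - a) ^ 2 + (d - c) ^ 2)) a b) by (rewrite RInt_const; reflexivity).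
    apply RInt_le; [lra|apply ex_RInt_const|apply (I _ _ _ (Eb c (or_introl eq_refl)))|].
    intros x Hx. simpl. pose proof (Pos x c ltac:(lra)).
    replace (- (c + - q)) with (q - c) by ring.
    apply Rmult_le_compat_l; [lra|]. apply Rinv_le_contravar; [lra|]. nra. }
  assert (B2 : 0 <= RInt (fun t => - snd (/ ((t, d) - (p, q)))%C) a b).
  { apply RInt_ge_0; [lra|apply (ex_RInt_opp (V := R_NormedModule)), (I _ _ _ (Eb d (or_intror eq_refl)))|].
    intros x Hx. simpl. pose proof (Pos x d ltac:(lra)) as P.
    apply Rinv_0_lt_compat in P. unfold Rdiv. nra. }
  assert (B3 : 0 <= RInt (fun t => fst (/ ((b, t) - (p, q)))%C) c d).
  { apply RInt_ge_0; [lra|apply (I _ _ _ (Er b (or_intror eq_refl)))|].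
    intros y Hy. simpl. pose proof (Pos b y ltac:(lra)) as P.
    apply Rinv_0_lt_compat in P. unfold Rdiv. nra. }
  assert (B4 : 0 <= RInt (fun t => - fst (/ ((a, t) - (p, q)))%C) c d).
  { apply RInt_ge_0; [lra|apply (ex_RInt_opp (V := R_NormedModule)), (I _ _ _ (Er a (or_introl eq_refl)))|].
    intros y Hy. simpl. pose proof (Pos a y ltac:(lra)) as P.
    apply Rinv_0_lt_compat in P. unfold Rdiv. nra. }
  rewrite (RInt_opp (V := R_CompleteNormedModule)) in B2, B4
    by (apply (I _ _ _ (Eb d (or_intror eq_refl))) || apply (I _ _ _ (Er a (or_introl eq_refl)))).
  unfold opp in B2, B4. simpl in B2, B4 |- *. simpl in B1, B3. lra.
Qed.

(** Cauchy's formula in the form h(w) J = integral of h(z) / (z - w), where J is the integral of 1 /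
    (z - w) and only the bound |J| >= m is used. [K] depends on the rectangle and the point alone,
    so one constant serves a whole family of functions h. *)
Lemma cauchy_estimate a b c d p q : a < p < b -> c < q < d ->
  exists K, 0 < K /\ forall h, (forall z, in_rect a b c d z -> Cdiff h z) ->
    forall M, (forall z, on_bdry a b c d z -> Cmod (h z) <= M) -> Cmod (h (p, q)) <= K * M.
Proof.
  intros Hp Hq.
  set (m := (b - a) * ((q - c) / ((b - a) ^ 2 + (d - c) ^ 2))).
  set (r := Rmin (Rmin (p - a) (b - p)) (Rmin (q - c) (d - q))).
  assert (Hr : 0 < r) by (repeat apply Rmin_pos; lra).
  assert (Hr4 : r <= p - a /\ r <= b - p /\ r <= q - c /\ r <= d - q).
  { unfold r. pose proof (Rmin_l (Rmin (p - a) (b - p)) (Rmin (q - c) (d - q))).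
    pose proof (Rmin_r (Rmin (p - a) (b - p)) (Rmin (q - c) (d - q))).
    pose proof (Rmin_l (p - a) (b - p)). pose proof (Rmin_r (p - a) (b - p)).
    pose proof (Rmin_l (q - c) (d - q)). pose proof (Rmin_r (q - c) (d - q)). lra. }
  assert (Hm : 0 < m).
  { apply Rmult_lt_0_compat; [lra|]. apply Rdiv_lt_0_compat; [lra|]. nra. }
  exists (2 * ((b - a) + (d - c)) / r / m). split.
  { repeat apply Rdiv_lt_0_compat; lra. }
  intros h Hh M HM. set (w := (p, q) : C).
  set (iv := fun z => (/ (z - w))%C).
  assert (Hne : forall z, fst z <> p \/ snd z <> q -> (z - w)%C <> RtoC 0).
  { intros z Hz E. apply (f_equal fst) in E as E1. apply (f_equal snd) in E as E2.
    simpl in E1, E2. lra. }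
  assert (Hiv : forall z, fst z <> p \/ snd z <> q -> Cdiff iv z).
  { intros z Hz. apply (Cdiff_comp Cinv (fun z => z - w)%C).
    - apply Cdiff_inv. auto.
    - apply Cdiff_minus; [apply Cdiff_id|apply Cdiff_const]. }
  set (k := fun z => ((h z - h w) * iv z)%C).
  assert (Hk : forall z, in_rect a b c d z -> fst z <> p \/ snd z <> q -> Cdiff k z).
  { intros z Hz Hw. apply Cdiff_mult; auto. apply Cdiff_minus; auto. apply Cdiff_const. }
  assert (Hbd : forall z, on_bdry a b c d z -> in_rect a b c d z /\ (fst z <> p \/ snd z <> q)).
  { intros z Hz. unfold on_bdry in Hz. unfold in_rect. split; lra. }
  assert (Hk0 : oint k a b c d = RtoC 0).
  { assert (Hw : in_rect a b c d w) by (unfold in_rect, w; simpl; lra).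
    destruct (Cdiff_locally_bounded h w (Hh w Hw)) as [K [del [HK [Hdel HB]]]].
    (* The difference quotient is bounded near w but not known to be differentiable at w. [goursat]
       disposes of four rectangles around the square of half-side [e] about w; the square has
       perimeter 8 e. *)
    assert (Shrink : forall e, 0 < e < r -> e < del / 2 -> Cmod (oint k a b c d) <= 8 * K * e).
    { intros e He Hed.
      assert (E : oint k a b c d = oint k (p - e) (p + e) (q - e) (q + e)).
      { assert (G : forall a' b' c' d', a <= a' <= b' -> b' <= b -> c <= c' <= d' -> d' <= d ->
          (b' < p \/ p < a' \/ d' < q \/ q < c') -> oint k a' b' c' d' = RtoC 0).
        { intros. apply goursat; try lra. intros z Hz. unfold in_rect in Hz.
          apply Hk; [unfold in_rect|]; lra. }
        assert (Cb : forall a' b' c' d', a <= a' < p -> p < b' <= b -> c <= c' < q -> q < d' <= d ->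
          forall z, on_bdry a' b' c' d' z -> Ccont k z).
        { intros a' b' c' d' ? ? ? ? z Hz. apply Cdiff_cont, Hk; unfold in_rect, on_bdry in *; lra. }
        rewrite (oint_split_h k a (p - e) b) by (try lra; apply Cb; lra).
        rewrite (oint_split_h k (p - e) (p + e) b) by (try lra; apply Cb; lra).
        rewrite (oint_split_v k (p - e) (p + e) c (q - e) d) by (try lra; apply Cb; lra).
        rewrite (oint_split_v k (p - e) (p + e) (q - e) (q + e) d) by (try lra; apply Cb; lra).
        rewrite (G a (p - e)), (G (p + e) b), (G (p - e) (p + e) c), (G (p - e) (p + e) (q + e)) by lra.
        ring. }
      rewrite E. eapply Rle_trans; [apply (oint_bound k K); try lra|].
      - intros z Hz. apply Cdiff_cont, Hk; unfold in_rect, on_bdry in *; lra.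
      - intros z Hz. unfold k, iv.
        assert (Hz' : fst z <> p \/ snd z <> q) by (unfold on_bdry in Hz; lra).
        pose proof (proj1 (Cmod_gt_0 _) (Hne z Hz')) as Pz.
        rewrite Cmod_mult, Cmod_inv by auto.
        apply Rle_div_l; auto. apply HB.
        eapply Rle_lt_trans; [apply Cmod_le_abs|]. simpl.
        assert (Rabs (fst z + - p) <= e) by (apply Rabs_le; unfold on_bdry in Hz; lra).
        assert (Rabs (snd z + - q) <= e) by (apply Rabs_le; unfold on_bdry in Hz; lra). lra.
      - apply Req_le. ring. }
    apply Cmod_eq_0. apply Rle_antisym; [|apply Cmod_ge_0].
    apply le_epsilon. intros eps He. rewrite Rplus_0_l.
    set (e := Rmin (Rmin (r / 2) (del / 4)) (eps / (8 * K))).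
    assert (Hee : 0 < e).
    { repeat apply Rmin_pos; try lra. apply Rdiv_lt_0_compat; lra. }
    pose proof (Rmin_l (Rmin (r / 2) (del / 4)) (eps / (8 * K))).
    pose proof (Rmin_r (Rmin (r / 2) (del / 4)) (eps / (8 * K))).
    pose proof (Rmin_l (r / 2) (del / 4)). pose proof (Rmin_r (r / 2) (del / 4)).
    fold e in H, H0.
    eapply Rle_trans; [apply (Shrink e); lra|].
    apply Rle_trans with (8 * K * (eps / (8 * K))); [apply Rmult_le_compat_l; lra|].
    apply Req_le. field. lra. }
  assert (Ec : forall f, (forall z, in_rect a b c d z -> Cdiff f z) ->
     forall z, on_bdry a b c d z -> Ccont (fun z => f z * iv z)%C z).
  { intros f Hf z Hz. destruct (Hbd z Hz). apply Ccont_mult; apply Cdiff_cont; auto. }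
  assert (E1 : oint (fun z => h z * iv z)%C a b c d = (h w * oint iv a b c d)%C).
  { assert (E2 : oint k a b c d = (oint (fun z => h z * iv z)%C a b c d - oint (fun z => h w * iv z)%C a b c d)%C).
    { rewrite <- oint_minus; try lra.
      - apply oint_ext; try lra. intros z Hz. unfold k. ring.
      - apply (Ec h Hh).
      - apply (Ec (fun _ => h w)). intros; apply Cdiff_const. }
    rewrite Hk0 in E2. rewrite oint_Cmult in E2; try lra.
    - apply (f_equal (fun z => (z + h w * oint iv a b c d)%C)) in E2.
      ring_simplify in E2. symmetry. exact E2.
    - intros z Hz. destruct (Hbd z Hz). apply Cdiff_cont. auto. }
  assert (L : m <= Cmod (oint iv a b c d)).
  { eapply Rle_trans; [apply (oint_inv_Im a b c d p q Hp Hq)|].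
    eapply Rle_trans; [apply Rle_abs|]. apply abs_snd_le_Cmod. }
  assert (U : Cmod (oint (fun z => h z * iv z)%C a b c d) <= 2 * ((b - a) + (d - c)) * (M / r)).
  { apply oint_bound; try lra; [apply (Ec h Hh)|]. intros z Hz.
    destruct (Hbd z Hz) as [_ Hn]. unfold iv. rewrite Cmod_mult, Cmod_inv by auto.
    assert (Hd : r <= Cmod (z - w)).
    { unfold on_bdry in Hz. destruct Hz as [[_ Hz]|[_ Hz]].
      - eapply Rle_trans; [|apply abs_snd_le_Cmod]. simpl.
        destruct Hz as [->| ->]; [rewrite Rabs_left|rewrite Rabs_pos_eq]; lra.
      - eapply Rle_trans; [|apply abs_fst_le_Cmod]. simpl.
        destruct Hz as [->| ->]; [rewrite Rabs_left|rewrite Rabs_pos_eq]; lra. }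
    apply Rmult_le_compat; auto; [apply Cmod_ge_0|left; apply Rinv_0_lt_compat; lra|].
    apply Rinv_le_contravar; lra. }
  rewrite E1, Cmod_mult in U. fold w.
  apply Rle_trans with (Cmod (h w) * Cmod (oint iv a b c d) / m).
  - apply Rle_div_r; auto. apply Rmult_le_compat_l; [apply Cmod_ge_0|exact L].
  - unfold Rdiv at 1. replace (2 * (b - a + (d - c)) / r / m * M)
      with (2 * (b - a + (d - c)) * (M / r) * / m) by (field; lra).
    apply Rmult_le_compat_r; [left; apply Rinv_0_lt_compat; lra|exact U].
Qed.

(** * Complex powers *)

Fixpoint csum (f : nat -> C) (n : nat) : C :=
  match n with O => RtoC 0 | S m => (csum f m + f m)%C end.

(** This is x^(-s). At x = [INR (S k)] it is by computation the term [nat_Cpow (S k) (- s)] of the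
    zeta series. *)
Definition xpow (s : C) (x : R) : C := Cexp (- s * RtoC (ln x))%C.

Lemma Cmod_Cexp z : Cmod (Cexp z) = exp (fst z).
Proof.
  unfold Cmod, Cexp. simpl.
  replace (exp (Re z) * cos (Im z) * (exp (Re z) * cos (Im z) * 1)
    + exp (Re z) * sin (Im z) * (exp (Re z) * sin (Im z) * 1))
    with (exp (Re z) ^ 2 * (Rsqr (sin (Im z)) + Rsqr (cos (Im z)))) by (unfold Rsqr; ring).
  rewrite sin2_cos2, Rmult_1_r. apply sqrt_pow2. left. apply exp_pos.
Qed.

Lemma Cexp_plus z w : Cexp (z + w) = (Cexp z * Cexp w)%C.
Proof.
  unfold Cexp, Cmult. simpl. unfold Re, Im. rewrite exp_plus, cos_plus, sin_plus. f_equal; ring.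
Qed.

Lemma Cexp_0 : Cexp (RtoC 0) = RtoC 1.
Proof. unfold Cexp. simpl. rewrite exp_0, cos_0, sin_0. unfold RtoC. f_equal; ring. Qed.

Lemma xpow_eq s x : xpow s x = (exp (- fst s * ln x) * cos (snd s * ln x),
   - (exp (- fst s * ln x) * sin (snd s * ln x))).
Proof.
  unfold xpow, Cexp. simpl. unfold Re, Im.
  replace (- fst s * ln x - - snd s * 0) with (- fst s * ln x) by ring.
  replace (- fst s * 0 + - snd s * ln x) with (- (snd s * ln x)) by ring.
  rewrite cos_neg, sin_neg. f_equal; ring.
Qed.

Lemma Cmod_xpow s x : Cmod (xpow s x) = exp (- fst s * ln x).
Proof.
  unfold xpow. rewrite Cmod_Cexp. f_equal. simpl. ring.
Qed.

Lemma Rabs_sin_le y : Rabs (sin y) <= Rabs y.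
Proof.
  destruct (MVT_gen sin 0 y cos) as [c [_ Hc]].
  - intros x _. apply is_derive_Reals, derivable_pt_lim_sin.
  - intros x _. apply continuity_pt_filterlim. apply continuous_sin.
  - rewrite sin_0 in Hc. replace (sin y) with (cos c * y) by lra.
    rewrite Rabs_mult. pose proof (COS_bound c). pose proof (Rabs_pos y).
    assert (Rabs (cos c) <= 1) by (apply Rabs_le; lra). nra.
Qed.

Lemma one_minus_cos_le y : 0 <= 1 - cos y <= y ^ 2 / 2.
Proof.
  pose proof (COS_bound y). split; [lra|].
  replace y with (2 * (y / 2)) at 1 by field. rewrite cos_2a_sin.
  pose proof (Rabs_sin_le (y / 2)) as H1. apply Rsqr_le_abs_1 in H1. unfold Rsqr in H1. nra.
Qed.

Lemma sin_minus_id_le y : Rabs y <= 1 -> Rabs (sin y - y) <= y ^ 2.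
Proof.
  intros Hy. destruct (MVT_gen sin 0 y cos) as [c [Hr Hc]].
  - intros x _. apply is_derive_Reals, derivable_pt_lim_sin.
  - intros x _. apply continuity_pt_filterlim. apply continuous_sin.
  - rewrite sin_0 in Hc. replace (sin y - y) with (- (1 - cos c) * y) by lra.
    rewrite Rabs_mult, Rabs_Ropp. pose proof (one_minus_cos_le c).
    rewrite (Rabs_pos_eq (1 - cos c)) by lra.
    assert (Hc2 : c ^ 2 <= y ^ 2).
    { destruct (Rle_lt_dec 0 y).
      - rewrite Rmin_left, Rmax_right in Hr by lra. nra.
      - rewrite Rmin_right, Rmax_left in Hr by lra. nra. }
    pose proof (Rabs_pos y). rewrite <- (pow2_abs y) in Hc2 |- *. nra.
Qed.

Lemma Cdiff_Cexp z : Cdiff Cexp z.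
Proof.
  exists (Cexp z). intros eps He.
  pose proof (Cmod_Cexp z) as HE. pose proof (exp_pos (fst z)) as HP.
  exists (Rmin (1 / 2) (eps / (20 * exp (fst z)))). split.
  { apply Rmin_pos; [lra|]. apply Rdiv_lt_0_compat; lra. }
  intros z' Hd. pose proof (Rlt_le_trans _ _ _ Hd (Rmin_l _ _)) as H1.
  pose proof (Rlt_le_trans _ _ _ Hd (Rmin_r _ _)) as H2.
  set (h := (z' - z)%C) in *. replace z' with (z + h)%C by (unfold h; ring).
  rewrite Cexp_plus.
  replace (Cexp z * Cexp h - Cexp z - Cexp z * h)%C with (Cexp z * (Cexp h - RtoC 1 - h))%C by ring.
  rewrite Cmod_mult, HE.
  assert (Hb : Cmod (Cexp h - RtoC 1 - h) <= 20 * Cmod h ^ 2).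
  { clearbody h. pose proof (abs_fst_le_Cmod h) as Hx. pose proof (abs_snd_le_Cmod h) as Hy.
    set (x := fst h) in *. set (y := snd h) in *. set (m := Cmod h) in *.
    pose proof (Rabs_pos x). pose proof (Rabs_pos y).
    assert (Hx2 : x ^ 2 <= m ^ 2) by (rewrite <- (pow2_abs x); nra).
    assert (Hy2 : y ^ 2 <= m ^ 2) by (rewrite <- (pow2_abs y); nra).
    assert (Hxr : - (1 / 2) < x < 1 / 2) by (destruct (Rabs_def2 x (1 / 2) ltac:(lra)); lra).
    assert (Ex1 : 1 + x <= exp x) by (apply exp_ineq1_le).
    assert (Ex2 : exp x <= 1 + x + 2 * x ^ 2).
    { pose proof (exp_ineq1_le (- x)). rewrite exp_Ropp in H3.
      assert (Hinv : exp x <= / (1 - x)).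
      { rewrite <- (Rinv_inv (exp x)). apply Rinv_le_contravar; lra. }
      eapply Rle_trans; [exact Hinv|]. apply Rmult_le_reg_r with (1 - x); [lra|].
      rewrite Rinv_l by lra. nra. }
    assert (Ex3 : exp x <= 2) by nra.
    pose proof (one_minus_cos_le y) as Hc. pose proof (sin_minus_id_le y ltac:(lra)) as Hs.
    eapply Rle_trans; [apply Cmod_le_abs|].
    unfold Cexp. simpl. unfold Re, Im. fold x y.
    replace (exp x * cos y + - (1) + - x) with ((exp x - 1 - x) - exp x * (1 - cos y)) by ring.
    replace (exp x * sin y + - 0 + - y) with (exp x * (sin y - y) + (exp x - 1) * y) by ring.
    assert (A0 : 0 <= exp x * (1 - cos y) <= m ^ 2).
    { split; [apply Rmult_le_pos; lra|]. apply Rle_trans with (2 * (y ^ 2 / 2)); [|lra].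
      apply Rmult_le_compat; lra. }
    assert (A1 : Rabs (exp x - 1 - x - exp x * (1 - cos y)) <= 3 * m ^ 2) by (apply Rabs_le; lra).
    assert (A2 : Rabs (exp x * (sin y - y)) <= 2 * m ^ 2).
    { rewrite Rabs_mult, (Rabs_pos_eq (exp x)) by lra.
      apply Rmult_le_compat; [lra|apply Rabs_pos|lra|]. eapply Rle_trans; [exact Hs|exact Hy2]. }
    assert (A3 : Rabs ((exp x - 1) * y) <= 2 * m ^ 2).
    { rewrite Rabs_mult. assert (Rabs (exp x - 1) <= 2 * m).
      { apply Rle_trans with (m + 2 * m ^ 2); [|nra].
        replace (exp x - 1) with (x + (exp x - 1 - x)) by ring.
        eapply Rle_trans; [apply Rabs_triang|]. apply Rplus_le_compat; [lra|]. apply Rabs_le. lra. }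
      apply Rle_trans with (2 * m * m); [|lra]. apply Rmult_le_compat; auto using Rabs_pos. }
    pose proof (pow2_ge_0 m). apply Rle_trans with (3 * m ^ 2 + (2 * m ^ 2 + 2 * m ^ 2)); [|lra].
    apply Rplus_le_compat; [exact A1|]. eapply Rle_trans; [apply Rabs_triang|].
    apply Rplus_le_compat; [exact A2|exact A3]. }
  pose proof (Cmod_ge_0 h).
  assert (H3 : 20 * exp (fst z) * Cmod h <= eps).
  { apply Rle_trans with (20 * exp (fst z) * (eps / (20 * exp (fst z)))).
    - apply Rmult_le_compat_l; lra. - apply Req_le. field. lra. }
  apply Rle_trans with (exp (fst z) * (20 * Cmod h ^ 2)).
  - apply Rmult_le_compat_l; lra.
  - replace (exp (fst z) * (20 * Cmod h ^ 2)) with (20 * exp (fst z) * Cmod h * Cmod h) by ring.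
    apply Rmult_le_compat_r; lra.
Qed.

Lemma Cdiff_xpow x s : Cdiff (fun s => xpow s x) s.
Proof.
  unfold xpow. apply (Cdiff_comp Cexp (fun s => - s * RtoC (ln x))%C); [apply Cdiff_Cexp|].
  apply Cdiff_mult; [|apply Cdiff_const].
  destruct (Cdiff_affine (RtoC 0) (- RtoC 1)%C s) as [l Hl]. exists l. intros eps He.
  destruct (Hl eps He) as [d [Hd H]]. exists d. split; auto. intros z' Hz'.
  specialize (H z' Hz').
  replace (- z' - - s)%C with (RtoC 0 + - RtoC 1 * z' - (RtoC 0 + - RtoC 1 * s))%C by ring. exact H.
Qed.

Lemma Cdiff_csum (f : nat -> C -> C) n z : (forall k, Cdiff (f k) z) ->
  Cdiff (fun z => csum (fun k => f k z) n) z.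
Proof.
  intros H. induction n; simpl; [apply Cdiff_const|]. apply Cdiff_plus; auto.
Qed.

Definition Cder (f : R -> C) (x : R) (l : C) : Prop :=
  is_derive (fun t => fst (f t)) x (fst l) /\ is_derive (fun t => snd (f t)) x (snd l).

Lemma Cder_plus f g x l m : Cder f x l -> Cder g x m -> Cder (fun t => f t + g t)%C x (l + m)%C.
Proof.
  intros [H1 H2] [H3 H4]. split; simpl; apply (is_derive_plus (V := R_NormedModule)); auto.
Qed.

Lemma Cder_Rmult (r : R -> R) f x dr l : is_derive r x dr -> Cder f x l ->
  Cder (fun t => RtoC (r t) * f t)%C x (RtoC dr * f x + RtoC (r x) * l)%C.
Proof.
  intros Hr [H1 H2]. split; simpl.
  - eapply is_derive_ext. { intros t. symmetry. rewrite Rmult_0_l, Rminus_0_r. reflexivity. }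
    evar_last; [apply (is_derive_mult r (fun t => fst (f t)) x dr (fst l) Hr H1); exact Rmult_comm|].
    unfold plus, mult; simpl. ring.
  - eapply is_derive_ext. { intros t. symmetry. rewrite Rmult_0_l, Rplus_0_r. reflexivity. }
    evar_last; [apply (is_derive_mult r (fun t => snd (f t)) x dr (snd l) Hr H2); exact Rmult_comm|].
    unfold plus, mult; simpl. ring.
Qed.

Lemma Cder_Cmult (c : C) f x l : Cder f x l -> Cder (fun t => c * f t)%C x (c * l)%C.
Proof.
  intros [H1 H2]. split; simpl.
  - apply (is_derive_minus (V := R_NormedModule)); apply (is_derive_scal _ x); auto.
  - apply (is_derive_plus (V := R_NormedModule)); apply (is_derive_scal _ x); auto.
Qed.

Lemma Cder_ext f g x l : (forall t, f t = g t) -> Cder f x l -> Cder g x l.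
Proof.
  intros E [H1 H2]. split; eapply is_derive_ext; eauto; intros t; simpl; now rewrite E.
Qed.

Lemma Cder_continuous f x l : Cder f x l -> Ccontinuous f x.
Proof.
  intros [H1 H2]. apply Ccontinuous_pair;
    apply (ex_derive_continuous (K := R_AbsRing) (V := R_NormedModule)); eexists; eassumption.
Qed.

Lemma Cder_xpow s x : 0 < x -> Cder (xpow s) x (- s * RtoC (/ x) * xpow s x)%C.
Proof.
  intros Hx. split.
  - eapply is_derive_ext. { intros t. rewrite xpow_eq. simpl. reflexivity. }
    rewrite xpow_eq. destruct s as [a t]. simpl. auto_derive; auto. field. lra.
  - eapply is_derive_ext. { intros u. rewrite xpow_eq. simpl. reflexivity. }
    rewrite xpow_eq. destruct s as [a t]. simpl. auto_derive; auto. field. lra.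
Qed.

Lemma is_CInt_Cder (F f : R -> C) a b : a <= b ->
  (forall x, a <= x <= b -> Cder F x (f x)) ->
  (forall x, a <= x <= b -> Ccontinuous f x) ->
  is_CInt f a b (F b - F a)%C.
Proof.
  intros Hab HF Hf. apply is_CInt_pair; simpl.
  - apply (@is_RInt_derive R_CompleteNormedModule (fun t => fst (F t)) (fun t => fst (f t)));
      intros x; rewrite Rmin_left, Rmax_right by lra; intros Hx;
      [apply HF, Hx|apply Ccontinuous_fst, Hf, Hx].
  - apply (@is_RInt_derive R_CompleteNormedModule (fun t => snd (F t)) (fun t => snd (f t)));
      intros x; rewrite Rmin_left, Rmax_right by lra; intros Hx;
      [apply HF, Hx|apply Ccontinuous_snd, Hf, Hx].
Qed.

(** * Euler-Maclaurin approximation of zeta *)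

(** The sum of n^(-s) up to N, plus N^(1-s) / (s-1) - N^(-s) / 2. The last term centres the sawtooth
    in the remainder integral, whose Fourier series is then a pure sine series. *)
Definition zeta_em (N : nat) (s : C) : C :=
  (csum (fun k => xpow s (INR (S k))) N + RtoC (INR N) * xpow s (INR N) / (s - RtoC 1)
   - xpow s (INR N) / RtoC 2)%C.

Definition dxpow (s : C) (x : R) : C := (- s * RtoC (/ x) * xpow s x)%C.

Lemma Cder_dxpow s x : 0 < x -> exists l, Cder (dxpow s) x l.
Proof.
  intros Hx. eexists. unfold dxpow.
  assert (H : Cder (fun t => - s * (RtoC (/ t) * xpow s t))%C x
    (- s * (RtoC (- / x ^ 2) * xpow s x + RtoC (/ x) * dxpow s x))%C).
  { apply Cder_Cmult, Cder_Rmult; [|apply Cder_xpow, Hx]. auto_derive; [lra|]. field. lra. }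
  eapply Cder_ext; [|exact H]. intros t. simpl. unfold dxpow. ring.
Qed.

Lemma saw_cont s (c x : R) : 0 < x -> Ccontinuous (fun x => RtoC (x - c) * dxpow s x)%C x.
Proof.
  intros Hx. destruct (Cder_dxpow s x Hx) as [l Hl].
  eapply Cder_continuous. apply Cder_Rmult; [|exact Hl].
  auto_derive; auto.
Qed.

Lemma Cmod_dxpow s x : 0 < x -> Cmod (dxpow s x) = Cmod s * (exp (- fst s * ln x) / x).
Proof.
  intros Hx. unfold dxpow. rewrite !Cmod_mult, Cmod_opp, Cmod_R, Cmod_xpow, Rabs_pos_eq.
  - field. lra. - left. apply Rinv_0_lt_compat, Hx.
Qed.

Lemma zeta_em_step N s : (1 <= N)%nat -> s <> RtoC 1 ->
  (zeta_em (S N) s - zeta_em N s)%C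
  = CInt (fun x => RtoC (x - (INR N + 1 / 2)) * dxpow s x)%C (INR N) (INR (S N)).
Proof.
  intros HN Hs. apply le_INR in HN. simpl in HN.
  assert (Hs' : (s - RtoC 1)%C <> RtoC 0).
  { intros E. apply Hs. replace s with ((s - RtoC 1) + RtoC 1)%C by ring. rewrite E. ring. }
  rewrite S_INR. symmetry. apply (@is_RInt_unique C_R_CompleteNormedModule).
  (* An antiderivative of the integrand: the second summand, x^(1-s) / (s-1), has derivative -x^(-s)
     and cancels what the linear factor of the first one leaves. *)
  set (A := fun x => (RtoC (x - (INR N + 1 / 2)) * xpow s x + / (s - RtoC 1) * (RtoC x * xpow s x))%C).
  replace (zeta_em (S N) s - zeta_em N s)%C with (A (INR N + 1)%R - A (INR N))%C.
  - apply is_CInt_Cder; [lra|..].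
    + intros x Hx.
      assert (H : Cder A x (RtoC 1 * xpow s x + RtoC (x - (INR N + 1 / 2)) * dxpow s x
         + / (s - RtoC 1) * (RtoC 1 * xpow s x + RtoC x * dxpow s x))%C).
      { apply Cder_plus; [|apply Cder_Cmult].
        - apply (Cder_Rmult (fun x => x - (INR N + 1 / 2))); [|apply Cder_xpow; lra].
          auto_derive; auto.
        - apply (Cder_Rmult (fun x => x)); [|apply Cder_xpow; lra]. auto_derive; auto. }
      match type of H with Cder _ _ ?l => replace l with
        (RtoC (x - (INR N + 1 / 2)) * dxpow s x)%C in H; [exact H|] end.
      assert (E : (RtoC x * dxpow s x = - s * xpow s x)%C).
      { unfold dxpow. rewrite RtoC_inv by lra. field. intros E. apply (f_equal fst) in E. simpl in E. lra. }
      rewrite E. field. auto.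
    + intros x Hx. apply saw_cont. lra.
  - unfold A, zeta_em. cbn [csum]. rewrite !S_INR.
    replace (INR N + 1 - (INR N + 1 / 2)) with (/ 2) by field.
    replace (INR N - (INR N + 1 / 2)) with (- / 2) by field.
    rewrite RtoC_opp, RtoC_inv, RtoC_plus by lra.
    replace (RtoC 2) with (RtoC 1 + RtoC 1)%C by (rewrite <- RtoC_plus; f_equal; ring).
    field. repeat match goal with |- _ /\ _ => split end; auto.
    all: intros E; apply (f_equal fst) in E; simpl in E; lra.
Qed.

Lemma RInt_xpow_abs (sg a b : R) : 0 < sg -> 0 < a -> a <= b ->
  is_RInt (fun x => exp (- sg * ln x) / x) a b (/ sg * (exp (- sg * ln a) - exp (- sg * ln b))).
Proof.
  intros Hs Ha Hb.
  replace (/ sg * (exp (- sg * ln a) - exp (- sg * ln b)))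
    with (- / sg * exp (- sg * ln b) - (- / sg * exp (- sg * ln a))) by ring.
  apply (is_RInt_antideriv (fun x => - / sg * exp (- sg * ln x))); auto; intros x Hx.
  - auto_derive; [lra|]. field. lra.
  - auto_derive. repeat split; lra.
Qed.

(** The centred sawtooth is at most 1/2 in modulus. The bound is kept as a difference so that it
    telescopes in [zeta_em_cauchy]. *)
Lemma zeta_em_step_bound N s : (1 <= N)%nat -> s <> RtoC 1 -> 0 < fst s ->
  Cmod (zeta_em (S N) s - zeta_em N s)
  <= Cmod s / (2 * fst s) * (exp (- fst s * ln (INR N)) - exp (- fst s * ln (INR (S N)))).
Proof.
  intros HN Hs Hp. rewrite zeta_em_step by auto.
  apply le_INR in HN. simpl in HN. pose proof (S_INR N) as ES.
  replace (Cmod s / (2 * fst s) * (exp (- fst s * ln (INR N)) - exp (- fst s * ln (INR (S N)))))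
    with (RInt (fun x => Cmod s / 2 * (exp (- fst s * ln x) / x)) (INR N) (INR (S N))).
  - apply Cmod_CInt_le; [lra|..].
    + apply ex_CInt_continuous; [lra|]. intros t Ht. apply saw_cont. lra.
    + eexists. apply (is_RInt_scal (V := R_NormedModule)), RInt_xpow_abs; lra.
    + intros t Ht. rewrite Cmod_mult, Cmod_dxpow, Cmod_R by lra.
      assert (Rabs (t - (INR N + 1 / 2)) <= / 2) by (apply Rabs_le; lra).
      pose proof (Cmod_ge_0 s).
      assert (0 < exp (- fst s * ln t) / t) by (apply Rdiv_lt_0_compat; [apply exp_pos|lra]).
      assert (0 <= Cmod s * (exp (- fst s * ln t) / t)) by nra. nra.
  - apply is_RInt_unique. evar_last.
    + apply (is_RInt_scal (V := R_NormedModule)), RInt_xpow_abs; lra.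
    + unfold scal; simpl; unfold mult; simpl. field. lra.
Qed.

Lemma zeta_em_cauchy N k s : (1 <= N)%nat -> s <> RtoC 1 -> 0 < fst s ->
  Cmod (zeta_em (N + k) s - zeta_em N s)
  <= Cmod s / (2 * fst s) * (exp (- fst s * ln (INR N)) - exp (- fst s * ln (INR (N + k)))).
Proof.
  intros HN Hs Hp. induction k.
  - rewrite Nat.add_0_r. replace (zeta_em N s - zeta_em N s)%C with (RtoC 0) by ring.
    rewrite Cmod_0. lra.
  - rewrite Nat.add_succ_r.
    replace (zeta_em (S (N + k)) s - zeta_em N s)%C
      with ((zeta_em (S (N + k)) s - zeta_em (N + k) s) + (zeta_em (N + k) s - zeta_em N s))%C by ring.
    eapply Rle_trans; [apply Cmod_triangle|].
    pose proof (zeta_em_step_bound (N + k) s ltac:(lia) Hs Hp). lra.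
Qed.

Lemma Cminus_neq_0 (z w : C) : z <> w -> (z - w)%C <> RtoC 0.
Proof.
  intros H E. apply H. replace z with ((z - w) + w)%C by ring. rewrite E. ring.
Qed.

Lemma exists_large_ln (N : nat) (L : R) : exists k, (1 <= N + k)%nat /\ L <= ln (INR (N + k)).
Proof.
  destruct (INR_unbounded (exp L)) as [n Hn]. exists (S n). split; [lia|].
  rewrite <- (ln_exp L) at 1. apply ln_le; [apply exp_pos|].
  apply Rle_trans with (INR n); [lra|]. apply le_INR. lia.
Qed.

Lemma exists_exp_small (a B eps : R) : 0 < a -> 0 < eps ->
  exists L, 0 < L /\ forall L', L <= L' -> B * exp (- a * L') <= eps.
Proof.
  intros Ha He. exists (Rmax 1 ((Rabs B / eps) / a)). split; [eapply Rlt_le_trans; [|apply Rmax_l]; lra|].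
  intros L' HL. pose proof (Rle_trans _ _ _ (Rmax_r _ _) HL) as H1.
  apply Rle_div_l in H1; [|lra].
  pose proof (exp_ineq1_le (a * L')) as H2.
  replace (- a * L') with (- (a * L')) by ring. rewrite exp_Ropp.
  pose proof (exp_pos (a * L')).
  apply Rle_div_l; [lra|]. apply Rle_trans with (Rabs B); [apply Rle_abs|].
  assert (H3 : Rabs B / eps <= exp (a * L')) by lra.
  apply Rle_div_l in H3; lra.
Qed.

Lemma csum_sum_n (f : nat -> C) n : @sum_n (AbsRing.AbelianMonoid C_AbsRing) f n = csum f (S n).
Proof.
  induction n.
  - rewrite sum_O. simpl. ring.
  - rewrite sum_Sn, IHn. reflexivity.
Qed.

Lemma zeta_em_right zeta s N : is_riemann_zeta zeta -> 1 < fst s -> (1 <= N)%nat ->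
  Cmod (zeta s - zeta_em N s) <= Cmod s / (2 * fst s) * exp (- fst s * ln (INR N)).
Proof.
  intros [Hz _] Hs HN.
  assert (Hs1 : s <> RtoC 1) by (intros ->; simpl in Hs; lra).
  assert (Hs' : (s - RtoC 1)%C <> RtoC 0).
  { apply Cminus_neq_0. assumption. }
  pose proof (proj1 (Cmod_gt_0 _) Hs') as Hp.
  apply le_epsilon. intros eps He.
  specialize (Hz s Hs).
  (* A ball of C is a square here; passing to the modulus costs a factor sqrt 2 <= 2, so radius eps
     / 6 yields eps / 3. *)
  assert (He' : 0 < eps / 6) by lra.
  destruct (Hz (fun y => ball (zeta s) (mkposreal _ He') y) (locally_ball (zeta s) (mkposreal _ He')))
    as [N0 HN0].
  destruct (exists_exp_small (fst s - 1) (/ Cmod (s - 1) + / 2) (eps / 2)) as [L [HL0 HL]]; [lra|lra|].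
  destruct (exists_large_ln (N + S N0) L) as [k [_ Hk]].
  set (M := (S N0 + k)%nat). replace (N + S N0 + k)%nat with (N + M)%nat in Hk by (unfold M; lia).
  assert (HM : (1 <= N + M)%nat) by lia.
  assert (H1 : Cmod (zeta s - csum (fun k => xpow s (INR (S k))) (N + M)) <= eps / 3).
  { replace (N + M)%nat with (S (N + N0 + k)) by (unfold M; lia).
    rewrite <- csum_sum_n. rewrite Cmod_minus_sym.
    specialize (HN0 (N + N0 + k)%nat ltac:(lia)).
    apply C_NormedModule_mixin_compat2 in HN0. simpl in HN0.
    assert (sqrt 2 <= 2) by (pose proof (sqrt_sqrt 2 ltac:(lra)); pose proof (sqrt_pos 2); nra).
    pose proof (sqrt_pos 2).
    eapply Rle_trans; [left; exact HN0|]. nra. }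
  assert (H2 : Cmod (zeta s - zeta_em (N + M) s) <= eps).
  { unfold zeta_em.
    set (A := csum (fun k => xpow s (INR (S k))) (N + M)) in *.
    set (X := xpow s (INR (N + M))).
    replace (zeta s - (A + INR (N + M) * X / (s - 1) - X / 2))%C
      with ((zeta s - A) + (X / 2 - INR (N + M) * X / (s - 1)))%C by ring.
    eapply Rle_trans; [apply Cmod_triangle|].
    eapply Rle_trans; [apply Rplus_le_compat_l, Cmod_minus_le|].
    assert (HI : 0 < INR (N + M)) by (apply lt_0_INR; lia).
    assert (C2 : RtoC 2 <> RtoC 0) by (intros E; apply (f_equal fst) in E; simpl in E; lra).
    rewrite !Cmod_div, Cmod_mult, !Cmod_R, !Rabs_pos_eq by (auto; lra).
    unfold X. rewrite !Cmod_xpow.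
    set (l := ln (INR (N + M))) in *.
    assert (E1 : INR (N + M) * exp (- fst s * l) = exp (- (fst s - 1) * l)).
    { rewrite <- (exp_ln (INR (N + M))) by auto. fold l. rewrite <- exp_plus. f_equal. ring. }
    assert (E2 : exp (- fst s * l) <= exp (- (fst s - 1) * l)).
    { destruct (Req_dec (- fst s * l) (- (fst s - 1) * l)) as [->|Hn]; [lra|].
      left. apply exp_increasing. nra. }
    rewrite E1. specialize (HL l Hk). unfold Rdiv in *.
    assert (0 < / Cmod (s - 1)) by (apply Rinv_0_lt_compat; auto).
    nra. }
  pose proof (zeta_em_cauchy N M s HN Hs1 ltac:(lra)) as H3.
  replace (zeta s - zeta_em N s)%C
    with ((zeta s - zeta_em (N + M) s) + (zeta_em (N + M) s - zeta_em N s))%C by ring.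
  eapply Rle_trans; [apply Cmod_triangle|].
  assert (0 <= Cmod s / (2 * fst s) * exp (- fst s * ln (INR (N + M)))).
  { apply Rmult_le_pos; [|left; apply exp_pos]. apply Rdiv_le_0_compat; [apply Cmod_ge_0|lra]. }
  lra.
Qed.

Lemma zeta_Cdiff zeta s : is_riemann_zeta zeta -> s <> RtoC 1 -> Cdiff zeta s.
Proof.
  intros [_ H] Hs. destruct (H s Hs) as [l [_ Hl]].
  exists l. intros eps He.
  destruct (Hl s (fun P HP => HP) (mkposreal eps He)) as [d Hd].
  exists (pos d). split; [apply cond_pos|]. intros z' Hz'.
  specialize (Hd z' Hz'). simpl in Hd.
  replace (l * (z' - s))%C with ((z' - s) * l)%C by ring. exact Hd.
Qed.

Lemma zeta_em_Cdiff N s : s <> RtoC 1 -> Cdiff (zeta_em N) s.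
Proof.
  intros Hs. unfold zeta_em.
  assert (Hs' : (s - RtoC 1)%C <> RtoC 0).
  { apply Cminus_neq_0. assumption. }
  apply Cdiff_minus; [apply Cdiff_plus|].
  - apply Cdiff_csum with (f := fun k s => xpow s (INR (S k))). intros k. apply Cdiff_xpow.
  - apply Cdiff_mult; [apply Cdiff_mult; [apply Cdiff_const|apply Cdiff_xpow]|].
    apply (Cdiff_comp Cinv (fun s => s - RtoC 1)%C); [apply Cdiff_inv, Hs'|].
    apply Cdiff_minus; [apply Cdiff_id|apply Cdiff_const].
  - apply Cdiff_mult; [apply Cdiff_xpow|apply Cdiff_const].
Qed.

Lemma bdry_bounded f a b c d : a <= b -> c <= d ->
  (forall z, on_bdry a b c d z -> Ccont f z) ->
  exists M, 0 <= M /\ forall z, on_bdry a b c d z -> Cmod (f z) <= M.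
Proof.
  intros Hab Hcd H.
  assert (Hh : forall y, y = c \/ y = d -> exists M, forall x, a <= x <= b -> Cmod (f (x, y)) <= M).
  { intros y Hy.
    destruct (bounded_continuity (K := R_AbsRing) (V := C_R_NormedModule) (fun x => f (x, y)) a b) as [M HM].
    - intros x Hx. apply (Ccont_comp_path f (fun x => (x, y))).
      + apply H. left. auto. + intros; apply Cmod_real_diff.
    - exists M. intros x Hx. rewrite Cmod_norm. left. apply HM, Hx. }
  assert (Hv : forall x, x = a \/ x = b -> exists M, forall y, c <= y <= d -> Cmod (f (x, y)) <= M).
  { intros x Hx.
    destruct (bounded_continuity (K := R_AbsRing) (V := C_R_NormedModule) (fun y => f (x, y)) c d) as [M HM].
    - intros y Hy. apply (Ccont_comp_path f (fun y => (x, y))).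
      + apply H. right. auto. + intros; apply Cmod_imag_diff.
    - exists M. intros y Hy. rewrite Cmod_norm. left. apply HM, Hy. }
  destruct (Hh c (or_introl eq_refl)) as [M1 H1]. destruct (Hh d (or_intror eq_refl)) as [M2 H2].
  destruct (Hv a (or_introl eq_refl)) as [M3 H3]. destruct (Hv b (or_intror eq_refl)) as [M4 H4].
  pose proof (Cmod_ge_0 (f (a, c))). pose proof (Cmod_ge_0 (f (a, d))). pose proof (Cmod_ge_0 (f (b, c))).
  pose proof (H1 a ltac:(lra)). pose proof (H2 a ltac:(lra)). pose proof (H3 c ltac:(lra)).
  pose proof (H4 c ltac:(lra)).
  exists (M1 + M2 + M3 + M4). split; [lra|].
  intros [x y] [[Hx [Hy|Hy]]|[Hy [Hx|Hx]]]; simpl in Hx, Hy; subst.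
  - specialize (H1 x Hx). lra. - specialize (H2 x Hx). lra.
  - specialize (H3 y Hy). lra. - specialize (H4 y Hy). lra.
Qed.

Lemma Cmod_in_rect a b c d z : 0 <= a -> 0 <= c -> in_rect a b c d z -> Cmod z <= b + d.
Proof.
  intros Ha Hc Hz. eapply Rle_trans; [apply Cmod_le_abs|].
  unfold in_rect in Hz. rewrite !Rabs_pos_eq; lra.
Qed.

(* On the part of the boundary where no bound for [zeta - zeta_em] tending to 0
   is known yet, the weight exp (n ((z - s) + (z - s)^2)) is exponentially small
   in n; at the centre s it is 1. *)
Lemma zeta_em_limit zeta s : is_riemann_zeta zeta -> 1 / 2 <= fst s <= 1 -> 1 <= snd s ->
  forall eps, 0 < eps -> exists L, forall N, (1 <= N)%nat -> L <= ln (INR N) ->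
    Cmod (zeta s - zeta_em N s) <= eps.
Proof.
  intros Hz Hs Ht eps He. destruct s as [sg t]. simpl in Hs, Ht.
  (* The left side stays in Re z >= 1/4, and the height 9/10 < 1 <= t keeps the pole outside. With z
     - s = x + i y, the exponent x + x^2 - y^2 of the weight is at most -3/100 on the boundary where
     Re z <= 101/100: there x <= 51/100 and y^2 = 81/100 on the horizontal sides, and x = -1/4 on
     the left side. *)
  set (a := sg - 1 / 4). set (b := sg + 1). set (c := t - 9 / 10). set (d := t + 9 / 10).
  assert (Hrect : forall z, in_rect a b c d z -> z <> RtoC 1).
  { intros z Hr ->. unfold in_rect, c in Hr. simpl in Hr. lra. }
  assert (Hbr : forall z, on_bdry a b c d z -> in_rect a b c d z).
  { intros z. unfold on_bdry, in_rect, a, b, c, d. lra. }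
  destruct (cauchy_estimate a b c d sg t) as [K [HK HC]]; [unfold a, b; lra|unfold c, d; lra|].
  destruct (bdry_bounded (fun z => zeta z - zeta_em 1 z)%C a b c d) as [B0 [HB0 HB]];
    [unfold a, b; lra|unfold c, d; lra|..].
  { intros z Hzb. apply Cdiff_cont, Cdiff_minus; [apply zeta_Cdiff|apply zeta_em_Cdiff]; auto. }
  set (Z := b + d).
  assert (HZ : 0 < Z) by (unfold Z, b, d; lra).
  set (BB := B0 + 2 * Z).
  assert (HBB : forall N z, (1 <= N)%nat -> on_bdry a b c d z -> Cmod (zeta z - zeta_em N z) <= BB).
  { intros N z HN Hzb.
    pose proof (zeta_em_cauchy 1 (N - 1) z (Nat.le_refl 1) (Hrect z (Hbr z Hzb))) as H.
    replace (1 + (N - 1))%nat with N in H by lia.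
    assert (Hf : 1 / 4 <= fst z) by (specialize (Hbr z Hzb); unfold in_rect, a in Hbr; lra).
    specialize (H ltac:(lra)). simpl (INR 1) in H. rewrite ln_1, Rmult_0_r, exp_0 in H.
    pose proof (exp_pos (- fst z * ln (INR N))) as HE.
    pose proof (Cmod_in_rect a b c d z ltac:(unfold a; lra) ltac:(unfold c; lra) (Hbr z Hzb)) as HZb. fold Z in HZb.
    assert (H2 : Cmod (zeta_em N z - zeta_em 1 z) <= 2 * Z).
    { eapply Rle_trans; [exact H|]. apply Rle_trans with (Cmod z / (2 * fst z) * 1).
      - apply Rmult_le_compat_l; [|lra]. apply Rdiv_le_0_compat; [apply Cmod_ge_0|lra].
      - rewrite Rmult_1_r. apply Rle_div_l; [lra|].
        pose proof (Rmult_le_compat_l Z _ _ ltac:(lra) Hf). lra. }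
    replace (zeta z - zeta_em N z)%C with ((zeta z - zeta_em 1 z) - (zeta_em N z - zeta_em 1 z))%C by ring.
    eapply Rle_trans; [apply Cmod_minus_le|]. specialize (HB z Hzb). unfold BB. lra. }
  destruct (exists_exp_small (3 / 400) (K * (BB + Z)) eps) as [L [HL0 HL]]; [lra|lra|].
  exists L. intros N HN HLN. specialize (HL _ HLN).
  assert (HI : 1 <= INR N) by (apply (le_INR 1); auto).
  set (l := ln (INR N)) in *.
  (* To the right of 101/100 the weight grows to at most e^(2 n), against the decay e^(-l) of
     [zeta_em_right]; n = l / 4 leaves e^(-l/2) there and e^(-3 l / 400) on the rest. *)
  set (n := l / 4).
  assert (HBB0 : 0 <= BB) by (unfold BB; lra).
  set (W := fun z => (RtoC n * ((z - (sg, t)) + (z - (sg, t)) * (z - (sg, t))))%C).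
  set (h := fun z => ((zeta z - zeta_em N z) * Cexp (W z))%C).
  assert (Hd : forall z, in_rect a b c d z -> Cdiff h z).
  { intros z Hr. apply Cdiff_mult.
    - apply Cdiff_minus; [apply zeta_Cdiff|apply zeta_em_Cdiff]; auto.
    - apply (Cdiff_comp Cexp W); [apply Cdiff_Cexp|]. unfold W.
      assert (D : Cdiff (fun z => z - (sg, t))%C z) by (apply Cdiff_minus; [apply Cdiff_id|apply Cdiff_const]).
      apply Cdiff_mult; [apply Cdiff_const|]. apply Cdiff_plus; auto. apply Cdiff_mult; auto. }
  assert (Hw : forall z, fst (W z) = n * ((fst z - sg) + (fst z - sg) ^ 2 - (snd z - t) ^ 2)).
  { intros z. unfold W. simpl. ring. }
  assert (Hmono : forall x y, x <= y -> exp x <= exp y).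
  { intros x y [Hxy| ->]; [left; now apply exp_increasing|lra]. }
  assert (HM : forall z, on_bdry a b c d z -> Cmod (h z) <= (BB + Z) * exp (- (3 / 400) * l)).
  { intros z Hzb. pose proof (Hbr z Hzb) as Hr. unfold in_rect in Hr.
    pose proof (exp_pos (- (3 / 400) * l)) as HP.
    unfold h. rewrite Cmod_mult, Cmod_Cexp, Hw.
    set (x := fst z - sg). set (y := snd z - t).
    assert (Hn : 0 <= n) by (unfold n; lra).
    destruct (Rle_lt_dec (fst z) (101 / 100)) as [H1|H1].
    - assert (Hq : x + x ^ 2 - y ^ 2 <= - (3 / 100)).
      { unfold on_bdry, a, b, c, d in Hzb.
        assert (x <= 51 / 100) by (unfold x; lra). assert (- (1 / 4) <= x) by (unfold x, a in *; lra).
        destruct Hzb as [[_ Hy]|[_ Hx]].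
        - assert (Hy2 : y ^ 2 = 81 / 100) by (unfold y; destruct Hy as [->| ->]; field). nra.
        - assert (Hx2 : x = - (1 / 4)) by (unfold x; lra). rewrite Hx2. nra. }
      apply Rle_trans with (BB * exp (- (3 / 400) * l)).
      + apply Rmult_le_compat; [apply Cmod_ge_0|left; apply exp_pos|apply HBB; auto|].
        apply Hmono. unfold n in *. nra.
      + apply Rmult_le_compat_r; lra.
    - apply Rle_trans with (Z * exp (- (3 / 400) * l)); [|apply Rmult_le_compat_r; lra].
      assert (Hq : x + x ^ 2 - y ^ 2 <= 2).
      { assert (x <= 1) by (unfold x, b in *; lra). assert (- (1 / 4) <= x) by (unfold x, a in *; lra). nra. }
      pose proof (Cmod_in_rect a b c d z ltac:(unfold a; lra) ltac:(unfold c; lra) (Hbr z Hzb)) as HZb. fold Z in HZb.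
      apply Rle_trans with ((Z * exp (- l)) * exp (n * 2)).
      + apply Rmult_le_compat; [apply Cmod_ge_0|left; apply exp_pos|..].
        * eapply Rle_trans; [apply (zeta_em_right zeta z N Hz); [lra|auto]|]. fold l.
          apply Rmult_le_compat.
          -- apply Rdiv_le_0_compat; [apply Cmod_ge_0|lra]. -- left; apply exp_pos.
          -- apply Rle_div_l; [lra|]. pose proof (Rmult_lt_compat_l Z _ _ HZ H1). lra.
          -- apply Hmono. nra.
        * apply Hmono. apply Rmult_le_compat_l; lra.
      + rewrite Rmult_assoc, <- exp_plus. apply Rmult_le_compat_l; [lra|]. apply Hmono.
        unfold n. lra. }
  specialize (HC h Hd _ HM).
  assert (E : h (sg, t) = (zeta (sg, t) - zeta_em N (sg, t))%C).
  { unfold h. replace (W (sg, t)) with (RtoC 0).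
    - rewrite Cexp_0. ring.
    - unfold W. replace ((sg, t) - (sg, t))%C with (RtoC 0) by (apply injective_projections; simpl; ring). ring. }
  rewrite E in HC. eapply Rle_trans; [exact HC|]. rewrite <- Rmult_assoc. exact HL.
Qed.

(** To the left of 1, [zeta_em_limit] identifies the limit without a rate; the rate then comes from
    [zeta_em_cauchy], by comparing N with a much larger index. *)
Lemma zeta_approx zeta s N : is_riemann_zeta zeta -> 1 / 2 <= fst s -> 1 <= snd s -> (1 <= N)%nat ->
  Cmod (zeta s - zeta_em N s) <= Cmod s * exp (- fst s * ln (INR N)).
Proof.
  intros Hz Hs Ht HN.
  assert (Hs1 : s <> RtoC 1) by (intros ->; simpl in Ht; lra).
  assert (Hle : Cmod s / (2 * fst s) * exp (- fst s * ln (INR N)) <= Cmod s * exp (- fst s * ln (INR N))).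
  { apply Rmult_le_compat_r; [left; apply exp_pos|]. apply Rle_div_l; [lra|].
    pose proof (Cmod_ge_0 s). nra. }
  destruct (Rlt_le_dec 1 (fst s)) as [H1|H1].
  - eapply Rle_trans; [apply zeta_em_right; auto|exact Hle].
  - apply le_epsilon. intros eps He.
    destruct (zeta_em_limit zeta s Hz (conj Hs H1) Ht eps He) as [L HL].
    destruct (exists_large_ln N L) as [k [Hk1 Hk2]].
    specialize (HL (N + k)%nat Hk1 Hk2).
    pose proof (zeta_em_cauchy N k s HN Hs1 ltac:(lra)) as H3.
    replace (zeta s - zeta_em N s)%C
      with ((zeta s - zeta_em (N + k) s) + (zeta_em (N + k) s - zeta_em N s))%C by ring.
    eapply Rle_trans; [apply Cmod_triangle|].
    assert (0 <= Cmod s / (2 * fst s) * exp (- fst s * ln (INR (N + k)))).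
    { apply Rmult_le_pos; [|left; apply exp_pos]. apply Rdiv_le_0_compat; [apply Cmod_ge_0|lra]. }
    lra.
Qed.

(** * Oscillatory integrals and the Fourier series of the sawtooth *)

Fixpoint rsum (f : nat -> R) (n : nat) : R :=
  match n with O => 0 | S m => rsum f m + f m end.

Lemma ex_RInt_ex_derive (f : R -> R) a b : a <= b ->
  (forall x, a <= x <= b -> ex_derive f x) -> ex_RInt f a b.
Proof.
  intros Hab H. apply (@ex_RInt_continuous R_CompleteNormedModule).
  intros z. rewrite Rmin_left, Rmax_right by lra. intros Hz.
  apply (ex_derive_continuous (K := R_AbsRing) (V := R_NormedModule)), H, Hz.
Qed.

Lemma Rabs_RInt_le (f g : R -> R) a b : a <= b -> ex_RInt f a b -> ex_RInt g a b ->
  (forall x, a <= x <= b -> Rabs (f x) <= g x) -> Rabs (RInt f a b) <= RInt g a b.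
Proof.
  intros Hab Hf Hg H.
  apply (@norm_RInt_le R_NormedModule f g a b (RInt f a b) (RInt g a b) Hab); auto;
    apply (@RInt_correct R_CompleteNormedModule); auto.
Qed.

(** The shift [al] lets one real function serve both parts of the complex kernel: 0 gives the
    cosine, PI / 2 the sine. Division by y makes the relevant derivative of the phase, k y - t,
    linear. *)
Definition osc (k t al y : R) : R := cos (k * y - t * ln y - al) / y.

Lemma ex_RInt_osc k t al a b : 0 < a -> a <= b -> ex_RInt (osc k t al) a b.
Proof.
  intros Ha Hab. apply ex_RInt_ex_derive; auto. intros x Hx. unfold osc. auto_derive. repeat split; lra.
Qed.

(* Integration by parts, with [k y - t] the logarithmic derivative of the phase. *)
Lemma osc_first k t al a b lam : 0 < k -> 0 < a -> a <= b -> 0 < lam ->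
  (forall y, a <= y <= b -> lam <= Rabs (k * y - t)) ->
  Rabs (RInt (osc k t al) a b) <= 4 / lam.
Proof.
  intros Hk Ha Hab Hl H.
  assert (Hnz : forall y, a <= y <= b -> k * y - t <> 0).
  { intros y Hy E. specialize (H y Hy). rewrite E, Rabs_R0 in H. lra. }
  set (G := fun y => sin (k * y - t * ln y - al) / (k * y - t)).
  set (g := fun y => k * sin (k * y - t * ln y - al) / (k * y - t) ^ 2).
  assert (HG : is_RInt (fun y => osc k t al y - g y) a b (G b - G a)).
  { apply is_RInt_antideriv; auto; intros x Hx; specialize (Hnz x Hx).
    - unfold G, g, osc. auto_derive; [repeat split; lra|]. unfold Rminus. field. split; lra.
    - unfold g, osc. auto_derive. repeat split; try lra.
      apply Rmult_integral_contrapositive_currified; [lra|].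
      rewrite Rmult_1_r. lra. }
  assert (Exg : ex_RInt g a b).
  { apply ex_RInt_ex_derive; auto. intros x Hx. specialize (Hnz x Hx). unfold g. auto_derive.
    repeat split; try lra. apply Rmult_integral_contrapositive_currified; [lra|].
    rewrite Rmult_1_r. lra. }
  assert (Hi : is_RInt (fun y => k / (k * y - t) ^ 2) a b (- / (k * b - t) - - / (k * a - t))).
  { apply (is_RInt_antideriv (fun y => - / (k * y - t))); auto; intros x Hx; specialize (Hnz x Hx).
    - auto_derive; [lra|]. field. lra.
    - auto_derive. apply Rmult_integral_contrapositive_currified; [lra|].
      rewrite Rmult_1_r. lra. }
  assert (Hinv : forall y, a <= y <= b -> Rabs (/ (k * y - t)) <= / lam).
  { intros y Hy. rewrite Rabs_inv. apply Rinv_le_contravar; auto. }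
  assert (E : RInt (osc k t al) a b = (G b - G a) + RInt g a b).
  { rewrite <- (is_RInt_unique _ _ _ _ HG).
    rewrite <- (RInt_plus (V := R_CompleteNormedModule)); auto; [|eexists; exact HG].
    apply (RInt_ext (V := R_CompleteNormedModule)). intros x _. unfold plus; simpl. ring. }
  assert (HGb : forall y, a <= y <= b -> Rabs (G y) <= / lam).
  { intros y Hy. unfold G. unfold Rdiv. rewrite Rabs_mult.
    pose proof (SIN_bound (k * y - t * ln y - al)).
    assert (Rabs (sin (k * y - t * ln y - al)) <= 1) by (apply Rabs_le; lra).
    pose proof (Hinv y Hy). pose proof (Rabs_pos (/ (k * y - t))).
    pose proof (Rabs_pos (sin (k * y - t * ln y - al))). nra. }
  assert (Hg : Rabs (RInt g a b) <= 2 / lam).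
  { apply Rle_trans with (RInt (fun y => k / (k * y - t) ^ 2) a b).
    - apply Rabs_RInt_le; auto; [eexists; exact Hi|]. intros x Hx.
      unfold g, Rdiv. rewrite !Rabs_mult, Rabs_inv.
      assert (P : 0 < (k * x - t) ^ 2) by (apply pow2_gt_0, Hnz, Hx).
      rewrite (Rabs_pos_eq k), (Rabs_pos_eq ((k * x - t) ^ 2)) by lra.
      pose proof (SIN_bound (k * x - t * ln x - al)).
      assert (Rabs (sin (k * x - t * ln x - al)) <= 1) by (apply Rabs_le; lra).
      apply Rmult_le_compat_r; [left; apply Rinv_0_lt_compat, P|]. nra.
    - rewrite (is_RInt_unique _ _ _ _ Hi).
      pose proof (Hinv a ltac:(lra)) as H1. pose proof (Hinv b ltac:(lra)) as H2.
      apply Rabs_le_between in H1. apply Rabs_le_between in H2. unfold Rdiv. lra. }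
  pose proof (HGb a ltac:(lra)) as H1. pose proof (HGb b ltac:(lra)) as H2.
  rewrite E. apply Rabs_le_between in H1. apply Rabs_le_between in H2. apply Rabs_le_between in Hg.
  apply Rabs_le. unfold Rdiv in *. lra.
Qed.

(** The second derivative test. An interval of radius d = sqrt (a / k) about the stationary point t
    / k is estimated trivially by 2 d / a, and outside it [osc_first] applies with lam = k d = sqrt
    (k a); hence 4 + 2 + 4 = 10. *)
Lemma osc_second k t al a b : 0 < k -> 0 < a -> a <= b ->
  Rabs (RInt (osc k t al) a b) <= 10 / sqrt (k * a).
Proof.
  intros Hk Ha Hab.
  assert (Hka : 0 < sqrt (k * a)) by (apply sqrt_lt_R0; nra).
  assert (Hsq : sqrt (k * a) * sqrt (k * a) = k * a) by (apply sqrt_sqrt; nra).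
  set (r := sqrt (k * a)) in *. set (d := r / k).
  assert (Hd : 0 < d) by (apply Rdiv_lt_0_compat; auto).
  assert (Hkd : k * d = r) by (unfold d; field; lra).
  set (y0 := t / k). assert (Hy0 : k * y0 = t) by (unfold y0; field; lra).
  (* Cut points clamped to [a, b], so that pieces may shrink to points and the position of the
     stationary point needs no case distinction. *)
  set (c1 := Rmax a (Rmin b (y0 - d))). set (c2 := Rmax a (Rmin b (y0 + d))).
  assert (Hc : a <= c1 /\ c1 <= c2 /\ c2 <= b /\ c2 - c1 <= 2 * d /\
     (c1 = a \/ c1 <= y0 - d) /\ (c2 = b \/ y0 + d <= c2)).
  { unfold c1, c2, Rmax, Rmin.
    repeat destruct (Rle_dec _ _); repeat split; lra. }
  destruct Hc as [Hc1 [Hc12 [Hc2 [Hcd [Hl Hr]]]]].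
  assert (B1 : Rabs (RInt (osc k t al) a c1) <= 4 / r).
  { destruct Hl as [E|Hl].
    - rewrite E, RInt_point. unfold zero; simpl. rewrite Rabs_R0. apply Rdiv_le_0_compat; lra.
    - apply osc_first; auto. intros y Hy. rewrite Rabs_left1; nra. }
  assert (B3 : Rabs (RInt (osc k t al) c2 b) <= 4 / r).
  { destruct Hr as [E|Hr].
    - rewrite E, RInt_point. unfold zero; simpl. rewrite Rabs_R0. apply Rdiv_le_0_compat; lra.
    - apply osc_first; auto; try lra. intros y Hy. rewrite Rabs_pos_eq; nra. }
  assert (B2 : Rabs (RInt (osc k t al) c1 c2) <= 2 / r).
  { apply Rle_trans with (RInt (fun _ => / a) c1 c2).
    - apply Rabs_RInt_le; auto.
      + apply ex_RInt_osc; lra. + apply ex_RInt_const.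
      + intros x Hx. unfold osc, Rdiv. rewrite Rabs_mult, Rabs_inv, (Rabs_pos_eq x) by lra.
        pose proof (COS_bound (k * x - t * ln x - al)).
        assert (Rabs (cos (k * x - t * ln x - al)) <= 1) by (apply Rabs_le; lra).
        assert (/ x <= / a) by (apply Rinv_le_contravar; lra).
        assert (0 < / x) by (apply Rinv_0_lt_compat; lra). nra.
    - rewrite RInt_const. unfold scal; simpl; unfold mult; simpl.
      apply Rle_trans with (2 * d * / a).
      + apply Rmult_le_compat_r; [left; apply Rinv_0_lt_compat; lra|lra].
      + apply Req_le. unfold d. replace (r / k) with (a / r); [field; lra|].
        apply Rmult_eq_reg_r with (k * r); [|nra]. field_simplify; try lra. }
  rewrite <- (RInt_Chasles (V := R_CompleteNormedModule) _ a c1 b) by (apply ex_RInt_osc; lra).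
  rewrite <- (RInt_Chasles (V := R_CompleteNormedModule) _ c1 c2 b) by (apply ex_RInt_osc; lra).
  unfold plus; simpl.
  apply Rabs_le_between in B1. apply Rabs_le_between in B2. apply Rabs_le_between in B3.
  apply Rabs_le. unfold Rdiv in *. lra.
Qed.

(** A second mean value theorem: integrate by parts against the primitive of g; a nonnegative
    decreasing amplitude costs only its initial value. The margin [lo] < a gives a two-sided
    neighbourhood of a on which the primitive exists. *)
Lemma monotone_amplitude (G dG g : R -> R) lo a b B : lo < a -> a <= b ->
  (forall y, lo < y -> continuous g y) ->
  (forall y, a <= y <= b -> is_derive G y (dG y)) ->
  (forall y, a <= y <= b -> continuous dG y) ->
  (forall y, a <= y <= b -> dG y <= 0) -> 0 <= G b ->
  (forall x, a <= x <= b -> Rabs (RInt g a x) <= B) ->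
  Rabs (RInt (fun y => G y * g y) a b) <= G a * B.
Proof.
  intros Hlo Hab Hg HG HdG Hneg HGb HB.
  assert (Eg : forall x, lo < x -> ex_RInt g a x).
  { intros x Hx. apply (@ex_RInt_continuous R_CompleteNormedModule). intros z Hz. apply Hg.
    eapply Rlt_le_trans; [|apply Hz]. apply Rmin_glb_lt; auto. }
  assert (DE : forall x, a <= x <= b -> is_derive (fun x => RInt g a x) x (g x)).
  { intros x Hx. apply (is_derive_RInt (V := R_NormedModule) g (fun x => RInt g a x) a x).
    - assert (Hp : 0 < x - lo) by lra. exists (mkposreal _ Hp). intros y Hy.
      apply (@RInt_correct R_CompleteNormedModule). apply Eg.
      apply Rabs_def2 in Hy. simpl in Hy. unfold minus, plus, opp in Hy; simpl in Hy. lra.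
    - apply Hg. lra. }
  set (E := fun x => RInt g a x) in *.
  assert (CE : forall x, a <= x <= b -> continuous E x).
  { intros x Hx. apply (ex_derive_continuous (K := R_AbsRing) (V := R_NormedModule)).
    eexists. apply DE, Hx. }
  assert (CG : forall x, a <= x <= b -> continuous G x).
  { intros x Hx. apply (ex_derive_continuous (K := R_AbsRing) (V := R_NormedModule)).
    eexists. apply HG, Hx. }
  assert (I1 : is_RInt (fun y => dG y * E y + G y * g y) a b (G b * E b - G a * E a)).
  { apply (@is_RInt_derive R_CompleteNormedModule (fun y => G y * E y));
      intros x; rewrite Rmin_left, Rmax_right by lra; intros Hx.
    - apply (is_derive_mult G E x (dG x) (g x)); auto. exact Rmult_comm.
    - apply (continuous_plus (V := R_NormedModule)); apply (continuous_mult (K := R_AbsRing)); auto.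
      apply Hg. lra. }
  assert (X1 : ex_RInt (fun y => dG y * E y) a b).
  { apply (@ex_RInt_continuous R_CompleteNormedModule). intros x.
    rewrite Rmin_left, Rmax_right by lra. intros Hx. apply (continuous_mult (K := R_AbsRing)); auto. }
  assert (I2 : is_RInt dG a b (G b - G a)).
  { apply (@is_RInt_derive R_CompleteNormedModule G);
      intros x; rewrite Rmin_left, Rmax_right by lra; intros Hx; auto. }
  assert (HB0 : 0 <= B) by (eapply Rle_trans; [apply Rabs_pos|apply (HB a); lra]).
  assert (B1 : Rabs (RInt (fun y => dG y * E y) a b) <= (G a - G b) * B).
  { apply Rle_trans with (RInt (fun y => (- B) * dG y) a b).
    - apply Rabs_RInt_le; auto.
      + eexists. apply (is_RInt_scal (V := R_NormedModule)). exact I2.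
      + intros x Hx. rewrite Rabs_mult. specialize (HB x Hx). specialize (Hneg x Hx).
        fold (E x) in HB. rewrite (Rabs_left1 (dG x)) by lra. nra.
    - apply Req_le. apply is_RInt_unique. evar_last.
      + apply (is_RInt_scal (V := R_NormedModule)). exact I2.
      + unfold scal; simpl; unfold mult; simpl. ring. }
  assert (Ea : E a = 0) by (unfold E; rewrite RInt_point; reflexivity).
  assert (EQ : RInt (fun y => G y * g y) a b = G b * E b - RInt (fun y => dG y * E y) a b).
  { transitivity (minus (RInt (fun y => dG y * E y + G y * g y) a b) (RInt (fun y => dG y * E y) a b)).
    - rewrite <- (RInt_minus (V := R_CompleteNormedModule)); auto; [|eexists; exact I1].
      apply (RInt_ext (V := R_CompleteNormedModule)). intros x _. unfold minus, plus, opp; simpl. ring.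
    - rewrite (is_RInt_unique _ _ _ _ I1), Ea. unfold minus, plus, opp; simpl. ring. }
  rewrite EQ. pose proof (HB b ltac:(lra)) as HBb. fold (E b) in HBb.
  apply Rabs_le_between in HBb. apply Rabs_le_between in B1. apply Rabs_le. nra.
Qed.

(** * Partial sums of the Fourier series of the sawtooth *)

(** On (0, 1) the sawtooth y - 1/2 equals minus the sum of sin (2 pi k y) / (pi k) over k >= 1, so
    this is the error of its M-th Fourier partial sum. *)
Definition saw_err (M : nat) (y : R) : R :=
  y - 1 / 2 + rsum (fun k => sin (2 * PI * INR (S k) * y) / (PI * INR (S k))) M.

Lemma dirichlet_kernel M y :
  (1 + rsum (fun k => 2 * cos (2 * PI * INR (S k) * y)) M) * sin (PI * y) = sin ((2 * INR M + 1) * PI * y).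
Proof.
  induction M.
  - simpl. f_equal. all: ring_simplify; auto. f_equal. ring.
  - cbn [rsum]. set (R0 := rsum _ M) in *.
    replace ((2 * INR (S M) + 1) * PI * y) with (2 * PI * INR (S M) * y + PI * y) by ring.
    replace ((2 * INR M + 1) * PI * y) with (2 * PI * INR (S M) * y - PI * y) in IHM
      by (rewrite S_INR; ring).
    rewrite sin_minus in IHM. rewrite sin_plus. lra.
Qed.

Lemma saw_err_derive M y : is_derive (saw_err M) y (1 + rsum (fun k => 2 * cos (2 * PI * INR (S k) * y)) M).
Proof.
  pose proof PI_RGT_0 as HP. unfold saw_err.
  apply (is_derive_plus (V := R_NormedModule) (fun y => y - 1 / 2)); [auto_derive; auto|].
  induction M.
  - simpl. apply (is_derive_const (V := R_NormedModule)).
  - cbn [rsum]. apply (is_derive_plus (V := R_NormedModule)); [exact IHM|].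
    pose proof (lt_0_INR (S M) ltac:(lia)) as HI. revert HI. generalize (INR (S M)). intros i HI.
    assert (PI * i <> 0) by nra. auto_derive; [auto|]. field. split; lra.
Qed.

Lemma saw_err_sym M y : saw_err M (1 - y) = - saw_err M y.
Proof.
  unfold saw_err. assert (H : rsum (fun k => sin (2 * PI * INR (S k) * (1 - y)) / (PI * INR (S k))) M
     = - rsum (fun k => sin (2 * PI * INR (S k) * y) / (PI * INR (S k))) M).
  { induction M; cbn [rsum]; [ring|]. rewrite IHM.
    replace (2 * PI * INR (S M) * (1 - y)) with (- (2 * PI * INR (S M) * y) + 2 * INR (S M) * PI) by ring.
    rewrite sin_period, sin_neg. unfold Rdiv. ring. }
  rewrite H. lra.
Qed.

Lemma saw_err_half M : saw_err M (1 / 2) = 0.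
Proof.
  pose proof (saw_err_sym M (1 / 2)) as H. replace (1 - 1 / 2) with (1 / 2) in H by field. lra.
Qed.

Lemma sin_PI_ge y : 0 <= y <= 1 / 2 -> y <= sin (PI * y).
Proof.
  intros Hy. pose proof PI_RGT_0 as HP. pose proof PI2_3_2 as HP2.
  destruct (Rle_lt_dec (1 / 6) y) as [H|H].
  - apply Rle_trans with (1 / 2); [lra|]. rewrite <- sin_PI6. apply sin_incr_1; nra.
  - destruct (MVT_gen sin 0 (PI * y) cos) as [c [Hc E]].
    + intros x _. apply is_derive_Reals, derivable_pt_lim_sin.
    + intros x _. apply continuity_pt_filterlim. apply continuous_sin.
    + rewrite Rmin_left, Rmax_right in Hc by nra. rewrite sin_0 in E.
      assert (1 / 2 <= cos c) by (rewrite <- cos_PI3; apply cos_decr_1; nra). nra.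
Qed.

(** The derivative of the error is the Dirichlet kernel, and the error vanishes at 1/2. So it is an
    integral from y to 1/2 of a fast sine with the decreasing amplitude 1 / sin (pi u). *)
Lemma saw_err_decay M y : 0 < y <= 1 / 2 -> Rabs (saw_err M y) <= 1 / ((2 * INR M + 1) * y).
Proof.
  intros Hy. pose proof PI_RGT_0 as HP. pose proof PI2_3_2 as HP2. pose proof (pos_INR M) as HM.
  set (m := (2 * INR M + 1) * PI). assert (Hm : 0 < m) by (unfold m; nra).
  assert (Hsin : forall u, y <= u <= 1 / 2 -> 0 < sin (PI * u)).
  { intros u Hu. pose proof (sin_PI_ge u ltac:(lra)). lra. }
  assert (E : - saw_err M y = RInt (fun u => / sin (PI * u) * sin (m * u)) y (1 / 2)).
  { replace (- saw_err M y) with (saw_err M (1 / 2) - saw_err M y) by (rewrite saw_err_half; ring).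
    symmetry. apply is_RInt_unique. apply is_RInt_antideriv; [lra|..]; intros u Hu; specialize (Hsin u Hu).
    - evar_last; [apply saw_err_derive|]. apply Rmult_eq_reg_r with (sin (PI * u)); [|lra].
      rewrite dirichlet_kernel. fold m. field. lra.
    - auto_derive. lra. }
  rewrite <- Rabs_Ropp, E.
  eapply Rle_trans.
  { apply (monotone_amplitude (fun u => / sin (PI * u)) (fun u => - (PI * cos (PI * u)) / (sin (PI * u)) ^ 2)
      (fun u => sin (m * u)) (y - 1) y (1 / 2) (2 / m)); try lra.
    - intros u _. apply (ex_derive_continuous (K := R_AbsRing) (V := R_NormedModule)). auto_derive; auto.
    - intros u Hu. specialize (Hsin u Hu). auto_derive; [lra|]. field. lra.
    - intros u Hu. specialize (Hsin u Hu).
      apply (ex_derive_continuous (K := R_AbsRing) (V := R_NormedModule)). auto_derive.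
      apply Rmult_integral_contrapositive_currified; [lra|]. rewrite Rmult_1_r. lra.
    - intros u Hu. specialize (Hsin u Hu).
      assert (0 <= cos (PI * u)) by (apply cos_ge_0; nra).
      assert (0 < / sin (PI * u) ^ 2) by (apply Rinv_0_lt_compat, pow_lt; lra).
      assert (0 <= PI * cos (PI * u) * / sin (PI * u) ^ 2)
        by (apply Rmult_le_pos; [apply Rmult_le_pos|]; lra).
      unfold Rdiv. lra.
    - left. apply Rinv_0_lt_compat, Hsin. lra.
    - intros x Hx.
      assert (EI : is_RInt (fun u => sin (m * u)) y x (- cos (m * x) / m - - cos (m * y) / m)).
      { apply (is_RInt_antideriv (fun u => - cos (m * u) / m)); [lra|..]; intros u _; auto_derive; auto.
        field. lra. }
      rewrite (is_RInt_unique _ _ _ _ EI).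
      pose proof (COS_bound (m * x)). pose proof (COS_bound (m * y)).
      replace (- cos (m * x) / m - - cos (m * y) / m) with ((cos (m * y) - cos (m * x)) / m) by (field; lra).
      unfold Rdiv. rewrite Rabs_mult, (Rabs_pos_eq (/ m)) by (left; apply Rinv_0_lt_compat; lra).
      apply Rmult_le_compat_r; [left; apply Rinv_0_lt_compat; lra|]. apply Rabs_le. lra. }
  pose proof (sin_PI_ge y ltac:(lra)) as Hs.
  replace (1 / ((2 * INR M + 1) * y)) with (/ y * (PI / m)) by (unfold m; field; lra).
  apply Rmult_le_compat.
  - left. apply Rinv_0_lt_compat. lra. - left. apply Rdiv_lt_0_compat; lra.
  - apply Rinv_le_contravar; lra.
  - apply Rmult_le_compat_r; [left; apply Rinv_0_lt_compat; lra|lra].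
Qed.

(** Uniformity in M near the jump: where (2 M + 1) y < 1 every one of the M sines contributes at
    most 2 y, and elsewhere the decay estimate is already at most 1. *)
Lemma saw_err_bounded M y : 0 <= y <= 1 / 2 -> Rabs (saw_err M y) <= 2.
Proof.
  intros Hy. pose proof PI_RGT_0 as HP. pose proof (pos_INR M) as HM.
  destruct (Rle_lt_dec 1 ((2 * INR M + 1) * y)) as [H|H].
  - assert (0 < y) by nra. eapply Rle_trans; [apply saw_err_decay; lra|].
    apply Rle_div_l; lra.
  - assert (B : Rabs (rsum (fun k => sin (2 * PI * INR (S k) * y) / (PI * INR (S k))) M) <= INR M * (2 * y)).
    { clear H. clear HM. induction M.
      - simpl. rewrite Rabs_R0. lra.
      - cbn [rsum]. eapply Rle_trans; [apply Rabs_triang|].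
        replace (INR (S M) * (2 * y)) with (INR M * (2 * y) + 2 * y) by (rewrite S_INR; ring).
        apply Rplus_le_compat; [exact IHM|].
        pose proof (lt_0_INR (S M) ltac:(lia)) as HI.
        assert (0 < PI * INR (S M)) by nra.
        unfold Rdiv. rewrite Rabs_mult, (Rabs_pos_eq (/ _)) by (left; apply Rinv_0_lt_compat; lra).
        apply Rle_div_l; [lra|].
        eapply Rle_trans; [apply Rabs_sin_le|]. rewrite Rabs_pos_eq by nra. lra. }
    unfold saw_err. eapply Rle_trans; [apply Rabs_triang|].
    assert (Rabs (y - 1 / 2) <= 1 / 2) by (apply Rabs_le; lra). nra.
Qed.

(** * The sawtooth frequencies as oscillatory integrals on the critical line *)

Definition crit (t : R) : C := (1 / 2, t).

Lemma exp_half_ln y : 0 < y -> exp (- (1 / 2) * ln y) = / sqrt y.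
Proof.
  intros Hy. replace (- (1 / 2) * ln y) with (- (ln y / 2)) by field. rewrite exp_Ropp. f_equal.
  rewrite <- (sqrt_pow2 (exp (ln y / 2))) by (left; apply exp_pos). f_equal.
  simpl. rewrite Rmult_1_r, <- exp_plus. replace (ln y / 2 + ln y / 2) with (ln y) by field.
  now apply exp_ln.
Qed.

(* [ker k t y] is y^(-3/2) exp(i (k y - t ln y)). *)
Definition ker (k t y : R) : C :=
  (exp (- (1 / 2) * ln y) * osc k t 0 y, exp (- (1 / 2) * ln y) * osc k t (PI / 2) y).

Lemma ker_continuous k t y : 0 < y -> Ccontinuous (ker k t) y.
Proof.
  intros Hy. apply Ccontinuous_pair; simpl;
    apply (ex_derive_continuous (K := R_AbsRing) (V := R_NormedModule)); unfold osc; auto_derive;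
    repeat split; lra.
Qed.

Lemma ex_CInt_ker k t a b : 0 < a -> a <= b -> ex_CInt (ker k t) a b.
Proof. intros Ha Hab. apply ex_CInt_continuous; auto. intros y Hy. apply ker_continuous. lra. Qed.

Lemma ker_amplitude k t a b B : 0 < a -> a <= b ->
  (forall al x, a <= x <= b -> Rabs (RInt (osc k t al) a x) <= B) ->
  Cmod (CInt (ker k t) a b) <= 2 * B / sqrt a.
Proof.
  intros Ha Hab H.
  assert (HB : forall al, Rabs (RInt (fun y => exp (- (1 / 2) * ln y) * osc k t al y) a b) <= / sqrt a * B).
  { intros al. rewrite <- exp_half_ln by auto.
    apply (monotone_amplitude (fun y => exp (- (1 / 2) * ln y))
      (fun y => - (1 / 2) * (/ y) * exp (- (1 / 2) * ln y)) (osc k t al) 0 a b B); auto.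
    - intros y Hy. apply (ex_derive_continuous (K := R_AbsRing) (V := R_NormedModule)). unfold osc.
      auto_derive. repeat split; lra.
    - intros y Hy. auto_derive; [lra|]. field. lra.
    - intros y Hy. apply (ex_derive_continuous (K := R_AbsRing) (V := R_NormedModule)).
      auto_derive. repeat split; lra.
    - intros y Hy. pose proof (exp_pos (- (1 / 2) * ln y)).
      assert (0 < / y) by (apply Rinv_0_lt_compat; lra). nra.
    - left. apply exp_pos. }
  rewrite CInt_pair by (apply ex_CInt_ker; auto).
  eapply Rle_trans; [apply Cmod_le_abs|]. simpl.
  pose proof (HB 0). pose proof (HB (PI / 2)). unfold Rdiv. lra.
Qed.

Lemma ker_first k t a b lam : 0 < k -> 0 < a -> a <= b -> 0 < lam ->
  (forall y, a <= y <= b -> lam <= Rabs (k * y - t)) ->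
  Cmod (CInt (ker k t) a b) <= 8 / (lam * sqrt a).
Proof.
  intros Hk Ha Hab Hl H. pose proof (sqrt_lt_R0 a Ha).
  replace (8 / (lam * sqrt a)) with (2 * (4 / lam) / sqrt a) by (field; lra).
  apply ker_amplitude; auto. intros al x Hx. apply osc_first; auto; try lra.
  intros y Hy. apply H. lra.
Qed.

Lemma ker_second k t a b : 0 < k -> 0 < a -> a <= b ->
  Cmod (CInt (ker k t) a b) <= 20 / (sqrt (k * a) * sqrt a).
Proof.
  intros Hk Ha Hab. pose proof (sqrt_lt_R0 a Ha). assert (0 < sqrt (k * a)) by (apply sqrt_lt_R0; nra).
  replace (20 / (sqrt (k * a) * sqrt a)) with (2 * (10 / sqrt (k * a)) / sqrt a) by (field; lra).
  apply ker_amplitude; auto. intros al x Hx. apply osc_second; auto; lra.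
Qed.

(** The sine is split into two exponentials. The one with frequency -k is written as the conjugate
    of the kernel for k and -t; its phase k y + t ln y has no stationary point when t > 0. *)
Lemma sin_dxpow k t x : 0 < x ->
  (RtoC (sin (k * x)) * dxpow (crit t) x)%C
  = (crit t * (Ci * RtoC (/ 2)) * (ker k t x - Cconj (ker k (- t) x)))%C.
Proof.
  intros Hx.
  assert (E : (RtoC (sin (k * x)) * RtoC (/ x) * xpow (crit t) x)%C
    = (- (Ci * RtoC (/ 2)) * (ker k t x - Cconj (ker k (- t) x)))%C).
  { rewrite xpow_eq. unfold ker, osc. simpl fst. simpl snd.
    set (e := exp (- (1 / 2) * ln x)).
    replace (k * x - t * ln x - PI / 2) with (- (PI / 2 - (k * x - t * ln x))) by ring.
    replace (k * x - - t * ln x - PI / 2) with (- (PI / 2 - (k * x + t * ln x))) by ring.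
    rewrite !cos_neg, !cos_shift, !Rminus_0_r.
    replace (k * x - - t * ln x) with (k * x + t * ln x) by ring.
    rewrite sin_minus, sin_plus, cos_minus, cos_plus.
    apply injective_projections; simpl; field; lra. }
  unfold dxpow.
  replace (RtoC (sin (k * x)) * (- crit t * RtoC (/ x) * xpow (crit t) x))%C
    with (- crit t * (RtoC (sin (k * x)) * RtoC (/ x) * xpow (crit t) x))%C by ring.
  rewrite E. ring.
Qed.

Lemma CInt_conj (f : R -> C) a b : ex_CInt f a b ->
  is_CInt (fun x => Cconj (f x)) a b (Cconj (CInt f a b)).
Proof.
  intros H. pose proof (@RInt_correct C_R_CompleteNormedModule f a b H) as HI.
  apply is_CInt_pair; simpl.
  - exact (is_CInt_fst _ _ _ _ HI).
  - apply (is_RInt_opp (V := R_NormedModule)). exact (is_CInt_snd _ _ _ _ HI).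
Qed.

(** The substitution y -> k y reduces every frequency to 2 pi. The factor in front is k^(1/2+it);
    after the division by k in the sawtooth series it becomes the conjugate of k^(-1/2-it), a term
    of the zeta sum itself. *)
Lemma ker_scaling t a b (k : R) : 0 < a -> a <= b -> 0 < k ->
  CInt (ker (2 * PI * k) t) a b
  = (RtoC k * Cconj (xpow (crit t) k) * CInt (ker (2 * PI) t) (k * a)%R (k * b)%R)%C.
Proof.
  intros Ha Hab Hk.
  assert (Ex : ex_CInt (ker (2 * PI) t) (k * a + 0) (k * b + 0)).
  { apply ex_CInt_ker; nra. }
  pose proof (@RInt_comp_lin C_R_CompleteNormedModule (ker (2 * PI) t) k 0 a b Ex) as H.
  rewrite !Rplus_0_r in H. rewrite <- H, <- CInt_Cmult.
  - apply CInt_ext. rewrite Rmin_left, Rmax_right by lra. intros x Hx.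
    rewrite Rplus_0_r. unfold scal; simpl; unfold prod_scal, scal; simpl; unfold mult; simpl.
    rewrite xpow_eq. unfold ker, osc. simpl fst. simpl snd.
    rewrite ln_mult by lra.
    replace (- (1 / 2) * (ln k + ln x)) with (- (1 / 2) * ln k + - (1 / 2) * ln x) by ring.
    rewrite exp_plus.
    assert (Ek : exp (- (1 / 2) * ln k) * exp (- (1 / 2) * ln k) * k = 1).
    { rewrite exp_half_ln by auto. pose proof (sqrt_lt_R0 k Hk).
      rewrite <- (sqrt_sqrt k) at 3 by lra. field. lra. }
    set (e := exp (- (1 / 2) * ln k)) in *. set (e' := exp (- (1 / 2) * ln x)).
    set (th := t * ln k).
    assert (Ecos : forall al, cos (2 * PI * k * x - t * ln x - al)
      = cos th * cos (2 * PI * (k * x) - t * (ln k + ln x) - al)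
        - sin th * cos (2 * PI * (k * x) - t * (ln k + ln x) - (al + PI / 2))).
    { intros al. replace (2 * PI * (k * x) - t * (ln k + ln x) - (al + PI / 2))
        with (- (PI / 2 - (2 * PI * (k * x) - t * (ln k + ln x) - al))) by ring.
      rewrite cos_neg, cos_shift, <- cos_plus. f_equal. unfold th. ring. }
    rewrite (Ecos 0), (Ecos (PI / 2)). rewrite Rplus_0_l.
    set (A0 := cos (2 * PI * (k * x) - t * (ln k + ln x) - 0)).
    set (A1 := cos (2 * PI * (k * x) - t * (ln k + ln x) - PI / 2)).
    replace (cos (2 * PI * (k * x) - t * (ln k + ln x) - (PI / 2 + PI / 2))) with (- A0).
    2:{ unfold A0. rewrite <- neg_cos. rewrite <- cos_neg. rewrite <- (cos_neg (_ - (PI / 2 + PI / 2))).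
        rewrite <- (cos_period _ 1). f_equal. simpl. field. }
    apply injective_projections; simpl.
    + transitivity ((e * e * k) * (e' * (cos th * A0 - sin th * A1) / x)); [rewrite Ek; field; lra|]. field. lra.
    + transitivity ((e * e * k) * (e' * (cos th * A1 - sin th * - A0) / x)); [rewrite Ek; field; lra|]. field. lra.
  - apply ex_CInt_continuous; [lra|]. intros x Hx.
    assert (Hc : Ccontinuous (ker (2 * PI) t) (k * x + 0)) by (apply ker_continuous; nra).
    assert (Hl : continuous (fun y => k * y + 0) x).
    { apply (ex_derive_continuous (K := R_AbsRing) (V := R_NormedModule)). auto_derive; auto. }
    apply (continuous_scal_r (V := C_R_NormedModule) k (fun y => ker (2 * PI) t (k * y + 0))).
    apply (continuous_comp (fun y => k * y + 0) (ker (2 * PI) t)); auto.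
Qed.

Lemma ex_CInt_Rmult_dxpow (r : R -> R) s a b : 0 < a -> a <= b ->
  (forall x, ex_derive r x) -> ex_CInt (fun x => RtoC (r x) * dxpow s x)%C a b.
Proof.
  intros Ha Hab Hr. apply ex_CInt_continuous; auto. intros x Hx.
  destruct (Hr x) as [l Hl]. destruct (Cder_dxpow s x ltac:(lra)) as [m Hm].
  eapply Cder_continuous. apply Cder_Rmult; eassumption.
Qed.

Lemma CInt_csum (f : nat -> R -> C) M a b : (forall k, ex_CInt (f k) a b) ->
  is_CInt (fun x => csum (fun k => f k x) M) a b (csum (fun k => CInt (f k) a b) M).
Proof.
  intros H. induction M; simpl.
  - apply is_CInt_pair; simpl.
    + evar_last; [apply (is_RInt_const (V := R_NormedModule))|]. apply Rmult_0_r.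
    + evar_last; [apply (is_RInt_const (V := R_NormedModule))|]. apply Rmult_0_r.
  - apply (is_RInt_plus (V := C_R_NormedModule)); auto.
    apply (@RInt_correct C_R_CompleteNormedModule). apply H.
Qed.

Lemma Cmod_dxpow_le s x : 0 <= fst s -> 1 <= x -> Cmod (dxpow s x) <= Cmod s.
Proof.
  intros Hs Hx. rewrite Cmod_dxpow by lra. rewrite <- (Rmult_1_r (Cmod s)) at 2.
  apply Rmult_le_compat_l; [apply Cmod_ge_0|].
  apply Rle_div_l; [lra|]. rewrite Rmult_1_l. apply Rle_trans with 1; [|lra].
  rewrite <- exp_0. assert (0 <= ln x) by (rewrite <- ln_1; apply ln_le; lra).
  destruct (Req_dec (- fst s * ln x) 0) as [->|Hn]; [lra|]. left. apply exp_increasing. nra.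
Qed.

(** The Fourier error does not tend to 0 uniformly near integers. Margins of width [eta] rely on the
    uniform bound 2, the middle on the decay; both are uniform in n. *)
Lemma saw_err_small s : 0 <= fst s -> forall eps, 0 < eps -> exists M0, forall M n,
  (M0 <= M)%nat -> (1 <= n)%nat ->
  Cmod (CInt (fun x => RtoC (saw_err M (x - INR n)) * dxpow s x)%C (INR n) (INR (S n))) <= eps.
Proof.
  intros Hs eps He. set (D := Cmod s). assert (HD : 0 <= D) by apply Cmod_ge_0.
  (* The two margins contribute 2 eta * 2 D <= eps / 2, the middle at most eps / (2 (D + 1)) * D <=
     eps / 2. *)
  set (eta := Rmin (1 / 4) (eps / (8 * (D + 1)))).
  assert (Heta : 0 < eta) by (apply Rmin_pos; [lra|apply Rdiv_lt_0_compat; lra]).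
  assert (Heta4 : eta <= 1 / 4) by apply Rmin_l.
  assert (Heta2 : eta * (8 * (D + 1)) <= eps).
  { apply Rle_trans with (eps / (8 * (D + 1)) * (8 * (D + 1))).
    - apply Rmult_le_compat_r; [lra|apply Rmin_r]. - apply Req_le. field. lra. }
  destruct (INR_unbounded ((D + 1) / (eta * eps))) as [M0 HM0]. exists M0. intros M n HM Hn.
  apply le_INR in HM. apply (le_INR 1) in Hn. simpl in Hn. pose proof (S_INR n) as ES.
  set (N := INR n) in *. rewrite ES.
  assert (Hder : forall x, ex_derive (fun x => saw_err M (x - N)) x).
  { intros x. eexists. apply (is_derive_comp (saw_err M) (fun x => x - N)); [apply saw_err_derive|].
    auto_derive; auto. }
  pose proof (fun a b Ha Hab => ex_CInt_Rmult_dxpow (fun x => saw_err M (x - N)) s a b Ha Hab Hder) as Ex.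
  rewrite <- (CInt_Chasles _ N (N + eta) (N + 1)) by (apply Ex; lra).
  rewrite <- (CInt_Chasles _ (N + eta) (N + 1 - eta) (N + 1)) by (apply Ex; lra).
  assert (B2 : forall y, 0 <= y <= 1 -> Rabs (saw_err M y) <= 2).
  { intros y Hy. destruct (Rle_lt_dec y (1 / 2)); [apply saw_err_bounded; lra|].
    replace y with (1 - (1 - y)) by ring. rewrite saw_err_sym, Rabs_Ropp. apply saw_err_bounded. lra. }
  pose proof (pos_INR M) as PM.
  assert (Be : forall y, eta <= y <= 1 - eta -> Rabs (saw_err M y) <= eps / (2 * (D + 1))).
  { assert (G : forall y, eta <= y <= 1 / 2 -> Rabs (saw_err M y) <= eps / (2 * (D + 1))).
    { intros y Hy. eapply Rle_trans; [apply saw_err_decay; lra|].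
      assert (HQ : (D + 1) < INR M * (eta * eps)).
      { apply Rlt_le_trans with (INR M0 * (eta * eps)).
        - apply Rlt_div_l in HM0; [lra|]. apply Rmult_lt_0_compat; lra.
        - apply Rmult_le_compat_r; [|lra]. left. apply Rmult_lt_0_compat; lra. }
      assert (0 < INR M).
      { apply Rmult_lt_reg_r with (eta * eps); [apply Rmult_lt_0_compat; lra|lra]. }
      apply Rle_div_l; [nra|]. apply Rle_trans with (eps / (2 * (D + 1)) * (2 * INR M * eta)).
      - replace (eps / (2 * (D + 1)) * (2 * INR M * eta)) with (INR M * (eta * eps) / (D + 1)) by (field; lra).
        apply Rle_div_r; lra.
      - apply Rmult_le_compat_l; [left; apply Rdiv_lt_0_compat; lra|]. nra. }
    intros y Hy. destruct (Rle_lt_dec y (1 / 2)); [apply G; lra|].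
    replace y with (1 - (1 - y)) by ring. rewrite saw_err_sym, Rabs_Ropp. apply G. lra. }
  assert (I : forall a b B, N <= a -> a <= b -> b <= N + 1 -> 0 <= B ->
     (forall y, a - N <= y <= b - N -> Rabs (saw_err M y) <= B) ->
     Cmod (CInt (fun x => RtoC (saw_err M (x - N)) * dxpow s x)%C a b) <= (b - a) * (B * D)).
  { intros a b B Ha Hab Hb HB H. apply Cmod_CInt_le_const; auto; [apply Ex; lra|].
    intros x Hx. rewrite Cmod_mult, Cmod_R. apply Rmult_le_compat; auto using Rabs_pos, Cmod_ge_0.
    - apply H. lra. - apply Cmod_dxpow_le; lra. }
  pose proof (I N (N + eta) 2 ltac:(lra) ltac:(lra) ltac:(lra) ltac:(lra)
    ltac:(intros; apply B2; lra)) as I1.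
  assert (HE2 : 0 < eps / (2 * (D + 1))) by (apply Rdiv_lt_0_compat; lra).
  pose proof (I (N + eta) (N + 1 - eta) (eps / (2 * (D + 1))) ltac:(lra) ltac:(lra) ltac:(lra) ltac:(lra)
    ltac:(intros; apply Be; lra)) as I2.
  pose proof (I (N + 1 - eta) (N + 1) 2 ltac:(lra) ltac:(lra) ltac:(lra) ltac:(lra)
    ltac:(intros; apply B2; lra)) as I3.
  eapply Rle_trans; [apply Cmod_triangle|].
  eapply Rle_trans; [apply Rplus_le_compat_l, Cmod_triangle|].
  assert (Q : eps / (2 * (D + 1)) * D <= eps / 2).
  { replace (eps / 2) with (eps / (2 * (D + 1)) * (D + 1)) by (field; lra).
    apply Rmult_le_compat_l; lra. }
  assert (0 <= eps / (2 * (D + 1)) * D) by (apply Rmult_le_pos; lra).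
  nra.
Qed.

Definition saw_term (s : C) (k : nat) (a b : R) : C :=
  CInt (fun x => RtoC (sin (2 * PI * INR (S k) * x) / (PI * INR (S k))) * dxpow s x)%C a b.

Lemma ex_saw_term s k a b : 0 < a -> a <= b ->
  ex_CInt (fun x => RtoC (sin (2 * PI * INR (S k) * x) / (PI * INR (S k))) * dxpow s x)%C a b.
Proof.
  intros Ha Hab. apply (ex_CInt_Rmult_dxpow (fun x => sin (2 * PI * INR (S k) * x) / (PI * INR (S k)))); auto.
  intros x. pose proof PI_RGT_0. pose proof (lt_0_INR (S k) ltac:(lia)) as HI. revert HI.
  generalize (INR (S k)). intros i HI. auto_derive. nra.
Qed.

Lemma csum_plus f g n : csum (fun k => f k + g k)%C n = (csum f n + csum g n)%C.
Proof. induction n; simpl; [ring|]. rewrite IHn. ring. Qed.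

Lemma csum_ext f g n : (forall k, (k < n)%nat -> f k = g k) -> csum f n = csum g n.
Proof. intros H. induction n; simpl; auto. rewrite IHn, H; auto. Qed.

Lemma csum_scal c f n : csum (fun k => c * f k)%C n = (c * csum f n)%C.
Proof. induction n; simpl; [ring|]. rewrite IHn. ring. Qed.

Lemma RtoC_rsum f n : RtoC (rsum f n) = csum (fun k => RtoC (f k)) n.
Proof. induction n; simpl; auto. now rewrite RtoC_plus, IHn. Qed.

Lemma sin_shift_period k (x : R) n : sin (2 * PI * INR k * (x - INR n)) = sin (2 * PI * INR k * x).
Proof.
  rewrite <- (sin_period (2 * PI * INR k * (x - INR n)) (k * n)). f_equal. rewrite mult_INR. ring.
Qed.

(** The linear weight x - n - 1/2 changes with the unit interval but the sines have period 1, so for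
    each frequency the unit integrals join to one over the whole range. *)
Lemma zeta_em_fourier s N M E0 j : (1 <= N)%nat -> s <> RtoC 1 ->
  (forall n, (1 <= n)%nat ->
    Cmod (CInt (fun x => RtoC (saw_err M (x - INR n)) * dxpow s x)%C (INR n) (INR (S n))) <= E0) ->
  Cmod (zeta_em (N + j) s - zeta_em N s + csum (fun k => saw_term s k (INR N) (INR (N + j))) M)
  <= INR j * E0.
Proof.
  intros HN Hs HE. assert (HN' : 1 <= INR N) by (apply (le_INR 1); auto).
  induction j.
  - rewrite Nat.add_0_r. replace (csum (fun k => saw_term s k (INR N) (INR N)) M) with (RtoC 0).
    + replace (zeta_em N s - zeta_em N s + 0)%C with (RtoC 0) by ring. rewrite Cmod_0. simpl. lra.
    + transitivity (RtoC 0 * csum (fun k => RtoC 0) M)%C; [ring|]. rewrite <- csum_scal.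
      apply csum_ext. intros k _. unfold saw_term. rewrite (@RInt_point C_R_CompleteNormedModule).
      transitivity (RtoC 0); [ring|reflexivity].
  - set (n := (N + j)%nat). replace (N + S j)%nat with (S n) by (unfold n; lia).
    assert (Hn : (1 <= n)%nat) by (unfold n; lia).
    assert (Hn' : INR N <= INR n) by (apply le_INR; unfold n; lia).
    pose proof (S_INR n) as ES.
    assert (HC : csum (fun k => saw_term s k (INR N) (INR (S n))) M
      = (csum (fun k => saw_term s k (INR N) (INR n)) M + csum (fun k => saw_term s k (INR n) (INR (S n))) M)%C).
    { rewrite <- csum_plus. apply csum_ext. intros k _. unfold saw_term. symmetry.
      apply CInt_Chasles; apply ex_saw_term; lra. }
    rewrite HC.
    assert (Ex1 : ex_CInt (fun x => RtoC (saw_err M (x - INR n)) * dxpow s x)%C (INR n) (INR (S n))).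
    { apply (ex_CInt_Rmult_dxpow (fun x => saw_err M (x - INR n))); try lra. intros x.
      eexists. apply (is_derive_comp (saw_err M) (fun x => x - INR n)); [apply saw_err_derive|].
      auto_derive; auto. }
    pose proof (CInt_csum (fun k x => RtoC (sin (2 * PI * INR (S k) * x) / (PI * INR (S k))) * dxpow s x)%C
       M (INR n) (INR (S n)) (fun k => ex_saw_term s k (INR n) (INR (S n)) ltac:(lra) ltac:(lra))) as Ex2.
    assert (EQ : (zeta_em (S n) s - zeta_em n s)%C
      = (CInt (fun x => RtoC (saw_err M (x - INR n)) * dxpow s x)%C (INR n) (INR (S n))
         - csum (fun k => saw_term s k (INR n) (INR (S n))) M)%C).
    { rewrite zeta_em_step by auto.
      unfold saw_term. rewrite <- (@is_RInt_unique C_R_CompleteNormedModule _ _ _ _ Ex2).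
      rewrite <- CInt_minus; [|exact Ex1|eexists; exact Ex2].
      apply CInt_ext. intros x _.
      transitivity ((RtoC (saw_err M (x - INR n))
         - csum (fun k => RtoC (sin (2 * PI * INR (S k) * x) / (PI * INR (S k)))) M) * dxpow s x)%C.
      - f_equal. rewrite <- RtoC_rsum, <- RtoC_minus. f_equal. unfold saw_err.
        replace (rsum (fun k => sin (2 * PI * INR (S k) * (x - INR n)) / (PI * INR (S k))) M)
          with (rsum (fun k => sin (2 * PI * INR (S k) * x) / (PI * INR (S k))) M); [ring|].
        clear. induction M; cbn [rsum]; auto. rewrite IHM, sin_shift_period. reflexivity.
      - assert (EC : csum (fun k => RtoC (sin (2 * PI * INR (S k) * x) / (PI * INR (S k))) * dxpow s x)%C M
          = (dxpow s x * csum (fun k => RtoC (sin (2 * PI * INR (S k) * x) / (PI * INR (S k)))) M)%C).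
        { rewrite <- csum_scal. apply csum_ext. intros k _. apply Cmult_comm. }
        rewrite EC. ring. }
    fold n in IHj.
    replace (zeta_em (S n) s - zeta_em N s
       + (csum (fun k => saw_term s k (INR N) (INR n)) M + csum (fun k => saw_term s k (INR n) (INR (S n))) M))%C
      with ((zeta_em n s - zeta_em N s + csum (fun k => saw_term s k (INR N) (INR n)) M)
        + (zeta_em (S n) s - zeta_em n s + csum (fun k => saw_term s k (INR n) (INR (S n))) M))%C by ring.
    rewrite EQ.
    eapply Rle_trans; [apply Cmod_triangle|]. rewrite (S_INR j).
    specialize (HE n Hn).
    assert (RR : forall a b : C, (a - b + b)%C = a) by (intros; ring).
    rewrite RR.
    eapply Rle_trans; [apply Rplus_le_compat; [exact IHj|exact HE]|]. lra.
Qed.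

Lemma saw_term_ker t k a b : 0 < a -> a <= b ->
  saw_term (crit t) k a b
  = (crit t * (Ci * RtoC (/ (2 * PI)))
      * (RtoC (/ INR (S k)) * CInt (ker (2 * PI * INR (S k)) t) a b
         - RtoC (/ INR (S k)) * Cconj (CInt (ker (2 * PI * INR (S k)) (- t)) a b)))%C.
Proof.
  intros Ha Hab. pose proof PI_RGT_0 as HP. pose proof (lt_0_INR (S k) ltac:(lia)) as HI.
  unfold saw_term. set (i := INR (S k)) in *.
  pose proof (@RInt_correct C_R_CompleteNormedModule _ _ _ (ex_CInt_ker (2 * PI * i) t a b Ha Hab)) as H1.
  pose proof (CInt_conj _ _ _ (ex_CInt_ker (2 * PI * i) (- t) a b Ha Hab)) as H2.
  pose proof (is_RInt_minus (V := C_R_NormedModule) _ _ _ _ _ _ H1 H2) as H3.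
  pose proof (is_CInt_Cmult (crit t * (Ci * RtoC (/ (2 * PI))) * RtoC (/ i))%C _ _ _ _ H3) as H4.
  transitivity (crit t * (Ci * RtoC (/ (2 * PI))) * RtoC (/ i)
     * (CInt (ker (2 * PI * i) t) a b - Cconj (CInt (ker (2 * PI * i) (- t)) a b)))%C; [|ring].
  apply (@is_RInt_unique C_R_CompleteNormedModule).
  eapply (is_RInt_ext (V := C_R_NormedModule)); [|exact H4].
  rewrite Rmin_left, Rmax_right by lra. intros x Hx. simpl.
  replace (RtoC (sin (2 * PI * i * x) / (PI * i))) with (RtoC (/ (PI * i)) * RtoC (sin (2 * PI * i * x)))%C
    by (rewrite <- RtoC_mult; f_equal; field; lra).
  transitivity (RtoC (/ (PI * i)) * (RtoC (sin (2 * PI * i * x)) * dxpow (crit t) x))%C; [|ring].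
  rewrite sin_dxpow by lra.
  replace (RtoC (/ (2 * PI))) with (RtoC (/ 2) * RtoC (/ PI))%C by (rewrite <- RtoC_mult; f_equal; field; lra).
  replace (RtoC (/ (PI * i))) with (RtoC (/ PI) * RtoC (/ i))%C by (rewrite <- RtoC_mult; f_equal; field; lra).
  match goal with |- context [ minus ?p ?q ] => change (minus p q) with (p - q)%C end.
  ring.
Qed.

(** * Finite sums and harmonic numbers *)

Lemma Cmod_csum f n : Cmod (csum f n) <= rsum (fun k => Cmod (f k)) n.
Proof.
  induction n; simpl; [rewrite Cmod_0; lra|]. eapply Rle_trans; [apply Cmod_triangle|]. lra.
Qed.

Lemma rsum_le f g n : (forall k, (k < n)%nat -> f k <= g k) -> rsum f n <= rsum g n.
Proof.
  intros H. induction n; simpl; [lra|]. apply Rplus_le_compat; auto.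
Qed.

Lemma rsum_ext f g n : (forall k, (k < n)%nat -> f k = g k) -> rsum f n = rsum g n.
Proof. intros H. induction n; simpl; auto. rewrite IHn, H; auto. Qed.

Lemma rsum_scal c f n : rsum (fun k => c * f k) n = c * rsum f n.
Proof. induction n; simpl; [ring|]. rewrite IHn. ring. Qed.

Lemma rsum_plus f g n : rsum (fun k => f k + g k) n = rsum f n + rsum g n.
Proof. induction n; simpl; [ring|]. rewrite IHn. ring. Qed.

Lemma rsum_const c n : rsum (fun _ => c) n = INR n * c.
Proof. induction n; [simpl; ring|]. cbn [rsum]. rewrite IHn, S_INR. ring. Qed.

Lemma rsum_nonneg f n : (forall k, (k < n)%nat -> 0 <= f k) -> 0 <= rsum f n.
Proof. intros H. induction n; simpl; [lra|]. apply Rplus_le_le_0_compat; auto. Qed.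

Lemma rsum_split f a b : rsum f (a + b) = rsum f a + rsum (fun k => f (a + k)%nat) b.
Proof.
  induction b; simpl; [rewrite Nat.add_0_r; ring|]. rewrite Nat.add_succ_r. simpl. rewrite IHb. ring.
Qed.

Lemma rsum_mono f a b : (a <= b)%nat -> (forall k, 0 <= f k) -> rsum f a <= rsum f b.
Proof.
  intros Hab Hf. replace b with (a + (b - a))%nat by lia. rewrite rsum_split.
  pose proof (rsum_nonneg (fun k => f (a + k)%nat) (b - a) (fun k _ => Hf _)). lra.
Qed.

Lemma csum_split f a b : csum f (a + b) = (csum f a + csum (fun k => f (a + k)%nat) b)%C.
Proof.
  induction b; simpl; [rewrite Nat.add_0_r; ring|]. rewrite Nat.add_succ_r. simpl. rewrite IHb. ring.
Qed.

Definition harm (n : nat) : R := rsum (fun k => / INR (S k)) n.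

Lemma inv_S_pos k : 0 < / INR (S k).
Proof. apply Rinv_0_lt_compat, lt_0_INR. lia. Qed.

Lemma harm_mono a b : (a <= b)%nat -> harm a <= harm b.
Proof. intros H. apply rsum_mono; auto. intros k. left. apply inv_S_pos. Qed.

Lemma harm_pow2 m : harm (2 ^ m) <= 1 + INR m.
Proof.
  induction m.
  - unfold harm. simpl. lra.
  - replace (2 ^ S m)%nat with (2 ^ m + 2 ^ m)%nat by (simpl; lia).
    unfold harm in *. rewrite rsum_split, S_INR.
    assert (H : rsum (fun k => / INR (S (2 ^ m + k))) (2 ^ m) <= 1).
    { assert (HP : 0 < INR (2 ^ m)) by (apply lt_0_INR; pose proof (Nat.pow_nonzero 2 m); lia).
      apply Rle_trans with (rsum (fun _ => / INR (2 ^ m)) (2 ^ m)).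
      - apply rsum_le. intros k _. apply Rinv_le_contravar; auto. apply le_INR. lia.
      - rewrite rsum_const. apply Req_le. field. lra. }
    lra.
Qed.

(** On either side of p the distances run through distinct integers. *)
Lemma harm_dist p m : rsum (fun j => / (Rabs (INR j - INR p) + 1)) m <= harm m + harm (S p).
Proof.
  set (f1 := fun j => if Compare_dec.le_dec p j then / INR (S (j - p)) else 0).
  set (f2 := fun j => if Compare_dec.le_dec p j then 0 else / INR (S (p - j))).
  apply Rle_trans with (rsum (fun j => f1 j + f2 j) m).
  { apply rsum_le. intros k _. unfold f1, f2. destruct (Compare_dec.le_dec p k) as [H|H].
    - rewrite S_INR, minus_INR by auto. apply le_INR in H. rewrite Rabs_pos_eq by lra. lra.
    - assert (H' : (k <= p)%nat) by lia. rewrite S_INR, minus_INR by auto. apply le_INR in H'.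
      rewrite Rabs_left1 by lra. replace (- (INR k - INR p)) with (INR p - INR k) by ring. lra. }
  rewrite rsum_plus. apply Rplus_le_compat.
  - assert (E : rsum f1 m = harm (m - p)).
    { induction m; [reflexivity|]. cbn [rsum]. rewrite IHm. unfold f1. destruct (Compare_dec.le_dec p m) as [H|H].
      - replace (S m - p)%nat with (S (m - p)) by lia. reflexivity.
      - replace (m - p)%nat with 0%nat by lia. replace (S m - p)%nat with 0%nat by lia. apply Rplus_0_r. }
    rewrite E. apply harm_mono. lia.
  - assert (E : rsum f2 m <= harm (S p) - harm (S p - m)).
    { induction m; [change (0 <= harm (S p) - harm (S p)); lra|]. cbn [rsum]. destruct (Compare_dec.le_dec p m) as [H|H].
      - pose proof (harm_mono (S p - S m) (S p - m) ltac:(lia)).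
        unfold f2 at 2. destruct (Compare_dec.le_dec p m); [lra|lia].
      - replace (S p - m)%nat with (S (p - m)) in IHm by lia.
        change (S p - S m)%nat with (p - m)%nat.
        change (harm (S (p - m))) with (harm (p - m) + / INR (S (p - m))) in IHm.
        unfold f2 at 2. destruct (Compare_dec.le_dec p m); [lia|lra]. }
    pose proof (harm_mono 0 (S p - m) ltac:(lia)) as H0. change (harm 0) with 0 in H0. lra.
Qed.

(** Induction on the sharper bound 3 - 2 / sqrt m, which absorbs each new term. *)
Lemma sum_three_halves m : rsum (fun k => / (INR (S k) * sqrt (INR (S k)))) m <= 3.
Proof.
  assert (H : forall m, rsum (fun k => / (INR (S k) * sqrt (INR (S k)))) (S m) <= 3 - 2 / sqrt (INR (S m))).
  { clear m. induction m.
    - simpl. rewrite sqrt_1. lra.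
    - set (f := fun k => / (INR (S k) * sqrt (INR (S k)))) in *.
      change (rsum f (S (S m))) with (rsum f (S m) + f (S m)).
      assert (Hk : 1 <= INR (S m)) by (apply (le_INR 1); lia).
      unfold f at 2. rewrite (S_INR (S m)). set (x := INR (S m)) in *.
      pose proof (sqrt_lt_R0 x ltac:(lra)) as Ha. pose proof (sqrt_lt_R0 (x + 1) ltac:(lra)) as Hb.
      pose proof (sqrt_sqrt x ltac:(lra)) as Ea. pose proof (sqrt_sqrt (x + 1) ltac:(lra)) as Eb.
      set (a := sqrt x) in *. set (b := sqrt (x + 1)) in *.
      assert (Hab : a < b) by nra.
      assert (K : / ((x + 1) * b) <= 2 / a - 2 / b).
      { replace (2 / a - 2 / b) with (2 * (b - a) / (a * b)) by (field; lra).
        assert (E : (b - a) * (b + a) = 1) by nra.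
        apply Rmult_le_reg_r with ((x + 1) * b * a); [repeat apply Rmult_lt_0_compat; lra|].
        replace (/ ((x + 1) * b) * ((x + 1) * b * a)) with a by (field; lra).
        replace (2 * (b - a) / (a * b) * ((x + 1) * b * a)) with (2 * (b - a) * (x + 1)) by (field; lra).
        rewrite <- Eb. apply Rmult_le_reg_r with (b + a); [lra|].
        replace (2 * (b - a) * (b * b) * (b + a)) with (2 * (b * b) * ((b - a) * (b + a))) by ring.
        rewrite E. nra. }
      lra. }
  destruct m; [simpl; lra|]. eapply Rle_trans; [apply H|].
  assert (0 < sqrt (INR (S m))) by (apply sqrt_lt_R0, lt_0_INR; lia).
  assert (0 < 2 / sqrt (INR (S m))) by (apply Rdiv_lt_0_compat; lra). lra.
Qed.

(** Interchange of summation: by additivity of J, the block from j + 1 to j + 2 occurs in the terms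
    k = 0, ..., j and so carries a partial sum of c. *)
Lemma abel_blocks (J : nat -> nat -> C) (c : nat -> C) n :
  (forall a b d, (1 <= a <= b)%nat -> (b <= d)%nat -> J a d = (J a b + J b d)%C) ->
  csum (fun k => c k * J (S k) (S n))%C n = csum (fun j => J (S j) (S (S j)) * csum c (S j))%C n.
Proof.
  intros HJ. induction n; [reflexivity|].
  cbn [csum]. cbn [csum] in IHn.
  rewrite <- IHn.
  assert (E : csum (fun k => c k * J (S k) (S (S n)))%C n
    = (csum (fun k => c k * J (S k) (S n))%C n + J (S n) (S (S n)) * csum c n)%C).
  { rewrite <- csum_scal, <- csum_plus. apply csum_ext. intros k Hk.
    rewrite (HJ (S k) (S n) (S (S n))) by lia. ring. }
  rewrite E. ring.
Qed.

(** The first derivative test without a stationary point. By i + U >= 2 sqrt (i U) the bound becomes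
    U^(-2) i^(-3/2), which is summable over i and small enough for the factor |s|. *)
Lemma tail_term_bound U i a b lam kap tt : 1 <= U -> 1 <= i -> U <= a -> a <= b ->
  0 < kap -> U * (i + U) <= lam -> (forall y, a <= y <= b -> lam <= Rabs (kap * y - tt)) ->
  / i * Cmod (CInt (ker kap tt) a b) <= 4 / U ^ 2 * / (i * sqrt i).
Proof.
  intros HU Hi Ha Hab Hk Hl H.
  pose proof (sqrt_lt_R0 i ltac:(lra)) as Pi. pose proof (sqrt_lt_R0 U ltac:(lra)) as PU.
  pose proof (sqrt_sqrt i ltac:(lra)) as Ei. pose proof (sqrt_sqrt U ltac:(lra)) as EU.
  assert (PL : 0 < lam) by nra.
  assert (Hs : sqrt U <= sqrt a) by (apply sqrt_le_1_alt; lra).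
  assert (AM : 2 * (sqrt i * sqrt U) <= i + U).
  { pose proof (pow2_ge_0 (sqrt i - sqrt U)). nra. }
  assert (B : Cmod (CInt (ker kap tt) a b) <= 4 / (U ^ 2 * sqrt i)).
  { eapply Rle_trans; [apply (ker_first kap tt a b lam); auto; lra|].
    apply Rle_trans with (8 / (2 * U ^ 2 * sqrt i)); [|apply Req_le; field; lra].
    apply Rmult_le_compat_l; [lra|]. apply Rinv_le_contravar; [repeat apply Rmult_lt_0_compat; try lra; apply pow_lt; lra|].
    apply Rle_trans with (U * (2 * (sqrt i * sqrt U)) * sqrt U).
    - replace (U * (2 * (sqrt i * sqrt U)) * sqrt U) with (2 * U * sqrt i * (sqrt U * sqrt U)) by ring.
      rewrite EU. apply Req_le. ring.
    - apply Rmult_le_compat; try lra. + repeat apply Rmult_le_pos; lra.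
      + eapply Rle_trans; [|exact Hl]. apply Rmult_le_compat_l; lra. }
  replace (4 / U ^ 2 * / (i * sqrt i)) with (/ i * (4 / (U ^ 2 * sqrt i))) by (field; lra).
  apply Rmult_le_compat_l; [left; apply Rinv_0_lt_compat; lra|exact B].
Qed.

(** The stationary point t / (2 pi) lies in block p. Blocks p - 1, p, p + 1 use the second
    derivative test; block i further away uses the first one with lam = 6 U (|i - p| - 1). The
    factor 5 U^2 is the bound for |s| that the integral has to beat. *)
Lemma block_bound U t (p i : R) : 1 <= U -> U ^ 2 <= t -> 1 <= i -> 0 <= p ->
  p <= t / (2 * PI * U) < p + 1 -> (Rabs (i - p) <= 1 \/ 2 <= Rabs (i - p)) ->
  5 * U ^ 2 * Cmod (CInt (ker (2 * PI) t) (i * U) ((i + 1) * U))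
  <= 2400 * (/ i + / (Rabs (i - p) + 1)).
Proof.
  intros HU Ht Hi Hp Hfl Hc.
  pose proof PI_4 as HP4. pose proof PI2_3_2 as HP3. assert (HP : 3 < PI) by lra.
  assert (HQ : 0 < 2 * PI * U) by nra.
  assert (Hlo : p * (2 * PI * U) <= t) by (apply Rle_div_r; lra).
  assert (Hhi : t < (p + 1) * (2 * PI * U)) by (apply Rlt_div_l; lra).
  (* From U^2 <= t < (p + 1) 2 pi U. Near p this bounds U / i by a constant plus O(1/i). *)
  assert (HU8 : U <= 8 * (p + 1)) by nra.
  assert (HiU : 0 < i * U) by nra.
  pose proof (sqrt_lt_R0 (i * U) HiU) as Ps. pose proof (sqrt_sqrt (i * U) ltac:(lra)) as Es.
  pose proof (Rabs_pos (i - p)) as Pd. set (d := Rabs (i - p)) in *.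
  assert (P1 : 0 < / i) by (apply Rinv_0_lt_compat; lra).
  assert (P2 : 0 < / (d + 1)) by (apply Rinv_0_lt_compat; lra).
  destruct Hc as [Hc|Hc].
  - assert (B : Cmod (CInt (ker (2 * PI) t) (i * U) ((i + 1) * U)) <= 20 / (i * U)).
    { eapply Rle_trans; [apply ker_second; nra|]. apply Rmult_le_compat_l; [lra|].
      apply Rinv_le_contravar; auto. rewrite <- Es at 1. apply Rmult_le_compat_r; [lra|].
      apply sqrt_le_1_alt. nra. }
    assert (Hpi : p <= i + 1) by (unfold d in Hc; apply Rabs_le_between in Hc; lra).
    apply Rle_trans with (5 * U ^ 2 * (20 / (i * U))).
    + apply Rmult_le_compat_l; [nra|exact B].
    + replace (5 * U ^ 2 * (20 / (i * U))) with (100 * (U / i)) by (field; lra).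
      assert (/ 2 <= / (d + 1)) by (apply Rinv_le_contravar; lra).
      assert (U / i <= 8 + 16 / i).
      { apply Rle_div_l; [lra|]. replace ((8 + 16 / i) * i) with (8 * i + 16) by (field; lra). lra. }
      unfold Rdiv in *. lra.
  - set (D := d - 1). assert (HD : 1 <= D) by (unfold D; lra).
    assert (B : Cmod (CInt (ker (2 * PI) t) (i * U) ((i + 1) * U)) <= 8 / (6 * U * D * sqrt (i * U))).
    { assert (P6 : 0 < 6 * U * D) by nra.
      eapply Rle_trans; [apply (ker_first (2 * PI) t (i * U) ((i + 1) * U) (6 * U * D)); try nra|lra].
      intros y Hy.
      apply Rle_trans with (2 * PI * U * D); [apply Rmult_le_compat_r; nra|].
      unfold D, d, Rabs at 1. destruct (Rcase_abs (i - p)) as [Hn|Hn].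
      - unfold d in Hc. rewrite Rabs_left in Hc by lra. rewrite Rabs_left1.
        + assert (2 * PI * y <= 2 * PI * ((i + 1) * U)) by (apply Rmult_le_compat_l; lra). lra.
        + assert (2 * PI * y <= 2 * PI * ((i + 1) * U)) by (apply Rmult_le_compat_l; lra).
          assert (0 <= 2 * PI * U * (p - i - 1)) by (apply Rmult_le_pos; lra). lra.
      - unfold d in Hc. rewrite Rabs_pos_eq in Hc by lra.
        assert (2 * PI * (i * U) <= 2 * PI * y) by (apply Rmult_le_compat_l; lra).
        assert (0 <= 2 * PI * U * (i - p - 1)) by (apply Rmult_le_pos; lra).
        rewrite Rabs_pos_eq; lra. }
    assert (Hpi : p <= i + D + 1).
    { unfold D, d. pose proof (Rle_abs (p - i)). rewrite Rabs_minus_sym in H. lra. }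
    assert (Hsq : sqrt (i * U) <= 4 * (i + D)).
    { rewrite <- (sqrt_pow2 (4 * (i + D))) by lra. apply sqrt_le_1_alt. nra. }
    apply Rle_trans with (5 * U ^ 2 * (8 / (6 * U * D * sqrt (i * U)))).
    + apply Rmult_le_compat_l; [nra|exact B].
    + replace (5 * U ^ 2 * (8 / (6 * U * D * sqrt (i * U))))
        with (20 / 3 * ((i * U) / sqrt (i * U)) / (D * i)) by (field; lra).
      rewrite <- Es at 1. replace (sqrt (i * U) * sqrt (i * U) / sqrt (i * U)) with (sqrt (i * U)) by (field; lra).
      apply Rle_trans with (20 / 3 * (4 * (i + D)) / (D * i)).
      * unfold Rdiv at 1 3. apply Rmult_le_compat_r; [left; apply Rinv_0_lt_compat; nra|lra].
      * replace (20 / 3 * (4 * (i + D)) / (D * i)) with (80 / 3 * (/ D + / i)) by (field; lra).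
        assert (/ D <= 3 * / (d + 1)).
        { replace (3 * / (d + 1)) with (/ ((d + 1) / 3)) by (field; lra). apply Rinv_le_contravar; unfold D; lra. }
        lra.
Qed.

(** * Zeta on the critical line through its partial sums *)

Definition zsum (s : C) (n : nat) : C := csum (fun k => xpow s (INR (S k))) n.

Lemma csum_conj f n : csum (fun k => Cconj (f k)) n = Cconj (csum f n).
Proof.
  induction n; simpl.
  - apply injective_projections; simpl; ring.
  - rewrite IHn. apply injective_projections; simpl; ring.
Qed.

Lemma csum_opp f n : csum (fun k => - f k)%C n = (- csum f n)%C.
Proof. induction n; simpl; [ring|]. rewrite IHn. ring. Qed.

Section Afe.
Variables (n : nat) (t B : R).
Hypothesis Hn : (1 <= n)%nat.
Let U := INR n.
Hypothesis Ht : U ^ 2 <= t <= 4 * U ^ 2.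
Hypothesis HB : forall j, (j <= 2 * n)%nat -> Cmod (zsum (crit t) j) <= B.

(** Frequencies 1, ..., m = 2 U - 1 form the head; from 2 U on, 2 pi k y >= 12 U^2 > t for all y >=
    U, so nothing is stationary. The upper end X = 4 U^4 is chosen so that the error |s| X^(-1/2) of
    [zeta_approx] is bounded. *)
Let m := (2 * n - 1)%nat.
Let X := 4 * U ^ 4.
Let JR a b := CInt (ker (2 * PI) t) a b.
Let w k := / (INR (S k) * sqrt (INR (S k))).

Local Lemma HU : 1 <= U.
Proof. apply (le_INR 1). exact Hn. Qed.

Local Lemma HU2 : 1 <= U ^ 2 /\ U <= U ^ 2.
Proof. pose proof HU. nra. Qed.

Local Lemma HX : 2 * U ^ 2 <= X /\ U <= X.
Proof. pose proof HU. pose proof HU2. unfold X. replace (U ^ 4) with (U ^ 2 * U ^ 2) by ring. nra. Qed.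

Local Lemma PI_bounds : 3 < PI <= 4.
Proof. pose proof PI_4. pose proof PI2_3_2. lra. Qed.

Local Lemma HB0 : 0 <= B.
Proof. pose proof (HB 0 ltac:(lia)) as H. unfold zsum in H. simpl in H. rewrite Cmod_0 in H. exact H. Qed.

Local Lemma INR_S_ge_1 k : 1 <= INR (S k).
Proof. apply (le_INR 1). lia. Qed.

Local Lemma INR_Sm : INR (S m) = 2 * U.
Proof. unfold m, U. replace (S (2 * n - 1)) with (2 * n)%nat by lia. rewrite mult_INR. simpl. ring. Qed.

Local Lemma sum_w_tail a b : rsum (fun k => w (a + k)%nat) b <= 3.
Proof.
  pose proof (sum_three_halves (a + b)) as H. rewrite rsum_split in H.
  assert (0 <= rsum (fun k => / (INR (S k) * sqrt (INR (S k)))) a); [|unfold w; lra].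
  apply rsum_nonneg. intros k _. left. apply Rinv_0_lt_compat.
  pose proof (INR_S_ge_1 k). apply Rmult_lt_0_compat; [lra|apply sqrt_lt_R0; lra].
Qed.

Local Lemma minus_part M :
  Cmod (csum (fun k => RtoC (/ INR (S k)) * Cconj (CInt (ker (2 * PI * INR (S k)) (- t)) U X))%C M)
  <= 12 / U ^ 2.
Proof.
  pose proof HU. pose proof HU2. pose proof HX. pose proof PI_bounds.
  eapply Rle_trans; [apply Cmod_csum|].
  apply Rle_trans with (rsum (fun k => 4 / U ^ 2 * w (0 + k)%nat) M).
  - apply rsum_le. intros k _. pose proof (INR_S_ge_1 k) as Hk.
    rewrite Cmod_mult, Cmod_conj, Cmod_R, Rabs_pos_eq by (left; apply Rinv_0_lt_compat; lra).
    simpl (0 + k)%nat. unfold w. set (i := INR (S k)) in *.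
    apply (tail_term_bound U i U X (U * (i + U))); try lra; try nra.
    intros y Hy. assert (i * U <= i * y) by (apply Rmult_le_compat_l; lra).
    assert (0 < i * U) by (apply Rmult_lt_0_compat; lra).
    assert (6 * (i * y) <= 2 * PI * i * y).
    { replace (2 * PI * i * y) with (2 * PI * (i * y)) by ring. apply Rmult_le_compat_r; lra. }
    rewrite Rabs_pos_eq; lra.
  - rewrite rsum_scal. pose proof (sum_w_tail 0 M).
    replace (12 / U ^ 2) with (4 / U ^ 2 * 3) by (field; lra).
    apply Rmult_le_compat_l; [left; apply Rdiv_lt_0_compat; lra|lra].
Qed.

(** Here i >= 2 U, so t <= 4 U^2 <= 2 i U takes only a third of 2 pi i y >= 6 i U. *)
Local Lemma plus_tail M :
  Cmod (csum (fun k => RtoC (/ INR (S (m + k))) * CInt (ker (2 * PI * INR (S (m + k))) t) U X)%C M)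
  <= 12 / U ^ 2.
Proof.
  pose proof HU. pose proof HU2. pose proof HX. pose proof PI_bounds.
  eapply Rle_trans; [apply Cmod_csum|].
  apply Rle_trans with (rsum (fun k => 4 / U ^ 2 * w (m + k)%nat) M).
  - apply rsum_le. intros k _.
    assert (Hk : 2 * U <= INR (S (m + k))) by (rewrite <- INR_Sm; apply le_INR; lia).
    rewrite Cmod_mult, Cmod_R, Rabs_pos_eq by (left; apply Rinv_0_lt_compat; lra).
    unfold w. set (i := INR (S (m + k))) in *.
    apply (tail_term_bound U i U X (U * (i + U))); try lra; try nra.
    intros y Hy. assert (i * U <= i * y) by (apply Rmult_le_compat_l; lra).
    assert (2 * U * U <= i * U) by (apply Rmult_le_compat_r; lra).
    assert (6 * (i * y) <= 2 * PI * i * y).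
    { replace (2 * PI * i * y) with (2 * PI * (i * y)) by ring. apply Rmult_le_compat_r; nra. }
    rewrite Rabs_pos_eq; lra.
  - rewrite rsum_scal. pose proof (sum_w_tail m M).
    replace (12 / U ^ 2) with (4 / U ^ 2 * 3) by (field; lra).
    apply Rmult_le_compat_l; [left; apply Rdiv_lt_0_compat; lra|lra].
Qed.

Local Lemma ex_JR a b : 0 < a -> a <= b -> ex_CInt (ker (2 * PI) t) a b.
Proof. apply ex_CInt_ker. Qed.

(** The reflection step. After scaling, the ranges [k U, k X] are cut at (m + 1) U = 2 U^2, past the
    stationary point: above the cut the first derivative test is enough, below it the blocks of
    length U go through [abel_blocks]. *)
Local Lemma plus_head :
  U ^ 2 * Cmod (csum (fun k => RtoC (/ INR (S k)) * CInt (ker (2 * PI * INR (S k)) t) U X)%C m)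
  <= 1440 * harm (2 * n) * B + 2.
Proof.
  pose proof HU as H0. pose proof HU2 as H1. pose proof HX as H2. pose proof PI_bounds as H3.
  set (c := fun k => Cconj (xpow (crit t) (INR (S k)))).
  set (J := fun a b => JR (INR a * U) (INR b * U)).
  assert (E1 : csum (fun k => RtoC (/ INR (S k)) * CInt (ker (2 * PI * INR (S k)) t) U X)%C m
    = (csum (fun k => c k * J (S k) (S m))%C m + csum (fun k => c k * JR (INR (S m) * U) (INR (S k) * X))%C m)%C).
  { rewrite <- csum_plus. apply csum_ext. intros k Hk. pose proof (INR_S_ge_1 k) as Hi.
    rewrite ker_scaling by lra. fold (c k). rewrite RtoC_inv by lra.
    assert (Hkm : INR (S k) <= INR (S m)) by (apply le_INR; lia). pose proof INR_Sm as ES.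
    change (CInt (ker (2 * PI) t) (INR (S k) * U)%R (INR (S k) * X)%R) with (JR (INR (S k) * U) (INR (S k) * X)).
    replace (JR (INR (S k) * U) (INR (S k) * X)) with
      (J (S k) (S m) + JR (INR (S m) * U) (INR (S k) * X))%C.
    - field. intros E. apply RtoC_inj in E. lra.
    - unfold J, JR. apply CInt_Chasles; apply ex_JR; try nra. }
  rewrite E1, abel_blocks.
  2:{ intros a b d Hab Hbd. unfold J, JR. symmetry.
      assert (1 <= INR a) by (apply (le_INR 1); lia).
      assert (INR a <= INR b) by (apply le_INR; lia). assert (INR b <= INR d) by (apply le_INR; lia).
      apply CInt_Chasles; apply ex_JR; nra. }
  assert (PU2 : 0 < U ^ 2) by lra.
  assert (Bt : Cmod (csum (fun k => c k * JR (INR (S m) * U) (INR (S k) * X))%C m) <= 2 / U ^ 2).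
  { eapply Rle_trans; [apply Cmod_csum|].
    apply Rle_trans with (rsum (fun _ => / (U ^ 2 * U)) m).
    - apply rsum_le. intros k Hk. pose proof (INR_S_ge_1 k) as Hi.
      rewrite Cmod_mult. unfold c. rewrite Cmod_conj, Cmod_xpow. simpl fst.
      rewrite exp_half_ln by lra.
      assert (Hc1 : / sqrt (INR (S k)) <= 1).
      { rewrite <- Rinv_1. apply Rinv_le_contravar; [lra|]. rewrite <- sqrt_1. apply sqrt_le_1_alt. lra. }
      assert (0 < / sqrt (INR (S k))) by (apply Rinv_0_lt_compat, sqrt_lt_R0; lra).
      rewrite INR_Sm.
      assert (BJ : Cmod (JR (2 * U * U) (INR (S k) * X)) <= / (U ^ 2 * U)).
      { unfold JR. eapply Rle_trans; [apply (ker_first (2 * PI) t (2 * U * U) (INR (S k) * X) (8 * U ^ 2)); try nra|].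
        - intros y Hy. assert (2 * PI * (2 * U * U) <= 2 * PI * y) by (apply Rmult_le_compat_l; lra).
          rewrite Rabs_pos_eq; nra.
        - replace (/ (U ^ 2 * U)) with (8 / (8 * U ^ 2 * U)) by (field; lra).
          apply Rmult_le_compat_l; [lra|]. apply Rinv_le_contravar; [nra|].
          apply Rmult_le_compat_l; [lra|]. rewrite <- (sqrt_pow2 U) at 1 by lra.
          apply sqrt_le_1_alt. nra. }
      pose proof (Cmod_ge_0 (JR (2 * U * U) (INR (S k) * X))). nra.
    - rewrite rsum_const. apply Rle_trans with (2 * U * / (U ^ 2 * U)).
      + apply Rmult_le_compat_r; [left; apply Rinv_0_lt_compat; nra|].
        rewrite <- INR_Sm. apply le_INR. lia.
      + apply Req_le. field. lra. }
  (* The index of the block with the stationary point; [p] < n since t <= 4 U^2 < 2 pi U^2. *)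
  destruct (nfloor_ex (t / (2 * PI * U))) as [p Hp]; [apply Rdiv_le_0_compat; [lra|nra]|].
  assert (Hpn : (S p <= 2 * n)%nat).
  { assert (INR p < INR n); [|apply INR_lt in H; lia]. fold U.
    apply Rle_lt_trans with (t / (2 * PI * U)); [lra|]. apply Rlt_div_l; nra. }
  assert (Bh : U ^ 2 * Cmod (csum (fun j => J (S j) (S (S j)) * csum c (S j))%C m) <= 1440 * harm (2 * n) * B).
  { apply Rle_trans with (U ^ 2 * (B * rsum (fun j => Cmod (J (S j) (S (S j)))) m)).
    - apply Rmult_le_compat_l; [lra|]. eapply Rle_trans; [apply Cmod_csum|].
      rewrite <- rsum_scal. apply rsum_le. intros j Hj. rewrite Cmod_mult, Rmult_comm.
      apply Rmult_le_compat_r; [apply Cmod_ge_0|]. unfold c. rewrite csum_conj, Cmod_conj.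
      apply (HB (S j)). unfold m in Hj. lia.
    - pose proof HB0 as PB.
      assert (S1 : 5 * U ^ 2 * rsum (fun j => Cmod (J (S j) (S (S j)))) m <= 7200 * harm (2 * n)).
      { rewrite <- rsum_scal.
        apply Rle_trans with (rsum (fun j => 2400 * (/ INR (S j) + / (Rabs (INR (S j) - INR p) + 1))) m).
        - apply rsum_le. intros j Hj. unfold J, JR. rewrite (S_INR (S j)).
          apply block_bound; auto; try lra; [apply INR_S_ge_1|apply pos_INR|].
          destruct (Nat.le_gt_cases (S j) p) as [Hjp|Hjp].
          + rewrite Rabs_minus_sym, <- minus_INR, Rabs_pos_eq by (auto; apply pos_INR).
            destruct (Nat.le_gt_cases (p - S j) 1) as [Hd|Hd].
            * left. apply (le_INR _ 1) in Hd. simpl (INR 1) in Hd. exact Hd.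
            * right. apply (le_INR 2). lia.
          + rewrite <- minus_INR, Rabs_pos_eq by (try lia; apply pos_INR).
            destruct (Nat.le_gt_cases (S j - p) 1) as [Hd|Hd].
            * left. apply (le_INR _ 1) in Hd. simpl (INR 1) in Hd. exact Hd.
            * right. apply (le_INR 2). lia.
        - rewrite rsum_scal, rsum_plus. fold (harm m).
          pose proof (harm_mono m (2 * n) ltac:(unfold m; lia)) as Hm1.
          pose proof (harm_mono (S p) (2 * n) Hpn) as Hm2.
          pose proof (harm_dist p (1 + m)) as Hd. rewrite rsum_split in Hd. simpl (1 + m)%nat in Hd.
          replace (S m) with (2 * n)%nat in Hd by (unfold m; lia).
          assert (0 <= rsum (fun j => / (Rabs (INR j - INR p) + 1)) 1).
          { apply rsum_nonneg. intros k _. left. apply Rinv_0_lt_compat. pose proof (Rabs_pos (INR k - INR p)). lra. }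
          change (fun k => / (Rabs (INR (1 + k) - INR p) + 1)) with (fun k => / (Rabs (INR (S k) - INR p) + 1)) in Hd.
          lra. }
      set (S0 := rsum (fun j => Cmod (J (S j) (S (S j)))) m) in *. nra. }
  eapply Rle_trans; [apply Rmult_le_compat_l; [lra|apply Cmod_triangle]|].
  assert (U ^ 2 * (2 / U ^ 2) = 2) by (field; lra).
  assert (U ^ 2 * Cmod (csum (fun k => c k * JR (INR (S m) * U) (INR (S k) * X))%C m) <= 2).
  { rewrite <- H. apply Rmult_le_compat_l; lra. }
  lra.
Qed.

Local Lemma Cmod_crit : t <= Cmod (crit t) <= 5 * U ^ 2 /\ t <= Cmod (crit t - RtoC 1).
Proof.
  pose proof HU2 as H. repeat split.
  - eapply Rle_trans; [|apply abs_snd_le_Cmod]. simpl. apply Rle_abs.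
  - eapply Rle_trans; [apply Cmod_le_abs|]. simpl. rewrite !Rabs_pos_eq; lra.
  - eapply Rle_trans; [|apply abs_snd_le_Cmod]. simpl. rewrite Ropp_0, Rplus_0_r. apply Rle_abs.
Qed.

(** Zeta is compared with [zeta_em] at X and carried back to U by the Fourier expansion. At U,
    [zeta_em] is a partial sum up to a bounded error, and the frequencies split into head, tail and
    conjugate part. *)
Lemma zeta_half_line_bound zeta : is_riemann_zeta zeta ->
  Cmod (zeta (crit t)) <= 1500 * (1 + harm (2 * n)) * (1 + B).
Proof.
  intros Hz. pose proof HU as H0. pose proof HU2 as H1. pose proof HX as H2. pose proof PI_bounds as H3.
  pose proof HB0 as PB. destruct Cmod_crit as [[Hs1 Hs2] Hs3].
  set (s := crit t) in *.
  assert (Hs : s <> RtoC 1).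
  { intros E. apply (f_equal snd) in E. unfold s in E. simpl in E. lra. }
  set (x := (4 * n ^ 4)%nat). assert (Ex : INR x = X).
  { unfold x, X, U. rewrite mult_INR, pow_INR. simpl. ring. }
  assert (Hx1 : (n <= x)%nat) by (apply INR_le; rewrite Ex; fold U; lra).
  assert (PX : 0 < INR x) by lra.
  assert (A1 : Cmod (zeta s - zeta_em x s) <= 5 / 2).
  { eapply Rle_trans; [apply zeta_approx; auto; [unfold s; simpl; lra|unfold s; simpl; lra|lia]|].
    unfold s at 2. simpl fst. rewrite exp_half_ln by auto. rewrite Ex.
    replace X with ((2 * U ^ 2) ^ 2) by (unfold X; ring). rewrite sqrt_pow2 by lra.
    apply Rle_div_l; lra. }
  (* There are x - n unit steps, so an error 1/x for each adds up to at most 1. *)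
  destruct (saw_err_small s ltac:(unfold s; simpl; lra) (/ INR x) (Rinv_0_lt_compat _ PX)) as [M0 HM0].
  set (M := (m + M0)%nat).
  assert (A2 : Cmod (zeta_em x s - zeta_em n s + csum (fun k => saw_term s k U X) M) <= 1).
  { pose proof (zeta_em_fourier s n M (/ INR x) (x - n) Hn Hs) as H.
    replace (n + (x - n))%nat with x in H by lia. rewrite Ex in H. fold U in H.
    eapply Rle_trans; [apply H|].
    - intros k Hk. rewrite <- Ex. apply HM0; auto. unfold M. lia.
    - rewrite <- Ex. apply Rle_trans with (INR x * / INR x).
      + apply Rmult_le_compat_r; [left; apply Rinv_0_lt_compat, PX|apply le_INR; lia].
      + rewrite Rinv_r; lra. }
  assert (A3 : Cmod (zeta_em n s) <= B + 2).
  { unfold zeta_em. fold U.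
    assert (Exp : Cmod (xpow s U) = / sqrt U).
    { rewrite Cmod_xpow. unfold s. simpl fst. apply exp_half_ln. lra. }
    assert (HsU : 1 <= sqrt U) by (rewrite <- sqrt_1; apply sqrt_le_1_alt; lra).
    assert (Hi : 0 < / sqrt U <= 1).
    { split; [apply Rinv_0_lt_compat; lra|]. rewrite <- Rinv_1. apply Rinv_le_contravar; lra. }
    assert (N1 : (s - RtoC 1)%C <> RtoC 0) by (apply Cmod_gt_0; lra).
    assert (N2 : RtoC 2 <> RtoC 0) by (intros E; apply (f_equal fst) in E; simpl in E; lra).
    eapply Rle_trans; [apply Cmod_minus_le|]. eapply Rle_trans; [apply Rplus_le_compat_r, Cmod_triangle|].
    rewrite !Cmod_div, Cmod_mult, !Cmod_R, !Rabs_pos_eq, Exp by (auto; lra).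
    assert (U * / sqrt U / Cmod (s - RtoC 1) <= 1).
    { apply Rle_div_l; [lra|]. nra. }
    pose proof (HB n ltac:(lia)) as HBn. unfold zsum in HBn. fold s in HBn. lra. }
  assert (A4 : Cmod (csum (fun k => saw_term s k U X) M) <= 1440 * harm (2 * n) * B + 26).
  { set (P := fun k => (RtoC (/ INR (S k)) * CInt (ker (2 * PI * INR (S k)) t) U X)%C).
    set (Q := fun k => (RtoC (/ INR (S k)) * Cconj (CInt (ker (2 * PI * INR (S k)) (- t)) U X))%C).
    assert (E : csum (fun k => saw_term s k U X) M
      = (s * (Ci * RtoC (/ (2 * PI))) * (csum P m + csum (fun k => P (m + k)%nat) M0 - csum Q M))%C).
    { rewrite <- csum_split. fold M. unfold Cminus. rewrite <- csum_opp, <- csum_plus, <- csum_scal.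
      apply csum_ext. intros k _. unfold s. rewrite saw_term_ker by lra. unfold P, Q. ring. }
    rewrite E, !Cmod_mult, Cmod_Ci, Cmod_R, Rmult_1_l, Rabs_pos_eq by (left; apply Rinv_0_lt_compat; lra).
    pose proof plus_head as B1. pose proof (plus_tail M0) as B2. pose proof (minus_part M) as B3.
    fold P in B1. fold Q in B3. change (Cmod (csum (fun k => P (m + k)%nat) M0) <= 12 / U ^ 2) in B2.
    assert (B4 : Cmod (csum P m + csum (fun k => P (m + k)%nat) M0 - csum Q M)
       <= Cmod (csum P m) + 24 / U ^ 2).
    { eapply Rle_trans; [apply Cmod_minus_le|]. eapply Rle_trans; [apply Rplus_le_compat_r, Cmod_triangle|].
      unfold Rdiv in *. lra. }
    (* |s| / (2 pi) <= 5 U^2 / (2 pi) <= U^2. *)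
    apply Rle_trans with (U ^ 2 * (Cmod (csum P m) + 24 / U ^ 2)).
    - apply Rmult_le_compat; try (apply Cmod_ge_0); auto.
      + apply Rmult_le_pos; [apply Cmod_ge_0|left; apply Rinv_0_lt_compat; lra].
      + apply Rle_div_l; nra.
    - rewrite Rmult_plus_distr_l. replace (U ^ 2 * (24 / U ^ 2)) with 24 by (field; lra). lra. }
  replace (zeta s) with ((zeta s - zeta_em x s)
     + ((zeta_em x s - zeta_em n s + csum (fun k => saw_term s k U X) M)
        + (zeta_em n s - csum (fun k => saw_term s k U X) M)))%C by ring.
  eapply Rle_trans; [apply Cmod_triangle|].
  eapply Rle_trans; [apply Rplus_le_compat_l, Cmod_triangle|].
  eapply Rle_trans; [apply Rplus_le_compat_l, Rplus_le_compat_l, Cmod_minus_le|].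
  assert (0 <= harm (2 * n)) by (apply (harm_mono 0); lia).
  assert (0 <= harm (2 * n) * B) by (apply Rmult_le_pos; auto).
  nra.
Qed.
End Afe.

(** * The divisor bound *)

Module Divisors.
Import all_boot.
Local Delimit Scope R_scope with real.
Local Open Scope nat_scope.

(** A divisor is determined by its exponent at p and its part prime to p. *)
Lemma size_divisors_split (p m : nat) : prime p -> 0 < m ->
  size (divisors m) <= (logn p m).+1 * size (divisors m`_p^').
Proof.
  move=> pp m0. rewrite -(size_iota 0 (logn p m).+1) -(size_allpairs (fun i f => p ^ i * f)%N).
  apply: uniq_leq_size; first exact: divisors_uniq.
  move=> e; rewrite -dvdn_divisors // => em.
  have e0 : 0 < e by apply: dvdn_gt0 em.
  apply/allpairsP; exists (logn p e, e`_p^'); split.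
  - by rewrite mem_iota add0n ltnS leq0n; apply: dvdn_leq_log.
  - rewrite -dvdn_divisors ?part_gt0 //. exact: partn_dvd.
  - by rewrite -p_part partnC.
Qed.

(** Here f stands for m^eps, and a + 1 counts the divisors of p^a. A prime p >= B costs nothing
    beyond f (p^a); a smaller one loses a factor C, and there are at most B of those. *)
Lemma size_divisors_bound (f : nat -> R) (C : R) (B : nat) :
  (forall x y, 0 < x -> 0 < y -> f (x * y) = (f x * f y)%real) -> f 1 = 1%real ->
  (forall x, 0 < x -> (0 < f x)%real) -> (1 <= C)%real ->
  (forall p a, 1 < p -> (INR a.+1 <= C * f (p ^ a)%N)%real) ->
  (forall p a, B <= p -> (INR a.+1 <= f (p ^ a)%N)%real) ->
  forall m, 0 < m -> (INR (size (divisors m)) <= C ^ B * f m)%real.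
Proof.
  move=> fM f1 fpos C1 small large.
  have Cpos k : (1 <= C ^ k)%real by apply: pow_R1_Rle.
  (* The induction strips the least prime factor. The lower bound [b] for the remaining primes
     records how many factors C are still available. *)
  suff H m b : 0 < m -> (forall q, prime q -> q %| m -> b <= q) ->
    (INR (size (divisors m)) <= C ^ (B - b)%N * f m)%real.
    move=> m m0. have := H m 0 m0. rewrite subn0. by apply.
  elim/ltn_ind: m b => m IH b m0 Hb.
  have [m1|m1] := leqP m 1.
    have -> : m = 1 by apply/eqP; rewrite eqn_leq m1.
    rewrite f1 /=. have := Cpos (B - b). lra.
  set p := pdiv m. have pp : prime p by apply: pdiv_prime.
  have pm : p %| m by apply: pdiv_dvd.
  set m' := m`_p^'. have m'0 : 0 < m' by apply: part_gt0.
  have Em : m = (p ^ logn p m * m')%N by rewrite -p_part partnC.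
  have a0 : 0 < logn p m by rewrite logn_gt0 mem_primes pp m0.
  have m'm : m' < m.
    rewrite Em -{1}(mul1n m') ltn_pmul2r //. by rewrite -{1}(expn0 p) ltn_exp2l // prime_gt1.
  have m'p q : prime q -> q %| m' -> p < q.
    move=> pq qm'. have qm : q %| m by apply: dvdn_trans qm' _; apply: dvdn_part.
    rewrite ltn_neqAle pdiv_min_dvd ?prime_gt1 // andbT. apply/eqP => Epq.
    have := part_pnat p^' m. rewrite -/m' => /pnatP -/(_ m'0 q pq qm').
    by rewrite inE /= Epq inE eqxx.
  have S0 := size_divisors_split p m pp m0. rewrite -/m' in S0.
  have S1 : (INR (size (divisors m)) <= INR (logn p m).+1 * INR (size (divisors m')))%real.
    rewrite -mult_INR. apply: le_INR. by apply/leP.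
  have fm : f m = (f (p ^ logn p m)%N * f m')%real by rewrite {1}Em fM // expn_gt0 prime_gt0.
  have P1 : (0 < f (p ^ logn p m)%N)%real by apply: fpos; rewrite expn_gt0 prime_gt0.
  have P2 : (0 < f m')%real by apply: fpos.
  have P3 := pos_INR (size (divisors m')). have P4 := pos_INR (logn p m).+1.
  have [Bp|pB] := leqP B p.
  - have L := large p (logn p m) Bp.
    have I : (INR (size (divisors m')) <= C ^ (B - b)%N * f m')%real.
      apply: IH => // q pq qm'. apply: leq_trans (Hb p pp pm) _. exact: ltnW (m'p q pq qm').
    apply: Rle_trans S1 _. rewrite fm.
    replace (C ^ (B - b)%N * (f (p ^ logn p m)%N * f m'))%real
      with (f (p ^ logn p m)%N * (C ^ (B - b)%N * f m'))%real by ring.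
    by apply: Rmult_le_compat.
  - have L := small p (logn p m) (prime_gt1 pp).
    have I : (INR (size (divisors m')) <= C ^ (B - p.+1)%N * f m')%real by apply: IH.
    apply: Rle_trans S1 _. apply: Rle_trans (Rmult_le_compat _ _ _ _ P4 P3 L I) _.
    rewrite fm.
    replace (C * f (p ^ logn p m)%N * (C ^ (B - p.+1)%N * f m'))%real
      with ((C * C ^ (B - p.+1)%N) * (f (p ^ logn p m)%N * f m'))%real by ring.
    apply: Rmult_le_compat_r; first by apply: Rlt_le; apply: Rmult_lt_0_compat.
    have -> : (C * C ^ (B - p.+1)%N = C ^ (B - p)%N)%real by rewrite -[(B - p)%N]prednK ?subn_gt0 // -subnS.
    apply: Rle_pow => //. apply/leP. apply: leq_sub2l. exact: Hb.
Qed.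

Lemma length_le_size_divisors (m : nat) (l : list nat) : 0 < m -> NoDup l ->
  (forall a, In a l -> Nat.divide a m) -> (length l <= size (divisors m))%coq_nat.
Proof.
  move=> m0 Ul Hl.
  have mem x s : reflect (In x s) (x \in s).
    elim: s => [|y s IHs] /=; first by apply: (iffP idP).
    rewrite inE. apply: (iffP orP) => [[/eqP->|/IHs]|[->|/IHs]]; auto.
  have Us : uniq l.
    elim: l Ul {Hl} => //= y s IHs /NoDup_cons_iff [H1 H2]. rewrite IHs // andbT. by apply/mem.
  apply/leP. apply: (uniq_leq_size Us) => a /mem /Hl [k Hk].
  by rewrite -dvdn_divisors //; apply/dvdnP; exists k.
Qed.
(** The same bound with the operations and orders of the standard library, so that the rest of the
    proof stays outside this module. *)
Lemma divisor_count_bound (f : nat -> R) (C : R) (B : nat) :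
  (forall x y, (0 < x)%coq_nat -> (0 < y)%coq_nat -> f (Nat.mul x y) = (f x * f y)%real) ->
  f 1 = 1%real -> (forall x, (0 < x)%coq_nat -> (0 < f x)%real) -> (1 <= C)%real ->
  (forall p a, (1 < p)%coq_nat -> (INR a.+1 <= C * f (Nat.pow p a))%real) ->
  (forall p a, (B <= p)%coq_nat -> (INR a.+1 <= f (Nat.pow p a))%real) ->
  forall m l, (0 < m)%coq_nat -> NoDup l -> (forall a, In a l -> Nat.divide a m) ->
    (INR (length l) <= C ^ B * f m)%real.
Proof.
  move=> fM f1 fpos C1 small large m l /ltP m0 Ul Hl.
  have powE p a : Nat.pow p a = (p ^ a)%N by elim: a => //= a ->; rewrite expnS.
  apply: (Rle_trans _ (INR (size (divisors m)))).
    by apply: le_INR; apply: length_le_size_divisors.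
  apply: size_divisors_bound => //.
  - move=> x y /ltP x0 /ltP y0. exact: fM.
  - move=> x /ltP. exact: fpos.
  - move=> p a /ltP p1. rewrite -powE. exact: small.
  - move=> p a /leP Bp. rewrite -powE. exact: large.
Qed.
End Divisors.

Lemma divisor_bound eps : 0 < eps -> exists K, 0 < K /\
  forall m (l : list nat), (1 <= m)%nat -> NoDup l -> (forall a, In a l -> Nat.divide a m) ->
    INR (length l) <= K * Rpower (INR m) eps.
Proof.
  intros He.
  assert (Hln : 0 < ln 2) by (rewrite <- ln_1; apply ln_increasing; lra).
  (* For every p >= 2, a + 1 <= C (1 + eps a ln 2) <= C 2^(eps a) <= C p^(eps a). *)
  set (C := 1 + / (eps * ln 2)).
  assert (HC : 1 <= C). { unfold C. assert (0 < / (eps * ln 2)) by (apply Rinv_0_lt_compat; nra). lra. }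
  (* For p >= B one has p^eps >= 2, and a + 1 <= 2^a needs no constant. *)
  destruct (INR_unbounded (Rpower 2 (/ eps))) as [B HB].
  exists (C ^ B). split; [apply pow_lt; lra|].
  assert (Ep : forall p a, (1 <= p)%nat -> Rpower (INR (Nat.pow p a)) eps = exp (eps * ln (INR p) * INR a)).
  { intros p a Hp. unfold Rpower. f_equal. rewrite pow_INR, ln_pow by (apply lt_0_INR; auto). ring. }
  apply (Divisors.divisor_count_bound (fun x => Rpower (INR x) eps) C B); auto.
  - intros x y Hx Hy. rewrite mult_INR. symmetry. apply Rpower_mult_distr; apply lt_0_INR; auto.
  - unfold Rpower. simpl. rewrite ln_1, Rmult_0_r. apply exp_0.
  - intros x _. apply exp_pos.
  - intros p a Hp. rewrite Ep by lia. apply (le_INR 2) in Hp. simpl in Hp.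
    assert (ln 2 <= ln (INR p)) by (apply ln_le; lra).
    pose proof (pos_INR a) as Ha. rewrite S_INR.
    assert (E1 : 1 + eps * ln 2 * INR a <= exp (eps * ln (INR p) * INR a)).
    { eapply Rle_trans; [|apply exp_ineq1_le]. apply Rplus_le_compat_l, Rmult_le_compat_r; nra. }
    apply Rle_trans with (C * (1 + eps * ln 2 * INR a)); [|apply Rmult_le_compat_l; lra].
    unfold C. replace ((1 + / (eps * ln 2)) * (1 + eps * ln 2 * INR a))
      with (1 + INR a + (/ (eps * ln 2) + eps * ln 2 * INR a)) by (field; lra).
    assert (0 < / (eps * ln 2)) by (apply Rinv_0_lt_compat; nra).
    assert (0 <= eps * ln 2 * INR a) by (repeat apply Rmult_le_pos; lra). lra.
  - intros p a Hp. apply le_INR in Hp.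
    assert (HB1 : 1 <= Rpower 2 (/ eps)).
    { unfold Rpower. rewrite <- exp_0. destruct (Rle_lt_or_eq_dec 0 (/ eps * ln 2)) as [H|H].
      - apply Rmult_le_pos; [left; apply Rinv_0_lt_compat|]; lra.
      - left. now apply exp_increasing. - rewrite <- H. lra. }
    assert (Hp1 : (1 <= p)%nat) by (apply (INR_le 1); simpl; lra).
    rewrite Ep by auto.
    assert (H2 : ln 2 <= eps * ln (INR p)).
    { assert (H3 : / eps * ln 2 <= ln (INR p)).
      { rewrite <- (ln_exp (/ eps * ln 2)). fold (Rpower 2 (/ eps)). apply ln_le; [apply exp_pos|lra]. }
      apply Rmult_le_compat_l with (r := eps) in H3; [|lra].
      replace (eps * (/ eps * ln 2)) with (ln 2) in H3 by (field; lra). lra. }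
    apply Rle_trans with (exp (ln 2 * INR a)).
    + replace (exp (ln 2 * INR a)) with (2 ^ a).
      * clear. rewrite S_INR. induction a; [simpl; lra|]. rewrite S_INR. simpl.
        pose proof (pow_R1_Rle 2 a ltac:(lra)). lra.
      * rewrite Rmult_comm, <- ln_pow by lra. symmetry. apply exp_ln, pow_lt. lra.
    + assert (Hm : ln 2 * INR a <= eps * ln (INR p) * INR a) by (apply Rmult_le_compat_r; [apply pos_INR|lra]).
      destruct Hm as [Hm|Hm]; [left; now apply exp_increasing|rewrite Hm; lra].
Qed.

(** * Mean values of Dirichlet polynomials *)

Fixpoint clsum (f : nat -> C) (L : list nat) : C :=
  match L with nil => RtoC 0 | a :: L => (f a + clsum f L)%C end.

Fixpoint rlsum (f : nat -> R) (L : list nat) : R :=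
  match L with nil => 0 | a :: L => f a + rlsum f L end.

(* With multiplicity: one entry per k-tuple of elements of [A]. *)
Fixpoint products (A : list nat) (k : nat) : list nat :=
  match k with O => 1%nat :: nil | S k => flat_map (fun a => map (Nat.mul a) (products A k)) A end.

Lemma clsum_app f L1 L2 : clsum f (L1 ++ L2) = (clsum f L1 + clsum f L2)%C.
Proof. induction L1; simpl; [ring|]. rewrite IHL1. ring. Qed.

Lemma rlsum_app f L1 L2 : rlsum f (L1 ++ L2) = rlsum f L1 + rlsum f L2.
Proof. induction L1; simpl; [ring|]. rewrite IHL1. ring. Qed.

Lemma products_pos A k : (forall a, In a A -> (1 <= a)%nat) ->
  forall m, In m (products A k) -> (1 <= m)%nat.
Proof.
  intros HA. induction k; simpl; intros m Hm; [lia|].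
  apply in_flat_map in Hm. destruct Hm as [a [Ha Hm]]. apply in_map_iff in Hm.
  destruct Hm as [b [<- Hb]]. specialize (HA a Ha). specialize (IHk b Hb). nia.
Qed.

Lemma products_le A k N : (forall a, In a A -> (a <= N)%nat) ->
  forall m, In m (products A k) -> (m <= N ^ k)%nat.
Proof.
  intros HA. induction k; simpl; intros m Hm; [lia|].
  apply in_flat_map in Hm. destruct Hm as [a [Ha Hm]]. apply in_map_iff in Hm.
  destruct Hm as [b [<- Hb]]. specialize (HA a Ha). specialize (IHk b Hb). nia.
Qed.

Lemma clsum_products f A k : f 1%nat = RtoC 1 ->
  (forall a b, (1 <= a)%nat -> (1 <= b)%nat -> f (a * b)%nat = (f a * f b)%C) ->
  (forall a, In a A -> (1 <= a)%nat) ->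
  Cmod (clsum f (products A k)) = Cmod (clsum f A) ^ k.
Proof.
  intros f1 fM HA. induction k; simpl.
  - rewrite f1. replace (RtoC 1 + RtoC 0)%C with (RtoC 1) by ring. apply Cmod_1.
  - rewrite <- IHk, <- Cmod_mult. f_equal.
    pose proof (products_pos A k HA) as HP. set (P := products A k) in *. clearbody P. clear IHk.
    induction A as [|a A IH]; simpl; [ring|].
    rewrite clsum_app, IH by (intros; apply HA; simpl; auto).
    assert (Em : clsum f (map (Nat.mul a) P) = (f a * clsum f P)%C).
    { assert (Ha : (1 <= a)%nat) by (apply HA; simpl; auto). clear - fM HP Ha.
      induction P as [|b P IH]; simpl; [ring|]. rewrite IH by (intros; apply HP; simpl; auto).
      rewrite fM; auto; [ring|apply HP; simpl; auto]. }
    rewrite Em. ring.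
Qed.

Lemma rlsum_products f A k : f 1%nat = 1 ->
  (forall a b, (1 <= a)%nat -> (1 <= b)%nat -> f (a * b)%nat = f a * f b) ->
  (forall a, In a A -> (1 <= a)%nat) ->
  rlsum f (products A k) = rlsum f A ^ k.
Proof.
  intros f1 fM HA. induction k; simpl.
  - rewrite f1. ring.
  - rewrite <- IHk.
    pose proof (products_pos A k HA) as HP. set (P := products A k) in *. clearbody P. clear IHk.
    induction A as [|a A IH]; simpl; [ring|].
    rewrite rlsum_app, IH by (intros; apply HA; simpl; auto).
    assert (Em : rlsum f (map (Nat.mul a) P) = f a * rlsum f P).
    { assert (Ha : (1 <= a)%nat) by (apply HA; simpl; auto). clear - fM HP Ha.
      induction P as [|b P IH]; simpl; [ring|]. rewrite IH by (intros; apply HP; simpl; auto).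
      rewrite fM; auto; [ring|apply HP; simpl; auto]. }
    rewrite Em. ring.
Qed.

Definition occ (L : list nat) (m : nat) : nat := count_occ Nat.eq_dec L m.

Lemma occ_map_mul a P m : (1 <= a)%nat ->
  occ (map (Nat.mul a) P) m = if Nat.eq_dec (m mod a) 0 then occ P (m / a) else 0%nat.
Proof.
  intros Ha. unfold occ. pose proof (Nat.div_mod_eq m a) as E.
  induction P as [|b P IH]; simpl; [destruct (Nat.eq_dec _ _); auto|].
  rewrite IH. destruct (Nat.eq_dec (a * b) m) as [Em|Em].
  - subst m. rewrite (Nat.mul_comm a b), Nat.Div0.mod_mul, Nat.div_mul by lia.
    destruct (Nat.eq_dec 0 0); [|lia]. destruct (Nat.eq_dec b b); [auto|lia].
  - destruct (Nat.eq_dec (m mod a) 0) as [E0|E0]; auto.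
    destruct (Nat.eq_dec b (m / a)) as [Eb|Eb]; auto. subst b. lia.
Qed.

(** Induction on the first factor: it is one of at most E divisors of m in A, and the other factors
    represent m / a, which again lies in [1, M]. *)
Lemma occ_products A k M E : NoDup A -> (forall a, In a A -> (1 <= a)%nat) -> 1 <= E ->
  (forall m l, (1 <= m <= M)%nat -> NoDup l -> (forall a, In a l -> Nat.divide a m) -> INR (length l) <= E) ->
  forall m, (1 <= m <= M)%nat -> INR (occ (products A k) m) <= E ^ k.
Proof.
  intros HA Hpos HE Hdiv. induction k; intros m Hm.
  - unfold occ. cbn [products count_occ pow]. destruct (Nat.eq_dec 1 m); simpl; lra.
  - assert (HEk : 0 <= E ^ k) by (apply pow_le; lra).
    set (g := fun a => Nat.eqb (m mod a) 0).
    (* The outer list is generalized while [products A k] stays fixed, since [flat_map] recurses on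
       the former only. *)
    assert (Key : forall A', (forall a, In a A' -> (1 <= a)%nat) ->
       INR (occ (flat_map (fun a => map (Nat.mul a) (products A k)) A') m)
       <= INR (length (filter g A')) * E ^ k).
    { induction A' as [|a A' IH]; intros Hp'; simpl; [unfold occ; simpl; rewrite Rmult_0_l; lra|].
      unfold occ. rewrite count_occ_app. fold (occ (map (Nat.mul a) (products A k)) m).
      fold (occ (flat_map (fun a => map (Nat.mul a) (products A k)) A') m).
      rewrite plus_INR. specialize (IH (fun b Hb => Hp' b (or_intror Hb))).
      assert (Ha : (1 <= a)%nat) by (apply Hp'; simpl; auto).
      rewrite occ_map_mul by auto. unfold g at 1. destruct (Nat.eq_dec (m mod a) 0) as [E0|E0].
      - rewrite E0. cbn [Nat.eqb length]. rewrite S_INR.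
        assert (Hq : (1 <= m / a <= M)%nat).
        { pose proof (Nat.div_mod_eq m a) as H. rewrite E0 in H. split.
          - destruct (Nat.eq_dec (m / a) 0) as [Z|Z]; [rewrite Z in H; lia|lia].
          - apply Nat.le_trans with m; [apply Nat.Div0.div_le_upper_bound; nia|lia]. }
        specialize (IHk _ Hq). rewrite Rmult_plus_distr_r, Rmult_1_l, Rplus_comm.
        apply Rplus_le_compat; assumption.
      - destruct (Nat.eqb_spec (m mod a) 0); [lia|]. rewrite Rplus_0_l. exact IH. }
    simpl products. eapply Rle_trans; [apply Key, Hpos|].
    simpl. apply Rmult_le_compat_r; auto. apply (Hdiv m); auto.
    + apply NoDup_filter, HA.
    + intros a Ha. apply filter_In in Ha. destruct Ha as [_ Ha]. unfold g in Ha.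
      apply Nat.eqb_eq in Ha. apply Nat.Lcm0.mod_divide in Ha. exact Ha.
Qed.

Lemma rlsum_ext f g L : (forall m, In m L -> f m = g m) -> rlsum f L = rlsum g L.
Proof. induction L; simpl; intros H; auto. rewrite IHL, H; auto. Qed.

Lemma rlsum_le f g L : (forall m, In m L -> f m <= g m) -> rlsum f L <= rlsum g L.
Proof. induction L; simpl; intros H; [lra|]. apply Rplus_le_compat; auto. Qed.

Lemma rlsum_scal c f L : rlsum (fun m => c * f m) L = c * rlsum f L.
Proof. induction L; simpl; [ring|]. rewrite IHL. ring. Qed.

Lemma rlsum_plus f g L : rlsum (fun m => f m + g m) L = rlsum f L + rlsum g L.
Proof. induction L; simpl; [ring|]. rewrite IHL. ring. Qed.

Lemma rlsum_swap (f : nat -> nat -> R) L1 L2 :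
  rlsum (fun m => rlsum (f m) L2) L1 = rlsum (fun n => rlsum (fun m => f m n) L1) L2.
Proof.
  induction L1; simpl.
  - induction L2; simpl; auto. rewrite <- IHL2. ring.
  - rewrite IHL1, <- rlsum_plus. reflexivity.
Qed.

Lemma rlsum_mult f g L1 L2 :
  rlsum f L1 * rlsum g L2 = rlsum (fun m => rlsum (fun n => f m * g n) L2) L1.
Proof.
  induction L1; simpl; [ring|]. rewrite rlsum_scal, <- IHL1. ring.
Qed.

Lemma is_RInt_rlsum (f : nat -> R -> R) (I : nat -> R) L a b :
  (forall m, In m L -> is_RInt (f m) a b (I m)) ->
  is_RInt (fun t => rlsum (fun m => f m t) L) a b (rlsum I L).
Proof.
  induction L; simpl; intros H.
  - evar_last; [apply (is_RInt_const (V := R_NormedModule))|]. apply Rmult_0_r.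
  - apply (is_RInt_plus (V := R_NormedModule)); auto.
Qed.

Lemma rlsum_occ (g : nat -> R) L M : (forall m, In m L -> (1 <= m <= M)%nat) ->
  rlsum g L = rsum (fun k => INR (occ L (S k)) * g (S k)) M.
Proof.
  intros H. induction L as [|a L IH].
  - simpl. symmetry. transitivity (rsum (fun _ => 0) M); [|rewrite rsum_const; ring].
    apply rsum_ext. intros k _. unfold occ. cbn [count_occ]. simpl (INR 0). ring.
  - simpl. rewrite IH by (intros; apply H; simpl; auto).
    assert (E : g a = rsum (fun k => if Nat.eq_dec a (S k) then g a else 0) M).
    { specialize (H a (or_introl eq_refl)). clear - H. induction M; [lia|].
      cbn [rsum]. destruct (Nat.eq_dec a (S M)) as [Ea|Ea].
      - rewrite (rsum_ext _ (fun _ => 0)); [rewrite rsum_const; ring|].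
        intros k Hk. destruct (Nat.eq_dec a (S k)); [lia|auto].
      - rewrite <- IHM by lia. ring. }
    rewrite E at 1. rewrite <- rsum_plus. apply rsum_ext. intros k _. unfold occ. cbn [count_occ].
    destruct (Nat.eq_dec a (S k)) as [Ea|Ea]; [rewrite S_INR, Ea; ring|ring].
Qed.

Lemma rlsum_le_occ (g : nat -> R) L M Dm : (forall m, In m L -> (1 <= m <= M)%nat) ->
  (forall m, (1 <= m <= M)%nat -> INR (occ L m) <= Dm) -> (forall m, 0 <= g m) ->
  rlsum g L <= Dm * rsum (fun k => g (S k)) M.
Proof.
  intros H HD Hg. rewrite (rlsum_occ g L M H), <- rsum_scal. apply rsum_le. intros k Hk.
  apply Rmult_le_compat_r; auto. apply HD. lia.
Qed.

Lemma ln_diff_lower (m n M : R) : 0 < n -> n < m -> m <= M -> (m - n) / M <= ln m - ln n.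
Proof.
  intros Hn Hnm HM.
  pose proof (exp_ineq1_le (ln n - ln m)) as H.
  replace (ln n - ln m) with (ln (n / m)) in H by (rewrite ln_div; lra).
  rewrite exp_ln in H by (apply Rdiv_lt_0_compat; lra).
  rewrite ln_div in H by lra.
  apply Rle_trans with ((m - n) / m).
  - apply Rmult_le_compat_l; [lra|]. apply Rinv_le_contravar; lra.
  - replace ((m - n) / m) with (1 - n / m) by (field; lra). lra.
Qed.

(** A bound for the integral of cos (t ln (m / n)) over an interval of length T: off the diagonal 2
    / |ln (m / n)| <= 2 M / |m - n|, written with |m - n| + 1 to match [harm_dist]. *)
Definition gap (M : nat) (T : R) (m n : nat) : R :=
  if Nat.eq_dec m n then T else 4 * INR M / (Rabs (INR n - INR m) + 1).

Lemma gap_sum M T m : (1 <= m <= M)%nat -> 0 <= T ->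
  rsum (fun k => gap M T m (S k)) M <= T + 8 * INR M * harm M.
Proof.
  intros Hm HT. pose proof (pos_INR M) as HM.
  apply Rle_trans with (rsum (fun k => (if Nat.eq_dec m (S k) then T else 0)
    + 4 * INR M * / (Rabs (INR k - INR (m - 1)) + 1)) M).
  - apply rsum_le. intros k _. unfold gap.
    assert (Ed : INR (S k) - INR m = INR k - INR (m - 1)).
    { rewrite minus_INR, S_INR by lia. simpl. ring. }
    rewrite Ed. pose proof (Rabs_pos (INR k - INR (m - 1))) as Hp.
    assert (0 <= 4 * INR M * / (Rabs (INR k - INR (m - 1)) + 1)).
    { apply Rmult_le_pos; [lra|]. left. apply Rinv_0_lt_compat. lra. }
    destruct (Nat.eq_dec m (S k)); [lra|]. unfold Rdiv. lra.
  - rewrite rsum_plus, rsum_scal.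
    assert (E : rsum (fun k => if Nat.eq_dec m (S k) then T else 0) M <= T).
    { clear - Hm HT. assert (G : forall K, rsum (fun k => if Nat.eq_dec m (S k) then T else 0) K
         <= if Compare_dec.le_dec m K then T else 0).
      { induction K; cbn [rsum]; [destruct (Compare_dec.le_dec m 0); lra|].
        destruct (Nat.eq_dec m (S K)), (Compare_dec.le_dec m K), (Compare_dec.le_dec m (S K)); try lia; lra. }
      eapply Rle_trans; [apply G|]. destruct (Compare_dec.le_dec m M); lra. }
    pose proof (harm_dist (m - 1) M) as H1. replace (S (m - 1)) with m in H1 by lia.
    pose proof (harm_mono m M ltac:(lia)) as H2.
    assert (4 * INR M * rsum (fun k => / (Rabs (INR k - INR (m - 1)) + 1)) M <= 4 * INR M * (2 * harm M)).
    { apply Rmult_le_compat_l; lra. }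
    lra.
Qed.

Lemma cos_integral_gap M T1 T2 m n : (1 <= m <= M)%nat -> (1 <= n <= M)%nat -> T1 <= T2 ->
  exists I, is_RInt (fun t => cos (t * (ln (INR m) - ln (INR n)))) T1 T2 I /\ Rabs I <= gap M (T2 - T1) m n.
Proof.
  intros Hm Hn HT. unfold gap. destruct (Nat.eq_dec m n) as [->|Hne].
  - exists (T2 - T1). split.
    + eapply is_RInt_ext; [|evar_last; [apply (is_RInt_const (V := R_NormedModule) T1 T2 1)|apply Rmult_1_r]].
      intros t _. simpl. rewrite Rminus_diag, Rmult_0_r, cos_0. reflexivity.
    + rewrite Rabs_pos_eq; lra.
  - set (l := ln (INR m) - ln (INR n)).
    assert (Hm0 : 1 <= INR m) by (apply (le_INR 1); lia). assert (Hn0 : 1 <= INR n) by (apply (le_INR 1); lia).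
    assert (HmM : INR m <= INR M) by (apply le_INR; lia). assert (HnM : INR n <= INR M) by (apply le_INR; lia).
    assert (Hd1 : 1 <= Rabs (INR n - INR m)).
    { destruct (Nat.le_gt_cases m n) as [H|H].
      - rewrite <- minus_INR, Rabs_pos_eq by (auto; apply pos_INR). apply (le_INR 1). lia.
      - rewrite Rabs_minus_sym, <- minus_INR, Rabs_pos_eq by (try lia; apply pos_INR). apply (le_INR 1). lia. }
    assert (Hl : Rabs (INR n - INR m) / INR M <= Rabs l).
    { unfold l. destruct (Rlt_le_dec (INR n) (INR m)) as [H|H].
      - rewrite Rabs_left by lra. pose proof (ln_diff_lower (INR m) (INR n) (INR M) ltac:(lra) H HmM).
        rewrite Rabs_pos_eq; [replace (- (INR n - INR m)) with (INR m - INR n) by ring; lra|].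
        eapply Rle_trans; [|exact H0]. apply Rdiv_le_0_compat; lra.
      - assert (H' : INR m < INR n). { destruct H as [H|H]; auto. rewrite H, Rminus_diag, Rabs_R0 in Hd1. lra. }
        rewrite Rabs_pos_eq by lra. pose proof (ln_diff_lower (INR n) (INR m) (INR M) ltac:(lra) H' HnM).
        rewrite Rabs_minus_sym, Rabs_pos_eq; [lra|].
        eapply Rle_trans; [|exact H0]. apply Rdiv_le_0_compat; lra. }
    assert (Hq : 0 < Rabs (INR n - INR m) / INR M) by (apply Rdiv_lt_0_compat; lra).
    assert (Hl0 : l <> 0) by (intros E; rewrite E, Rabs_R0 in Hl; lra).
    exists (sin (T2 * l) / l - sin (T1 * l) / l). split.
    + apply (is_RInt_antideriv (fun t => sin (t * l) / l)); auto; intros t _; auto_derive; auto. field. auto.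
    + replace (sin (T2 * l) / l - sin (T1 * l) / l) with ((sin (T2 * l) - sin (T1 * l)) * / l) by (field; auto).
      rewrite Rabs_mult, Rabs_inv.
      pose proof (SIN_bound (T2 * l)). pose proof (SIN_bound (T1 * l)).
      assert (Rabs (sin (T2 * l) - sin (T1 * l)) <= 2) by (apply Rabs_le; lra).
      apply Rle_trans with (2 * / (Rabs (INR n - INR m) / INR M)).
      * apply Rmult_le_compat; auto using Rabs_pos; [left; apply Rinv_0_lt_compat; lra|].
        apply Rinv_le_contravar; auto.
      * set (d := Rabs (INR n - INR m)) in *.
        replace (2 * / (d / INR M)) with (4 * INR M / (2 * d)) by (field; lra).
        apply Rmult_le_compat_l; [lra|]. apply Rinv_le_contravar; lra.
Qed.

Lemma clsum_fst_snd sg t L :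
  clsum (fun m => xpow (sg, t) (INR m)) L
  = (rlsum (fun m => exp (- sg * ln (INR m)) * cos (t * ln (INR m))) L,
     - rlsum (fun m => exp (- sg * ln (INR m)) * sin (t * ln (INR m))) L).
Proof.
  induction L as [|a L IH]; simpl.
  - unfold RtoC. f_equal. ring.
  - rewrite IH, xpow_eq. unfold Cplus. simpl. f_equal; ring.
Qed.

(** The square is expanded and each product e m * e n is replaced by half the sum of squares. This
    makes the form depend only on the row sums of [gap], and costs a factor [harm M]. Repeated
    entries of L are paid for by [Dm]. *)
Lemma mean_value sg T1 T2 L M Dm : T1 <= T2 -> 0 <= Dm ->
  (forall m, In m L -> (1 <= m <= M)%nat) ->
  (forall m, (1 <= m <= M)%nat -> INR (occ L m) <= Dm) ->
  RInt (fun t => Cmod (clsum (fun m => xpow (sg, t) (INR m)) L) ^ 2) T1 T2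
  <= Dm * (T2 - T1 + 8 * INR M * harm M) * rlsum (fun m => exp (- (2 * sg) * ln (INR m))) L.
Proof.
  intros HT HD HL Hocc.
  set (e := fun m => exp (- sg * ln (INR m))).
  assert (E : forall t, Cmod (clsum (fun m => xpow (sg, t) (INR m)) L) ^ 2
    = rlsum (fun m => rlsum (fun n => e m * e n * cos (t * (ln (INR m) - ln (INR n)))) L) L).
  { intros t. rewrite Cmod2_alt, clsum_fst_snd. unfold Re, Im. simpl fst. simpl snd.
    replace ((- rlsum (fun m => exp (- sg * ln (INR m)) * sin (t * ln (INR m))) L) ^ 2)
      with (rlsum (fun m => exp (- sg * ln (INR m)) * sin (t * ln (INR m))) L
        * rlsum (fun m => exp (- sg * ln (INR m)) * sin (t * ln (INR m))) L) by ring.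
    simpl. rewrite Rmult_1_r, !rlsum_mult, <- rlsum_plus. apply rlsum_ext. intros m _.
    rewrite <- rlsum_plus. apply rlsum_ext. intros n _. unfold e.
    rewrite Rmult_minus_distr_l, cos_minus. ring. }
  assert (HI : exists I : nat -> nat -> R, forall m n, In m L -> In n L ->
     is_RInt (fun t => cos (t * (ln (INR m) - ln (INR n)))) T1 T2 (I m n)
     /\ Rabs (I m n) <= gap M (T2 - T1) m n).
  { exists (fun m n => RInt (fun t => cos (t * (ln (INR m) - ln (INR n)))) T1 T2).
    intros m n Hm Hn. destruct (cos_integral_gap M T1 T2 m n (HL m Hm) (HL n Hn) HT) as [J [HJ1 HJ2]].
    rewrite (is_RInt_unique _ _ _ _ HJ1). auto. }
  destruct HI as [I HI].
  rewrite (RInt_ext (V := R_CompleteNormedModule) _ _ T1 T2 (fun t _ => E t)).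
  assert (HR : is_RInt (fun t => rlsum (fun m => rlsum (fun n => e m * e n * cos (t * (ln (INR m) - ln (INR n)))) L) L)
     T1 T2 (rlsum (fun m => rlsum (fun n => e m * e n * I m n) L) L)).
  { apply (is_RInt_rlsum (fun m t => rlsum (fun n => e m * e n * cos (t * (ln (INR m) - ln (INR n)))) L)).
    intros m Hm. apply (is_RInt_rlsum (fun n t => e m * e n * cos (t * (ln (INR m) - ln (INR n))))).
    intros n Hn. apply (is_RInt_scal (V := R_NormedModule)). apply HI; auto. }
  rewrite (is_RInt_unique _ _ _ _ HR).
  set (h := fun m => exp (- (2 * sg) * ln (INR m))).
  assert (Hh : forall m, e m * e m = h m).
  { intros m. unfold e, h. rewrite <- exp_plus. f_equal. ring. }
  assert (Hh0 : forall m, 0 < h m) by (intros m; apply exp_pos).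
  set (G := gap M (T2 - T1)).
  assert (HG0 : forall m n, 0 <= G m n).
  { intros m n. unfold G, gap. destruct (Nat.eq_dec m n); [lra|].
    pose proof (Rabs_pos (INR n - INR m)). pose proof (pos_INR M). apply Rdiv_le_0_compat; lra. }
  assert (HGs : forall m n, G m n = G n m).
  { intros m n. unfold G, gap. destruct (Nat.eq_dec m n), (Nat.eq_dec n m); try congruence.
    rewrite Rabs_minus_sym. reflexivity. }
  apply Rle_trans with (rlsum (fun m => rlsum (fun n => / 2 * (h m * G m n) + / 2 * (h n * G m n)) L) L).
  { apply rlsum_le. intros m Hm. apply rlsum_le. intros n Hn. destruct (HI m n Hm Hn) as [_ Hb].
    fold G in Hb. rewrite <- Hh, <- Hh. pose proof (exp_pos (- sg * ln (INR m))) as Pm.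
    pose proof (exp_pos (- sg * ln (INR n))) as Pn. fold (e m) in Pm. fold (e n) in Pn.
    apply Rle_trans with (e m * e n * G m n).
    - apply Rmult_le_compat_l; [nra|]. eapply Rle_trans; [apply Rle_abs|exact Hb].
    - specialize (HG0 m n). assert (0 <= (e m - e n) ^ 2 * G m n) by (apply Rmult_le_pos; [apply pow2_ge_0|auto]). nra. }
  assert (ES : forall m, rlsum (fun n => / 2 * (h m * G m n) + / 2 * (h n * G m n)) L
     = / 2 * (h m * rlsum (G m) L) + / 2 * rlsum (fun n => h n * G m n) L).
  { intros m. rewrite rlsum_plus, !rlsum_scal. reflexivity. }
  rewrite (rlsum_ext _ _ _ (fun m _ => ES m)), rlsum_plus, !rlsum_scal.
  rewrite (rlsum_swap (fun m n => h n * G m n)).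
  assert (ES2 : rlsum (fun n => rlsum (fun m => h n * G m n) L) L = rlsum (fun m => h m * rlsum (G m) L) L).
  { apply rlsum_ext. intros n _. rewrite rlsum_scal. f_equal. apply rlsum_ext. intros m _. apply HGs. }
  rewrite ES2. replace (/ 2 * rlsum (fun m => h m * rlsum (G m) L) L + / 2 * rlsum (fun m => h m * rlsum (G m) L) L)
    with (rlsum (fun m => h m * rlsum (G m) L) L) by field.
  rewrite <- rlsum_scal. apply rlsum_le. intros m Hm. rewrite Rmult_comm.
  apply Rmult_le_compat_r; [left; apply Hh0|].
  eapply Rle_trans; [apply (rlsum_le_occ (G m) L M Dm); auto|].
  apply Rmult_le_compat_l; auto. apply gap_sum; [auto|lra].
Qed.

Lemma xpow_mult s a b : (1 <= a)%nat -> (1 <= b)%nat ->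
  xpow s (INR (a * b)) = (xpow s (INR a) * xpow s (INR b))%C.
Proof.
  intros Ha Hb. unfold xpow. rewrite <- Cexp_plus, mult_INR, ln_mult by (apply lt_0_INR; auto).
  f_equal. rewrite RtoC_plus. ring.
Qed.

Lemma clsum_seq f a l : clsum f (seq a l) = csum (fun i => f (a + i)%nat) l.
Proof.
  revert a. induction l as [|l IH]; intros a; [reflexivity|].
  change (S l) with (1 + l)%nat at 2. rewrite csum_split. simpl. rewrite IH, Nat.add_0_r.
  replace (csum (fun k => f (a + S k)%nat) l) with (csum (fun i => f (S a + i)%nat) l); [ring|].
  apply csum_ext. intros k _. f_equal. lia.
Qed.

Lemma rlsum_seq f a l : rlsum f (seq a l) = rsum (fun i => f (a + i)%nat) l.
Proof.
  revert a. induction l as [|l IH]; intros a; [reflexivity|].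
  change (S l) with (1 + l)%nat at 2. rewrite rsum_split. simpl. rewrite IH, Nat.add_0_r.
  replace (rsum (fun k => f (a + S k)%nat) l) with (rsum (fun i => f (S a + i)%nat) l); [ring|].
  apply rsum_ext. intros k _. f_equal. lia.
Qed.

Definition dpoly (sg t : R) (a l : nat) : C := csum (fun i => xpow (sg, t) (INR (a + i))) l.

Lemma dpoly_continuous sg a l t : Ccontinuous (fun t => dpoly sg t a l) t.
Proof.
  unfold dpoly. induction l; simpl.
  - apply (continuous_const (U := R_UniformSpace) (V := C_UniformSpace)).
  - apply (continuous_plus (U := R_UniformSpace) (V := C_R_NormedModule)); auto.
    apply Ccontinuous_pair; apply (ex_derive_continuous (K := R_AbsRing) (V := R_NormedModule)).
    + eapply ex_derive_ext. { intros u. rewrite xpow_eq. simpl. reflexivity. } auto_derive; auto.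
    + eapply ex_derive_ext. { intros u. rewrite xpow_eq. simpl. reflexivity. } auto_derive; auto.
Qed.

Lemma continuous_pow (f : R -> R) n t : continuous f t -> continuous (fun t => f t ^ n) t.
Proof.
  intros H. induction n; simpl; [apply continuous_const|]. apply (continuous_mult (K := R_AbsRing)); auto.
Qed.

(** The k-th power of the polynomial has length N^k and multiplicities at most E^k. Its sum of m^(-2
    sg) with multiplicity factors back into a k-th power. *)
Lemma moment_bound sg a l k N E T1 T2 : (1 <= a)%nat -> (a + l <= S N)%nat -> T1 <= T2 -> 1 <= E ->
  (forall m l, (1 <= m <= N ^ k)%nat -> NoDup l -> (forall a, In a l -> Nat.divide a m) -> INR (length l) <= E) ->
  RInt (fun t => Cmod (dpoly sg t a l) ^ (2 * k)) T1 T2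
  <= E ^ k * (T2 - T1 + 8 * INR (N ^ k) * harm (N ^ k))
     * rsum (fun i => exp (- (2 * sg) * ln (INR (a + i)))) l ^ k.
Proof.
  intros Ha Hl HT HE Hdiv. set (A := seq a l).
  assert (HA1 : forall b, In b A -> (1 <= b)%nat) by (intros b Hb; apply in_seq in Hb; lia).
  assert (HA2 : forall b, In b A -> (b <= N)%nat) by (intros b Hb; apply in_seq in Hb; lia).
  assert (E1 : forall t, Cmod (dpoly sg t a l) ^ (2 * k)
     = Cmod (clsum (fun m => xpow (sg, t) (INR m)) (products A k)) ^ 2).
  { intros t. rewrite clsum_products; auto using xpow_mult.
    - unfold A. rewrite clsum_seq. unfold dpoly. rewrite Nat.mul_comm. apply pow_mult.
    - rewrite xpow_eq. simpl. rewrite ln_1, !Rmult_0_r, exp_0, cos_0, sin_0. unfold RtoC. f_equal; ring. }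
  rewrite (RInt_ext (V := R_CompleteNormedModule) _ _ T1 T2 (fun t _ => E1 t)).
  eapply Rle_trans.
  { apply (mean_value sg T1 T2 (products A k) (N ^ k) (E ^ k)); auto; [apply pow_le; lra|..].
    - intros m Hm. split; [eapply products_pos; eauto|eapply products_le; eauto].
    - intros m Hm. apply (occ_products A k (N ^ k) E); auto. apply seq_NoDup. }
  apply Req_le. f_equal. rewrite rlsum_products; auto.
  - unfold A. rewrite rlsum_seq. reflexivity.
  - simpl. rewrite ln_1, Rmult_0_r. apply exp_0.
  - intros x y Hx Hy. rewrite mult_INR, ln_mult, <- exp_plus by (apply lt_0_INR; auto). f_equal. ring.
Qed.

(** * Weyl-van der Corput bounds for the sums of n^(-it) *)

Definition cis (x : R) : C := (cos x, sin x).

Lemma Cmod_cis x : Cmod (cis x) = 1.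
Proof.
  unfold Cmod, cis. simpl. rewrite !Rmult_1_r, Rplus_comm.
  replace (sin x * sin x + cos x * cos x) with 1; [apply sqrt_1|].
  pose proof (sin2_cos2 x) as H. unfold Rsqr in H. lra.
Qed.

Lemma cis_plus x y : cis (x + y) = (cis x * cis y)%C.
Proof. unfold cis, Cmult. simpl. rewrite cos_plus, sin_plus. f_equal; ring. Qed.

Lemma cis_conj x : Cconj (cis x) = cis (- x).
Proof. unfold cis, Cconj. simpl. rewrite cos_neg, sin_neg. reflexivity. Qed.

Lemma sin_ge_half x : 0 <= x <= 1 -> x / 2 <= sin x.
Proof.
  intros Hx. pose proof PI2_3_2 as HP.
  destruct (MVT_gen sin 0 x cos) as [c [Hc E]].
  - intros y _. apply is_derive_Reals, derivable_pt_lim_sin.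
  - intros y _. apply continuity_pt_filterlim. apply continuous_sin.
  - rewrite Rmin_left, Rmax_right in Hc by lra. rewrite sin_0 in E.
    assert (1 / 2 <= cos c) by (rewrite <- cos_PI3; apply cos_decr_1; lra). nra.
Qed.

(* With [w = 1 / (1 - exp (- i g)) = (1 - i cot (g / 2)) / 2], each term is
   [z_n = (z_n - z_(n+1)) w_n]; the variation of [w] telescopes. *)
Lemma kusmin_landau (f : nat -> R) (L : nat) lam : 0 < lam ->
  (forall i, (i < L)%nat -> lam <= f i - f (S i) <= 2) ->
  (forall i, (S i < L)%nat -> f (S i) - f (S (S i)) <= f i - f (S i)) ->
  Cmod (csum (fun i => cis (f i)) L) <= 8 / lam.
Proof.
  intros Hl Hg Hmono.
  set (g := fun i => f i - f (S i)) in *.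
  set (c := fun i => cos (g i / 2) / sin (g i / 2)).
  set (w := fun i => (1 / 2, - c i / 2) : C).
  assert (Hs : forall i, (i < L)%nat -> 0 < sin (g i / 2) /\ 0 <= c i <= 4 / lam /\ lam <= 2).
  { intros i Hi. specialize (Hg i Hi). fold (g i) in Hg.
    pose proof (sin_ge_half (g i / 2) ltac:(lra)) as H1. pose proof PI2_3_2.
    assert (0 <= cos (g i / 2)) by (apply cos_ge_0; lra). pose proof (COS_bound (g i / 2)).
    split; [lra|]. split; [|lra]. unfold c. split; [apply Rdiv_le_0_compat; lra|].
    apply Rle_div_l; [lra|]. apply Rle_trans with (4 / lam * (lam / 4)).
    - replace (4 / lam * (lam / 4)) with 1 by (field; lra). lra.
    - apply Rmult_le_compat_l; [left; apply Rdiv_lt_0_compat; lra|lra]. }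
  assert (Hw : forall i, (i < L)%nat -> Cmod (w i) <= 3 / lam).
  { intros i Hi. destruct (Hs i Hi) as [_ [Hc Hl2]]. eapply Rle_trans; [apply Cmod_le_abs|]. simpl.
    rewrite Rabs_pos_eq by lra. replace (- c i / 2) with (- (c i / 2)) by field.
    rewrite Rabs_Ropp, Rabs_pos_eq by lra.
    assert (1 / 2 <= 1 / lam) by (apply Rmult_le_compat_l; [lra|]; apply Rinv_le_contravar; lra).
    unfold Rdiv in *. lra. }
  assert (Hc : forall i, (S i < L)%nat -> c i <= c (S i)).
  { intros i Hi. destruct (Hs i ltac:(lia)) as [S1 _]. destruct (Hs (S i) Hi) as [S2 _].
    pose proof (Hg i ltac:(lia)) as G1. pose proof (Hg (S i) Hi) as G2. specialize (Hmono i Hi).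
    fold (g i) in G1, Hmono. fold (g (S i)) in G2, Hmono.
    assert (E : c (S i) - c i = sin (g i / 2 - g (S i) / 2) / (sin (g i / 2) * sin (g (S i) / 2))).
    { unfold c. rewrite sin_minus. field. lra. }
    assert (0 <= sin (g i / 2 - g (S i) / 2)) by (pose proof (sin_ge_half (g i / 2 - g (S i) / 2) ltac:(lra)); lra).
    assert (0 <= c (S i) - c i); [|lra]. rewrite E. apply Rdiv_le_0_compat; [lra|].
    apply Rmult_lt_0_compat; lra. }
  set (z := fun i => cis (f i)).
  assert (Hz : forall i, (i < L)%nat -> (z i + z (S i) * w i)%C = (z i * w i)%C).
  { intros i Hi. destruct (Hs i Hi) as [S1 _].
    assert (Ez : z (S i) = (z i * cis (- g i))%C).
    { unfold z. rewrite <- cis_plus. f_equal. unfold g. ring. }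
    rewrite Ez.
    assert (E1 : ((RtoC 1 - cis (- g i)) * w i)%C = RtoC 1).
    { unfold cis, w, c. rewrite cos_neg, sin_neg.
      replace (cos (g i)) with (1 - 2 * sin (g i / 2) * sin (g i / 2)).
      2:{ rewrite <- cos_2a_sin. f_equal. field. }
      replace (sin (g i)) with (2 * sin (g i / 2) * cos (g i / 2)).
      2:{ rewrite <- sin_2a. f_equal. field. }
      pose proof (sin2_cos2 (g i / 2)) as H. unfold Rsqr in H.
      set (sn := sin (g i / 2)) in *. set (cs := cos (g i / 2)) in *.
      apply injective_projections; simpl.
      - transitivity (sn * sn + cs * cs); [field; lra|lra].
      - field. lra. }
    transitivity (z i * ((RtoC 1 - cis (- g i)) * w i) + z i * cis (- g i) * w i)%C; [rewrite E1; ring|ring]. }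
  assert (Main : forall n, (S n <= L)%nat ->
    Cmod (csum z (S n) + z (S n) * w n) <= Cmod (w 0%nat) + / 2 * (c n - c 0%nat)).
  { induction n as [|n IH]; intros Hn.
    - simpl csum. replace (RtoC 0 + z 0%nat + z 1%nat * w 0%nat)%C with (z 0%nat + z 1%nat * w 0%nat)%C by ring.
      rewrite Hz by lia. rewrite Cmod_mult. unfold z. rewrite Cmod_cis. lra.
    - change (csum z (S (S n))) with (csum z (S n) + z (S n))%C.
      replace (csum z (S n) + z (S n) + z (S (S n)) * w (S n))%C
        with (csum z (S n) + (z (S n) + z (S (S n)) * w (S n)))%C by ring.
      rewrite Hz by lia.
      replace (csum z (S n) + z (S n) * w (S n))%C
        with ((csum z (S n) + z (S n) * w n) + z (S n) * (w (S n) - w n))%C by ring.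
      eapply Rle_trans; [apply Cmod_triangle|]. specialize (IH ltac:(lia)).
      rewrite Cmod_mult. unfold z at 3. rewrite Cmod_cis, Rmult_1_l.
      assert (E : Cmod (w (S n) - w n) = / 2 * (c (S n) - c n)).
      { replace (w (S n) - w n)%C with (Ci * RtoC (- (/ 2 * (c (S n) - c n))))%C.
        - rewrite Cmod_mult, Cmod_Ci, Cmod_R, Rabs_Ropp, Rabs_pos_eq; [ring|].
          specialize (Hc n ltac:(lia)). lra.
        - unfold w. apply injective_projections; simpl; field. }
      lra. }
  destruct L as [|n].
  - simpl. rewrite Cmod_0. apply Rdiv_le_0_compat; lra.
  - specialize (Main n (le_n _)).
    replace (csum z (S n)) with ((csum z (S n) + z (S n) * w n) - z (S n) * w n)%C by ring.
    eapply Rle_trans; [apply Cmod_minus_le|]. rewrite (Cmod_mult (z (S n))). unfold z at 3. rewrite Cmod_cis.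
    pose proof (Hw n ltac:(lia)). pose proof (Hw 0%nat ltac:(lia)).
    destruct (Hs n ltac:(lia)) as [_ [C1 _]]. destruct (Hs 0%nat ltac:(lia)) as [_ [C2 _]].
    fold (csum z (S n)). unfold Rdiv in *. lra.
Qed.

Lemma csum_zero f n : (forall i, (i < n)%nat -> f i = RtoC 0) -> csum f n = RtoC 0.
Proof. intros H. induction n; simpl; auto. rewrite IHn, H by auto. ring. Qed.

Lemma csum_window f a b c : (forall i, (i < a)%nat -> f i = RtoC 0) ->
  (forall i, (a + b <= i)%nat -> f i = RtoC 0) ->
  csum f (a + b + c) = csum (fun i => f (a + i)%nat) b.
Proof.
  intros H1 H2. rewrite !csum_split, (csum_zero f a) by auto.
  rewrite (csum_zero (fun k => f (a + b + k)%nat) c); [ring|]. intros i _. apply H2. lia.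
Qed.

Lemma csum_swap (f : nat -> nat -> C) m n :
  csum (fun i => csum (f i) n) m = csum (fun j => csum (fun i => f i j) m) n.
Proof.
  induction m; simpl.
  - symmetry. apply csum_zero. auto.
  - rewrite IHm, <- csum_plus. reflexivity.
Qed.

Lemma Cmod_sqr_conj z : RtoC (Cmod z ^ 2) = (z * Cconj z)%C.
Proof. rewrite Cmod2_conj. reflexivity. Qed.

Lemma rsum_cauchy f n : rsum f n ^ 2 <= INR n * rsum (fun i => f i ^ 2) n.
Proof.
  induction n; [simpl; lra|]. cbn [rsum]. rewrite S_INR.
  set (s := rsum f n) in *. set (q := rsum (fun i => f i ^ 2) n) in *. set (x := f n).
  pose proof (pos_INR n) as Hn.
  assert (Hq : 0 <= q) by (apply rsum_nonneg; intros; apply pow2_ge_0).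
  assert (H : 2 * s * x <= q + INR n * x ^ 2).
  { destruct (Req_dec (INR n) 0) as [E|E].
    - assert (s ^ 2 <= 0) by (rewrite E in IHn; lra). assert (s = 0) by nra. rewrite H0. nra.
    - assert (0 < INR n) by lra. apply Rmult_le_reg_l with (INR n); [lra|].
      pose proof (pow2_ge_0 (s - INR n * x)). nra. }
  nra.
Qed.

(** Average over H shifts and apply Cauchy-Schwarz. Two kinds of correlation bounds are allowed:
    [Aa] / d is what Kusmin-Landau supplies in the inner differencing, and the constant [Bb] is the
    result of that differencing, fed into the outer one. *)
Lemma van_der_corput (z : nat -> C) (L H : nat) Aa Bb : (1 <= H)%nat -> 0 <= Aa -> 0 <= Bb ->
  (forall i, (i < L)%nat -> Cmod (z i) <= 1) ->
  (forall d, (1 <= d < H)%nat ->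
     Cmod (csum (fun i => z i * Cconj (z (i + d)%nat))%C (L - d)) <= Aa / INR d + Bb) ->
  INR H * Cmod (csum z L) ^ 2
  <= (INR L + INR H) * (INR L + 8 * Aa * harm H + INR H * Bb).
Proof.
  intros HH HA HB Hz Hcor.
  (* The sequence extended by zero and moved to start at H, so that its shifts by h < H stay within
     the natural numbers and all have the sum [S0] over [0, L + H). *)
  set (Z := fun j => if Nat.leb H j then if Nat.ltb j (H + L) then z (j - H)%nat else RtoC 0 else RtoC 0).
  assert (Z0 : forall j, (j < H \/ H + L <= j)%nat -> Z j = RtoC 0).
  { intros j Hj. unfold Z. destruct (Nat.leb_spec H j); auto. destruct (Nat.ltb_spec j (H + L)); auto. lia. }
  assert (Z1 : forall i, (i < L)%nat -> Z (H + i)%nat = z i).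
  { intros i Hi. unfold Z. destruct (Nat.leb_spec H (H + i)); [|lia].
    destruct (Nat.ltb_spec (H + i) (H + L)); [|lia]. f_equal. lia. }
  set (S0 := csum z L).
  assert (HS : forall h, (h < H)%nat -> csum (fun m => Z (m + h)%nat) (L + H) = S0).
  { intros h Hh. replace (L + H)%nat with ((H - h) + L + h)%nat by lia.
    rewrite csum_window.
    - apply csum_ext. intros i Hi. replace (H - h + i + h)%nat with (H + i)%nat by lia. auto.
    - intros i Hi. apply Z0. lia. - intros i Hi. apply Z0. lia. }
  assert (Cor : forall h h', (h <= h' < H)%nat ->
     csum (fun m => Z (m + h)%nat * Cconj (Z (m + h')%nat))%C (L + H)
     = csum (fun i => z i * Cconj (z (i + (h' - h))%nat))%C (L - (h' - h))).
  { intros h h' Hh. set (d := (h' - h)%nat).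
    destruct (Nat.le_gt_cases L d) as [Hd|Hd].
    - replace (L - d)%nat with 0%nat by lia. apply csum_zero. intros m _.
      destruct (Nat.lt_ge_cases (m + h) H) as [Hm|Hm]; [rewrite (Z0 (m + h)%nat) by lia; ring|].
      rewrite (Z0 (m + h')%nat) by lia. apply injective_projections; simpl; ring.
    - replace (L + H)%nat with ((H - h) + (L - d) + (d + h))%nat by lia.
      rewrite csum_window.
      + apply csum_ext. intros i Hi. replace (H - h + i + h)%nat with (H + i)%nat by lia.
        replace (H - h + i + h')%nat with (H + (i + d))%nat by lia. rewrite !Z1 by lia. reflexivity.
      + intros i Hi. rewrite (Z0 (i + h)%nat) by lia. ring.
      + intros i Hi. rewrite (Z0 (i + h')%nat) by lia. apply injective_projections; simpl; ring. }
  set (R := fun h h' => if Nat.eq_dec h h' then INR L else Aa * (2 / (Rabs (INR h' - INR h) + 1)) + Bb).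
  assert (CorR : forall h h', (h < H)%nat -> (h' < H)%nat ->
     Cmod (csum (fun m => Z (m + h)%nat * Cconj (Z (m + h')%nat))%C (L + H)) <= R h h').
  { assert (G : forall h h', (h < h' < H)%nat ->
       Cmod (csum (fun m => Z (m + h)%nat * Cconj (Z (m + h')%nat))%C (L + H))
       <= Aa * (2 / (Rabs (INR h' - INR h) + 1)) + Bb).
    { intros h h' Hh. rewrite Cor by lia. eapply Rle_trans; [apply Hcor; lia|].
      apply Rplus_le_compat_r. unfold Rdiv. apply Rmult_le_compat_l; auto.
      rewrite <- minus_INR by lia. rewrite Rabs_pos_eq by apply pos_INR.
      assert (1 <= INR (h' - h)) by (apply (le_INR 1); lia).
      replace (2 * / (INR (h' - h) + 1)) with (/ ((INR (h' - h) + 1) / 2)) by (field; lra).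
      apply Rinv_le_contravar; lra. }
    intros h h' Hh Hh'. unfold R. destruct (Nat.eq_dec h h') as [->|Hne].
    - rewrite Cor by lia. rewrite Nat.sub_diag, Nat.sub_0_r.
      eapply Rle_trans; [apply Cmod_csum|]. rewrite <- (Rmult_1_r (INR L)), <- rsum_const.
      apply rsum_le. intros i Hi. rewrite Nat.add_0_r, Cmod_mult, Cmod_conj.
      specialize (Hz i Hi). pose proof (Cmod_ge_0 (z i)). nra.
    - destruct (Nat.lt_ge_cases h h') as [Hl|Hl]; [apply G; lia|].
      rewrite Rabs_minus_sym.
      rewrite <- (Cmod_conj (csum _ _)), <- csum_conj.
      erewrite csum_ext; [apply (G h' h); lia|]. intros m _. simpl.
      apply injective_projections; simpl; ring. }
  set (Y := fun m => csum (fun h => Z (m + h)%nat) H).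
  assert (E1 : (RtoC (INR H) * S0)%C = csum Y (L + H)).
  { unfold Y. rewrite (csum_swap (fun m h => Z (m + h)%nat)).
    transitivity (csum (fun _ => S0) H).
    - clear. induction H as [|k IH]; cbn [csum]; [simpl; ring|]. rewrite <- IH, S_INR, RtoC_plus. ring.
    - apply csum_ext. intros h Hh. symmetry. auto. }
  assert (E2 : (INR H * Cmod S0) ^ 2 <= (INR L + INR H) * rsum (fun m => Cmod (Y m) ^ 2) (L + H)).
  { rewrite <- plus_INR. eapply Rle_trans; [|apply rsum_cauchy].
    apply pow_incr. split; [apply Rmult_le_pos; [apply pos_INR|apply Cmod_ge_0]|].
    replace (INR H * Cmod S0) with (Cmod (RtoC (INR H) * S0)).
    - rewrite E1. apply Cmod_csum.
    - rewrite Cmod_mult, Cmod_R, Rabs_pos_eq; auto using pos_INR. }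
  assert (E3 : rsum (fun m => Cmod (Y m) ^ 2) (L + H) <= rsum (fun h => rsum (fun h' => R h h') H) H).
  { assert (EC : RtoC (rsum (fun m => Cmod (Y m) ^ 2) (L + H))
       = csum (fun h => csum (fun h' => csum (fun m => Z (m + h)%nat * Cconj (Z (m + h')%nat))%C (L + H)) H) H).
    { rewrite RtoC_rsum.
      transitivity (csum (fun m => csum (fun h => csum (fun h' => Z (m + h)%nat * Cconj (Z (m + h')%nat))%C H) H) (L + H)).
      - apply csum_ext. intros m _. rewrite Cmod_sqr_conj. unfold Y. rewrite <- csum_conj, Cmult_comm, <- csum_scal.
        apply csum_ext. intros h _. rewrite Cmult_comm, <- csum_scal. reflexivity.
      - rewrite csum_swap. apply csum_ext. intros h _. rewrite csum_swap. reflexivity. }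
    rewrite <- (Rabs_pos_eq (rsum (fun m => Cmod (Y m) ^ 2) (L + H))).
    2:{ apply rsum_nonneg. intros. apply pow2_ge_0. }
    rewrite <- Cmod_R, EC. eapply Rle_trans; [apply Cmod_csum|]. apply rsum_le. intros h Hh.
    eapply Rle_trans; [apply Cmod_csum|]. apply rsum_le. intros h' Hh'. apply CorR; auto. }
  assert (E4 : forall h, (h < H)%nat -> rsum (fun h' => R h h') H <= INR L + 8 * Aa * harm H + INR H * Bb).
  { intros h Hh. pose proof (pos_INR L) as PL.
    apply Rle_trans with (rsum (fun h' => (if Nat.eq_dec h h' then INR L else 0)
       + (2 * Aa * / (Rabs (INR h' - INR h) + 1) + Bb)) H).
    - apply rsum_le. intros h' _. unfold R.
      pose proof (Rabs_pos (INR h' - INR h)).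
      assert (0 <= 2 * Aa * / (Rabs (INR h' - INR h) + 1)).
      { apply Rmult_le_pos; [lra|left; apply Rinv_0_lt_compat; lra]. }
      destruct (Nat.eq_dec h h'); [lra|]. unfold Rdiv. lra.
    - rewrite !rsum_plus, rsum_scal, rsum_const.
      assert (G1 : rsum (fun h' => if Nat.eq_dec h h' then INR L else 0) H <= INR L).
      { assert (G : forall K, rsum (fun k => if Nat.eq_dec h k then INR L else 0) K
           <= if Compare_dec.lt_dec h K then INR L else 0).
        { induction K; cbn [rsum]; [destruct (Compare_dec.lt_dec h 0); lra|].
          destruct (Nat.eq_dec h K), (Compare_dec.lt_dec h K), (Compare_dec.lt_dec h (S K)); try lia; lra. }
        eapply Rle_trans; [apply G|]. destruct (Compare_dec.lt_dec h H); lra. }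
      pose proof (harm_dist h H) as G2. pose proof (harm_mono (S h) H ltac:(lia)) as G3.
      assert (2 * Aa * rsum (fun k => / (Rabs (INR k - INR h) + 1)) H <= 2 * Aa * (2 * harm H)).
      { apply Rmult_le_compat_l; lra. }
      assert (0 <= harm H) by (apply (harm_mono 0); lia).
      assert (0 <= Aa * harm H) by (apply Rmult_le_pos; lra). lra. }
  assert (PH : 0 < INR H) by (apply lt_0_INR; lia).
  assert (E5 : rsum (fun h => rsum (fun h' => R h h') H) H <= INR H * (INR L + 8 * Aa * harm H + INR H * Bb)).
  { rewrite <- rsum_const. apply rsum_le. auto. }
  apply Rmult_le_reg_l with (INR H); auto. pose proof (pos_INR L).
  apply Rle_trans with ((INR L + INR H) * (INR H * (INR L + 8 * Aa * harm H + INR H * Bb))); [|apply Req_le; ring].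
  replace (INR H * (INR H * Cmod S0 ^ 2)) with ((INR H * Cmod S0) ^ 2) by ring.
  eapply Rle_trans; [exact E2|]. apply Rmult_le_compat_l; lra.
Qed.

(* Minus the derivative of the second difference
   [t (ln (x + d) + ln (x + e) - ln x - ln (x + d + e))]. *)
Definition psi (t d e y : R) : R := t * d * e * (/ y + / (y + d + e)) * (/ (y + d) * / (y + e)).

Lemma psi_decr t d e x y : 0 <= t -> 0 <= d -> 0 <= e -> 0 < x -> x <= y -> psi t d e y <= psi t d e x.
Proof.
  intros Ht Hd He Hx Hxy. unfold psi.
  assert (I : forall a b, 0 < a -> a <= b -> 0 <= / b <= / a).
  { intros a b Ha Hab. split; [left; apply Rinv_0_lt_compat; lra|apply Rinv_le_contravar; lra]. }
  pose proof (I x y ltac:(lra) ltac:(lra)). pose proof (I (x + d + e) (y + d + e) ltac:(lra) ltac:(lra)).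
  pose proof (I (x + d) (y + d) ltac:(lra) ltac:(lra)). pose proof (I (x + e) (y + e) ltac:(lra) ltac:(lra)).
  assert (0 <= t * d * e) by (repeat apply Rmult_le_pos; lra).
  apply Rmult_le_compat; [apply Rmult_le_pos; lra|apply Rmult_le_pos; lra|
    apply Rmult_le_compat_l; lra|apply Rmult_le_compat; lra].
Qed.

Lemma psi_bounds t d e N y : 0 <= t -> 0 <= d -> 0 <= e -> 0 < N -> N <= y -> y + d + e <= 2 * N ->
  t * d * e / (8 * N ^ 3) <= psi t d e y <= 2 * t * d * e / N ^ 3.
Proof.
  intros Ht Hd He HN Hy Hy2. unfold psi.
  assert (0 <= t * d * e) by (repeat apply Rmult_le_pos; lra).
  assert (I : forall a, N <= a -> a <= 2 * N -> / (2 * N) <= / a <= / N).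
  { intros a Ha Hab. split; apply Rinv_le_contravar; lra. }
  assert (P : 0 < / (2 * N)) by (apply Rinv_0_lt_compat; lra).
  pose proof (I y ltac:(lra) ltac:(lra)). pose proof (I (y + d + e) ltac:(lra) ltac:(lra)).
  pose proof (I (y + d) ltac:(lra) ltac:(lra)). pose proof (I (y + e) ltac:(lra) ltac:(lra)).
  rewrite (Rmult_assoc (t * d * e)). split.
  - apply Rle_trans with (t * d * e * (/ (2 * N) * (/ (2 * N) * / (2 * N)))); [apply Req_le; field; lra|].
    apply Rmult_le_compat_l; auto. apply Rmult_le_compat; try lra; [nra|]. apply Rmult_le_compat; lra.
  - apply Rle_trans with (t * d * e * ((2 * / N) * (/ N * / N))); [|apply Req_le; field; lra].
    apply Rmult_le_compat_l; auto. apply Rmult_le_compat; try lra; [apply Rmult_le_pos; lra|].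
    apply Rmult_le_compat; lra.
Qed.

Definition phase2 (t d e x : R) : R := t * (ln (x + d) + ln (x + e) - ln x - ln (x + d + e)).

Lemma phase2_step t d e x : 0 < d -> 0 < e -> 0 < x ->
  exists y, x <= y <= x + 1 /\ phase2 t d e x - phase2 t d e (x + 1) = psi t d e y.
Proof.
  intros Hd He Hx.
  destruct (MVT_gen (phase2 t d e) x (x + 1) (fun y => - psi t d e y)) as [y [Hy E]].
  - intros y. rewrite Rmin_left, Rmax_right by lra. intros Hy. unfold phase2, psi.
    auto_derive; [lra|]. field. lra.
  - intros y. rewrite Rmin_left, Rmax_right by lra. intros Hy. apply continuity_pt_filterlim.
    apply (ex_derive_continuous (K := R_AbsRing) (V := R_NormedModule)). unfold phase2. auto_derive. lra.
  - rewrite Rmin_left, Rmax_right in Hy by lra. exists y. split; auto. lra.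
Qed.

(** Consecutive phases differ by a value of [psi] at an intermediate point; these points are ordered
    and [psi] decreases. All arguments lie in [N, 2 N], so [psi] has the order t d e / N^3, and t d
    e <= N^3 keeps it at most 2. *)
Lemma second_difference_sum t (N L d e : nat) : 0 < t -> (1 <= N)%nat -> (1 <= d)%nat -> (1 <= e)%nat ->
  (L <= N)%nat -> t * INR d * INR e <= INR N ^ 3 ->
  Cmod (csum (fun i => cis (phase2 t (INR d) (INR e) (INR (N + i)))) (L - d - e))
  <= 64 * INR N ^ 3 / (t * INR d) / INR e.
Proof.
  intros Ht HN Hd He HL Hb. apply (le_INR 1) in HN as PN. apply (le_INR 1) in Hd as Pd.
  apply (le_INR 1) in He as Pe. simpl in PN, Pd, Pe.
  assert (PN3 : 0 < INR N ^ 3) by (apply pow_lt; lra).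
  assert (Pde : 0 < t * INR d * INR e) by (repeat apply Rmult_lt_0_compat; lra).
  replace (64 * INR N ^ 3 / (t * INR d) / INR e) with (8 / (t * INR d * INR e / (8 * INR N ^ 3)))
    by (field; repeat split; lra).
  assert (Hi1 : forall i, 1 <= INR (N + i)) by (intros i; apply (le_INR 1); lia).
  apply kusmin_landau.
  - apply Rdiv_lt_0_compat; lra.
  - intros i Hi. destruct (phase2_step t (INR d) (INR e) (INR (N + i))) as [y [Hy E]]; try lra.
    { specialize (Hi1 i). lra. }
    replace (INR (N + S i)) with (INR (N + i) + 1) by (rewrite Nat.add_succ_r, S_INR; ring).
    rewrite E.
    assert (H1 : INR N <= INR (N + i)) by (apply le_INR; lia).
    assert (H2 : INR (N + i) + 1 + INR d + INR e <= 2 * INR N).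
    { rewrite <- S_INR, <- !plus_INR. replace (2 * INR N) with (INR (2 * N)) by (rewrite mult_INR; reflexivity).
      apply le_INR. lia. }
    pose proof (psi_bounds t (INR d) (INR e) (INR N) y ltac:(lra) ltac:(lra) ltac:(lra) ltac:(lra) ltac:(lra) ltac:(lra)) as [B1 B2].
    split; auto. eapply Rle_trans; [exact B2|]. apply Rle_div_l; lra.
  - intros i Hi. destruct (phase2_step t (INR d) (INR e) (INR (N + i))) as [y [Hy E]]; try lra.
    { specialize (Hi1 i). lra. }
    destruct (phase2_step t (INR d) (INR e) (INR (N + S i))) as [y' [Hy' E']]; try lra.
    { specialize (Hi1 (S i)). lra. }
    assert (ES : forall k, INR (N + S k) = INR (N + k) + 1) by (intros k; rewrite Nat.add_succ_r, S_INR; ring).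
    rewrite (ES (S i)), E'. rewrite (ES i) at 1. rewrite E. rewrite (ES i) in Hy'.
    specialize (Hi1 i). apply psi_decr; lra.
Qed.

(** Both differencings use the same H. The condition t H^2 <= N^3 admits all shifts d, e < H in
    Kusmin-Landau, and N^2 <= 4 t makes its bound N^3 / (t d e) of order N / (d e), harmless up to
    [harm H]. *)
Lemma log_phase_sum t (N L H : nat) : 0 < t -> (1 <= N)%nat -> (L <= N)%nat -> (1 <= H <= N)%nat ->
  t * INR H ^ 2 <= INR N ^ 3 -> INR N ^ 2 <= 4 * t ->
  INR H * Cmod (csum (fun i => cis (- (t * ln (INR (N + i))))) L) ^ 4 <= 16900 * INR N ^ 4 * (1 + harm H).
Proof.
  intros Ht HN HL HH Hb Hb2. apply (le_INR 1) in HN as PN. simpl in PN.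
  assert (PH : 1 <= INR H) by (apply (le_INR 1); lia).
  assert (HHN : INR H <= INR N) by (apply le_INR; lia).
  assert (HLN : INR L <= INR N) by (apply le_INR; lia).
  assert (Ph : 0 <= harm H) by (apply (harm_mono 0); lia).
  set (h := harm H) in *. set (X := INR N) in *. set (Y := INR H) in *.
  set (z := fun i => cis (- (t * ln (INR (N + i))))).
  set (Bd := sqrt (4096 * X ^ 2 * (1 + h) / Y)).
  assert (HBd0 : 0 <= 4096 * X ^ 2 * (1 + h) / Y) by (apply Rdiv_le_0_compat; [nra|lra]).
  assert (Inner : forall d, (1 <= d < H)%nat ->
     Cmod (csum (fun i => z i * Cconj (z (i + d)%nat))%C (L - d)) <= 0 / INR d + Bd).
  { intros d Hd. assert (Pd : 1 <= INR d) by (apply (le_INR 1); lia).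
    assert (HdH : INR d <= Y) by (apply le_INR; lia).
    pose proof (van_der_corput (fun i => z i * Cconj (z (i + d)%nat))%C (L - d) H
      (64 * X ^ 3 / (t * INR d)) 0 ltac:(lia)) as V.
    assert (HA : 0 <= 64 * X ^ 3 / (t * INR d)).
    { apply Rdiv_le_0_compat; [|nra]. assert (0 < X ^ 3) by (apply pow_lt; lra). lra. }
    specialize (V HA (Rle_refl 0)). fold Y h in V.
    assert (V1 : Y * Cmod (csum (fun i => z i * Cconj (z (i + d)%nat))%C (L - d)) ^ 2
      <= (INR (L - d) + Y) * (INR (L - d) + 8 * (64 * X ^ 3 / (t * INR d)) * h + Y * 0)).
    { apply V.
      - intros i _. rewrite Cmod_mult, Cmod_conj. unfold z. rewrite !Cmod_cis. lra.
      - intros e He. rewrite Rplus_0_r.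
        erewrite csum_ext; [apply (second_difference_sum t N L d e); auto; try lia|].
        + assert (Pe : 1 <= INR e) by (apply (le_INR 1); lia).
          assert (HeH : INR e <= Y) by (apply le_INR; lia). fold X.
          eapply Rle_trans; [|exact Hb]. rewrite Rmult_assoc. apply Rmult_le_compat_l; [lra|]. nra.
        + intros i _. unfold z. rewrite !cis_conj, <- !cis_plus, cis_conj, <- cis_plus. f_equal.
          unfold phase2. rewrite !plus_INR. rewrite !Ropp_involutive.
          replace (INR N + INR i + INR e + INR d) with (INR N + INR i + INR d + INR e) by ring.
          replace (INR N + (INR i + INR d)) with (INR N + INR i + INR d) by ring.
          replace (INR N + (INR i + INR e)) with (INR N + INR i + INR e) by ring.
          replace (INR N + (INR i + INR e + INR d)) with (INR N + INR i + INR d + INR e) by ring.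
          ring. }
    assert (V2 : Y * Cmod (csum (fun i => z i * Cconj (z (i + d)%nat))%C (L - d)) ^ 2 <= 4096 * X ^ 2 * (1 + h)).
    { eapply Rle_trans; [exact V1|].
      assert (HLd : INR (L - d) <= X) by (apply le_INR; lia). pose proof (pos_INR (L - d)).
      assert (Q : 64 * X ^ 3 / (t * INR d) <= 256 * X).
      { apply Rle_div_l; [nra|]. assert (0 <= X * (4 * t - X ^ 2)) by (apply Rmult_le_pos; lra).
        assert (X * t <= X * (t * INR d)) by (apply Rmult_le_compat_l; [lra|]; nra). nra. }
      assert (QD : 0 <= 64 * X ^ 3 / (t * INR d) * h) by (apply Rmult_le_pos; lra).
      apply Rle_trans with ((2 * X) * (X + 2048 * X * h)).
      - apply Rmult_le_compat; try lra.
        + assert (64 * X ^ 3 / (t * INR d) * h <= 256 * X * h) by (apply Rmult_le_compat_r; lra). lra.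
      - assert (0 <= X ^ 2) by apply pow2_ge_0. assert (0 <= X ^ 2 * h) by (apply Rmult_le_pos; lra). lra. }
    replace (0 / INR d + Bd) with Bd by (field; lra). unfold Bd.
    set (q := Cmod _) in *. assert (Hq : 0 <= q) by apply Cmod_ge_0.
    rewrite <- (sqrt_pow2 q) by exact Hq. apply sqrt_le_1_alt.
    apply (proj1 (Rle_div_r (q ^ 2) _ Y ltac:(lra))). rewrite Rmult_comm. exact V2. }
  assert (HBd : 0 <= Bd) by apply sqrt_pos.
  pose proof (van_der_corput z L H 0 Bd ltac:(lia) (Rle_refl 0) HBd) as V. fold Y h in V.
  set (S0 := Cmod (csum z L)) in *. assert (HS0 : 0 <= S0) by apply Cmod_ge_0.
  assert (V1 : Y * S0 ^ 2 <= (INR L + Y) * (INR L + 8 * 0 * h + Y * Bd)).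
  { apply V; auto. intros i _. unfold z. rewrite Cmod_cis. lra. }
  assert (EB : Bd * Bd * Y = 4096 * X ^ 2 * (1 + h)).
  { unfold Bd. rewrite sqrt_sqrt by auto. field. lra. }
  assert (V2 : Y * S0 ^ 2 <= 2 * X * (X + Y * Bd)).
  { eapply Rle_trans; [exact V1|]. pose proof (pos_INR L). apply Rmult_le_compat; try lra.
    - assert (0 <= Y * Bd) by (apply Rmult_le_pos; lra). lra. }
  (* [X <= Y Bd / 64] since [(Y Bd)^2 = 4096 X^2 (1 + h) Y] *)
  assert (V3 : 64 * X <= Y * Bd).
  { apply Rsqr_incr_0_var; [|apply Rmult_le_pos; lra]. unfold Rsqr.
    replace (Y * Bd * (Y * Bd)) with (Y * (Bd * Bd * Y)) by ring. rewrite EB.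
    assert (1 <= Y * (1 + h)) by nra. assert (0 <= X ^ 2) by apply pow2_ge_0. nra. }
  assert (V4 : Y * S0 ^ 2 <= 65 / 32 * X * (Y * Bd)) by nra.
  assert (V5 : S0 ^ 2 <= 65 / 32 * X * Bd) by (apply Rmult_le_reg_l with Y; lra).
  replace (S0 ^ 4) with (S0 ^ 2 * S0 ^ 2) by ring.
  assert (V6 : S0 ^ 2 * S0 ^ 2 <= (65 / 32 * X * Bd) * (65 / 32 * X * Bd)).
  { apply Rmult_le_compat; auto using pow2_ge_0. }
  apply Rle_trans with (Y * ((65 / 32 * X * Bd) * (65 / 32 * X * Bd))); [apply Rmult_le_compat_l; lra|].
  replace (Y * (65 / 32 * X * Bd * (65 / 32 * X * Bd))) with (4225 / 1024 * X ^ 2 * (Bd * Bd * Y)) by field.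
  rewrite EB. apply Req_le. field.
Qed.

Lemma INR_pow2 n : INR (2 ^ n) = 2 ^ n.
Proof. rewrite pow_INR. reflexivity. Qed.

(** With H^2 of order N^3 / U^2, the bound S^4 << N^4 log / H becomes S^8 << N^5 U^2 log^2; the
    eighth power avoids roots. *)
Lemma log_phase_block t (u i L : nat) : (2 ^ u) ^ 2 <= t <= 4 * (2 ^ u) ^ 2 -> (i <= S u)%nat ->
  (L <= 2 ^ i)%nat ->
  Cmod (csum (fun k => cis (- (t * ln (INR (2 ^ i + k))))) L) ^ 8
  <= 3 * 10 ^ 9 * (2 + INR i) ^ 2 * (2 ^ i) ^ 5 * (2 ^ u) ^ 2.
Proof.
  intros Ht Hi HL. set (S0 := Cmod _). assert (HS : 0 <= S0) by apply Cmod_ge_0.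
  pose proof (pow_R1_Rle 2 u ltac:(lra)) as HU. pose proof (pow_R1_Rle 2 i ltac:(lra)) as HN.
  pose proof (pos_INR i) as Pi.
  set (U := 2 ^ u) in *. set (N := 2 ^ i) in *.
  destruct (Nat.le_gt_cases (2 + 2 * u) (3 * i)) as [Hc|Hc].
  - set (v := ((3 * i - 2 - 2 * u) / 2)%nat).
    pose proof (Nat.div_mod_eq (3 * i - 2 - 2 * u) 2) as Ev. fold v in Ev.
    pose proof (Nat.mod_upper_bound (3 * i - 2 - 2 * u) 2 ltac:(lia)) as Hm.
    set (H := (2 ^ v)%nat).
    assert (EH : INR H = 2 ^ v) by apply INR_pow2.
    assert (B1 : 4 * U ^ 2 * INR H ^ 2 <= N ^ 3).
    { rewrite EH. unfold U, N. rewrite <- !pow_mult. replace 4 with (2 ^ 2) by ring.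
      rewrite <- !pow_add. apply Rle_pow; [lra|lia]. }
    assert (B2 : N ^ 3 <= 8 * U ^ 2 * INR H ^ 2).
    { rewrite EH. unfold U, N. rewrite <- !pow_mult. replace 8 with (2 ^ 3) by ring.
      rewrite <- !pow_add. apply Rle_pow; [lra|lia]. }
    assert (HvN : (H <= 2 ^ i)%nat) by (apply Nat.pow_le_mono_r; lia).
    assert (H1 : (1 <= H)%nat) by (unfold H; pose proof (Nat.pow_nonzero 2 v); lia).
    assert (P1 : (1 <= 2 ^ i)%nat) by (pose proof (Nat.pow_nonzero 2 i); lia).
    assert (PH : 1 <= INR H) by (apply (le_INR 1); auto).
    assert (HN2 : N <= 2 * U).
    { unfold N, U. change (2 * 2 ^ u) with (2 ^ (S u)). apply Rle_pow; [lra|lia]. }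
    pose proof (log_phase_sum t (2 ^ i) L H ltac:(nra) P1 HL (conj H1 HvN)) as B3.
    rewrite INR_pow2 in B3. fold N in B3.
    assert (B4 : INR H * S0 ^ 4 <= 16900 * N ^ 4 * (1 + harm H)).
    { apply B3; [|nra]. eapply Rle_trans; [|exact B1]. apply Rmult_le_compat_r; [apply pow2_ge_0|lra]. }
    assert (Hh : harm H <= 1 + INR i).
    { eapply Rle_trans; [apply harm_pow2|]. apply Rplus_le_compat_l, le_INR. lia. }
    assert (P4 : 0 < N ^ 4) by (apply pow_lt; lra).
    assert (B5 : INR H * S0 ^ 4 <= 16900 * N ^ 4 * (2 + INR i)).
    { eapply Rle_trans; [exact B4|]. apply Rmult_le_compat_l; lra. }
    assert (B6 : INR H ^ 2 * S0 ^ 8 <= 16900 ^ 2 * N ^ 8 * (2 + INR i) ^ 2).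
    { replace (INR H ^ 2 * S0 ^ 8) with ((INR H * S0 ^ 4) ^ 2) by ring.
      replace (16900 ^ 2 * N ^ 8 * (2 + INR i) ^ 2) with ((16900 * N ^ 4 * (2 + INR i)) ^ 2) by ring.
      apply pow_incr. split; auto. apply Rmult_le_pos; [lra|apply pow_le; auto]. }
    apply Rmult_le_reg_l with (INR H ^ 2); [nra|].
    eapply Rle_trans; [exact B6|].
    replace (N ^ 8) with (N ^ 5 * N ^ 3) by ring.
    assert (P5 : 0 < N ^ 5) by (apply pow_lt; lra).
    apply Rle_trans with (16900 ^ 2 * (N ^ 5 * (8 * U ^ 2 * INR H ^ 2)) * (2 + INR i) ^ 2).
    + apply Rmult_le_compat_r; [apply pow2_ge_0|]. apply Rmult_le_compat_l; [lra|].
      apply Rmult_le_compat_l; lra.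
    + assert (0 <= N ^ 5 * U ^ 2 * INR H ^ 2 * (2 + INR i) ^ 2).
      { repeat apply Rmult_le_pos; try apply pow2_ge_0; lra. }
      nra.
  (* Short block: N^3 <= 2 U^2, so the trivial bound N^8 = N^5 N^3 is already good enough. *)
  - assert (B1 : S0 <= N).
    { unfold S0. eapply Rle_trans; [apply Cmod_csum|].
      rewrite (rsum_ext _ (fun _ => 1)) by (intros; apply Cmod_cis). rewrite rsum_const, Rmult_1_r.
      unfold N. rewrite <- INR_pow2. apply le_INR, HL. }
    assert (B2 : N ^ 3 <= 2 * U ^ 2).
    { unfold U, N. rewrite <- !pow_mult. change (2 * 2 ^ (u * 2)) with (2 ^ (S (u * 2))). apply Rle_pow; [lra|lia]. }
    apply Rle_trans with (N ^ 8); [apply pow_incr; lra|].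
    replace (N ^ 8) with (N ^ 5 * N ^ 3) by ring.
    assert (P5 : 0 < N ^ 5) by (apply pow_lt; lra).
    apply Rle_trans with (N ^ 5 * (2 * U ^ 2)); [apply Rmult_le_compat_l; lra|].
    assert (0 <= N ^ 5 * U ^ 2) by (apply Rmult_le_pos; [lra|apply pow2_ge_0]).
    assert (2 <= 3 * 10 ^ 9 * (2 + INR i) ^ 2) by nra. nra.
Qed.

Lemma abel_decreasing (b : nat -> R) (z : nat -> C) n M : (forall i, 0 <= b (S i) <= b i) ->
  (forall j, (j <= n)%nat -> Cmod (csum z j) <= M) ->
  Cmod (csum (fun i => RtoC (b i) * z i)%C n) <= b 0%nat * M.
Proof.
  intros Hb HM. assert (HM0 : 0 <= M) by (eapply Rle_trans; [apply Cmod_ge_0|apply (HM 0%nat); lia]).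
  assert (Hb0 : forall i, 0 <= b i) by (intros i; specialize (Hb i); lra).
  destruct n as [|n]; [simpl; rewrite Cmod_0; apply Rmult_le_pos; auto|].
  assert (G : forall m, (m <= n)%nat ->
    Cmod (csum (fun i => RtoC (b i) * z i)%C (S m) - RtoC (b m) * csum z (S m)) <= (b 0%nat - b m) * M).
  { induction m as [|m IH]; intros Hm.
    - simpl csum. replace (RtoC 0 + RtoC (b 0%nat) * z 0%nat - RtoC (b 0%nat) * (RtoC 0 + z 0%nat))%C with (RtoC 0) by ring.
      rewrite Cmod_0. lra.
    - specialize (IH ltac:(lia)).
      change (csum (fun i => RtoC (b i) * z i)%C (S (S m)))
        with (csum (fun i => RtoC (b i) * z i)%C (S m) + RtoC (b (S m)) * z (S m))%C.
      change (csum z (S (S m))) with (csum z (S m) + z (S m))%C.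
      replace (csum (fun i => RtoC (b i) * z i)%C (S m) + RtoC (b (S m)) * z (S m)
         - RtoC (b (S m)) * (csum z (S m) + z (S m)))%C
        with ((csum (fun i => RtoC (b i) * z i)%C (S m) - RtoC (b m) * csum z (S m))
          + RtoC (b m - b (S m)) * csum z (S m))%C by (rewrite RtoC_minus; ring).
      eapply Rle_trans; [apply Cmod_triangle|]. rewrite (Cmod_mult (RtoC _)), Cmod_R.
      specialize (Hb m). rewrite (Rabs_pos_eq (b m - b (S m))) by lra.
      pose proof (HM (S m) ltac:(lia)).
      assert ((b m - b (S m)) * Cmod (csum z (S m)) <= (b m - b (S m)) * M) by (apply Rmult_le_compat_l; lra).
      lra. }
  specialize (G n (le_n _)).
  replace (csum (fun i => RtoC (b i) * z i)%C (S n))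
    with ((csum (fun i => RtoC (b i) * z i)%C (S n) - RtoC (b n) * csum z (S n)) + RtoC (b n) * csum z (S n))%C by ring.
  eapply Rle_trans; [apply Cmod_triangle|]. rewrite (Cmod_mult (RtoC (b n)) (csum z (S n))), Cmod_R, Rabs_pos_eq by auto.
  pose proof (HM (S n) (le_n _)).
  assert (b n * Cmod (csum z (S n)) <= b n * M) by (apply Rmult_le_compat_l; auto). lra.
Qed.

Lemma xpow_half t x : 0 < x -> xpow (1 / 2, t) x = (RtoC (/ sqrt x) * cis (- (t * ln x)))%C.
Proof.
  intros Hx. rewrite xpow_eq. simpl fst. simpl snd. rewrite exp_half_ln by auto.
  unfold cis. rewrite cos_neg, sin_neg. apply injective_projections; simpl; ring.
Qed.

Lemma pow4_le_root x W : 0 <= x -> 0 <= W -> x ^ 4 <= W -> x <= sqrt (sqrt W).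
Proof.
  intros Hx HW H. rewrite <- (sqrt_pow2 x) by auto. apply sqrt_le_1_alt.
  rewrite <- (sqrt_pow2 (x ^ 2)) by apply pow2_ge_0. apply sqrt_le_1_alt.
  replace ((x ^ 2) ^ 2) with (x ^ 4) by ring. exact H.
Qed.

Lemma root_pow4 W : 0 <= W -> sqrt (sqrt W) ^ 4 = W.
Proof.
  intros HW. replace 4%nat with (2 * 2)%nat by lia. rewrite pow_mult, pow2_sqrt by apply sqrt_pos. now apply pow2_sqrt.
Qed.

(** The last factor is U^(3/2), that is T^(3/4). *)
Definition weyl4 (u : nat) : R := 10 ^ 5 * (3 + INR u) * (2 ^ u * sqrt (2 ^ u)).

(** Removing n^(-1/2) by partial summation divides S^8 << N^5 U^2 by N^4, and N U^2 <= 2 U^3 is the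
    square of U^(3/2) up to a constant. *)
Lemma half_line_block t (u i l : nat) : (2 ^ u) ^ 2 <= t <= 4 * (2 ^ u) ^ 2 -> (i <= S u)%nat ->
  (l <= 2 ^ i)%nat -> Cmod (dpoly (1 / 2) t (2 ^ i) l) ^ 4 <= weyl4 u.
Proof.
  intros Ht Hi Hl. pose proof (pow_R1_Rle 2 u ltac:(lra)) as HU. pose proof (pow_R1_Rle 2 i ltac:(lra)) as HN.
  pose proof (pos_INR i) as Pi. pose proof (pos_INR u) as Pu.
  set (z := fun k => cis (- (t * ln (INR (2 ^ i + k))))).
  set (b := fun k => / sqrt (INR (2 ^ i + k))).
  assert (P1 : forall k, 1 <= INR (2 ^ i + k)).
  { intros k. apply (le_INR 1). pose proof (Nat.pow_nonzero 2 i). lia. }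
  assert (E : dpoly (1 / 2) t (2 ^ i) l = csum (fun k => RtoC (b k) * z k)%C l).
  { unfold dpoly. apply csum_ext. intros k _. apply xpow_half. specialize (P1 k). lra. }
  set (Q := 3 * 10 ^ 9 * (2 + INR i) ^ 2 * (2 ^ i) ^ 5 * (2 ^ u) ^ 2).
  assert (HQ : 0 < Q).
  { unfold Q. repeat apply Rmult_lt_0_compat; try lra; apply pow_lt; lra. }
  set (M := sqrt (sqrt (sqrt Q))).
  assert (HM : 0 <= M /\ M ^ 8 = Q).
  { split; [apply sqrt_pos|]. unfold M. replace 8%nat with (2 * (2 * 2))%nat by lia.
    rewrite !pow_mult, !pow2_sqrt; auto; try apply sqrt_pos. lra. }
  assert (B1 : Cmod (dpoly (1 / 2) t (2 ^ i) l) <= b 0%nat * M).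
  { rewrite E. apply abel_decreasing.
    - intros k. unfold b. pose proof (P1 k). pose proof (P1 (S k)).
      assert (INR (2 ^ i + k) <= INR (2 ^ i + S k)) by (apply le_INR; lia).
      split; [left; apply Rinv_0_lt_compat, sqrt_lt_R0; lra|].
      apply Rinv_le_contravar; [apply sqrt_lt_R0; lra|apply sqrt_le_1_alt; lra].
    - intros j Hj. pose proof (log_phase_block t u i j Ht Hi ltac:(lia)) as H8. fold z Q in H8.
      pose proof (Cmod_ge_0 (csum z j)) as Hc. set (q := Cmod (csum z j)) in *.
      assert (H2 : q ^ 2 <= sqrt (sqrt Q)).
      { apply pow4_le_root; [apply pow2_ge_0|lra|]. replace ((q ^ 2) ^ 4) with (q ^ 8) by ring. exact H8. }
      rewrite <- (sqrt_pow2 q) by exact Hc. apply sqrt_le_1_alt. exact H2. }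
  assert (B2 : (b 0%nat * M) ^ 8 = 3 * 10 ^ 9 * (2 + INR i) ^ 2 * 2 ^ i * (2 ^ u) ^ 2).
  { rewrite Rpow_mult_distr. destruct HM as [_ ->]. unfold b, Q. rewrite Nat.add_0_r, INR_pow2.
    set (N := 2 ^ i) in *. replace ((/ sqrt N) ^ 8) with (/ (N ^ 4)).
    - field. lra.
    - rewrite pow_inv. f_equal. replace 8%nat with (2 * 4)%nat by lia. rewrite pow_mult, pow2_sqrt; lra. }
  assert (B3 : 3 * 10 ^ 9 * (2 + INR i) ^ 2 * 2 ^ i * (2 ^ u) ^ 2 <= weyl4 u ^ 2).
  { unfold weyl4. set (U := 2 ^ u) in *.
    replace ((10 ^ 5 * (3 + INR u) * (U * sqrt U)) ^ 2) with (10 ^ 10 * (3 + INR u) ^ 2 * (U ^ 2 * sqrt U ^ 2)) by ring.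
    rewrite pow2_sqrt by lra.
    assert (HN2 : 2 ^ i <= 2 * U) by (unfold U; change (2 * 2 ^ u) with (2 ^ (S u)); apply Rle_pow; [lra|lia]).
    assert (Hiu : INR i <= INR u + 1) by (rewrite <- S_INR; apply le_INR; lia).
    assert (H2 : (2 + INR i) ^ 2 <= (3 + INR u) ^ 2) by (apply pow_incr; lra).
    apply Rle_trans with (3 * 10 ^ 9 * (3 + INR u) ^ 2 * (2 * U) * U ^ 2).
    - apply Rmult_le_compat_r; [apply pow2_ge_0|].
      apply Rmult_le_compat; try lra. + apply Rmult_le_pos; [lra|apply pow2_ge_0].
    - assert (0 <= (3 + INR u) ^ 2 * (U ^ 2 * U)).
      { apply Rmult_le_pos; [apply pow2_ge_0|]. apply Rmult_le_pos; [apply pow2_ge_0|lra]. }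
      nra. }
  assert (W0 : 0 <= weyl4 u).
  { unfold weyl4. repeat apply Rmult_le_pos; try lra. apply sqrt_pos. }
  apply Rsqr_incr_0_var; auto. unfold Rsqr.
  replace (Cmod (dpoly (1 / 2) t (2 ^ i) l) ^ 4 * Cmod (dpoly (1 / 2) t (2 ^ i) l) ^ 4)
    with (Cmod (dpoly (1 / 2) t (2 ^ i) l) ^ 8) by ring.
  replace (weyl4 u * weyl4 u) with (weyl4 u ^ 2) by ring.
  eapply Rle_trans; [apply pow_incr; split; [apply Cmod_ge_0|exact B1]|]. lra.
Qed.

Lemma dpoly_split sg t a l m : dpoly sg t a (l + m) = (dpoly sg t a l + dpoly sg t (a + l) m)%C.
Proof.
  unfold dpoly. rewrite csum_split. f_equal. apply csum_ext. intros k _. now rewrite Nat.add_assoc.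
Qed.

Lemma pow4_convex a b : (a + b) ^ 4 <= 8 * (a ^ 4 + b ^ 4).
Proof.
  assert (H1 : (a + b) ^ 2 <= 2 * (a ^ 2 + b ^ 2)) by (pose proof (pow2_ge_0 (a - b)); nra).
  pose proof (pow2_ge_0 (a + b)). pose proof (pow2_ge_0 (a ^ 2 - b ^ 2)).
  replace ((a + b) ^ 4) with ((a + b) ^ 2 * (a + b) ^ 2) by ring.
  apply Rle_trans with ((2 * (a ^ 2 + b ^ 2)) * (2 * (a ^ 2 + b ^ 2))); [apply Rmult_le_compat; auto|]. nra.
Qed.

Lemma zeta_half_line_pow4 zeta t u B4 : is_riemann_zeta zeta -> (2 ^ u) ^ 2 <= t <= 4 * (2 ^ u) ^ 2 ->
  (forall j, (j <= 2 ^ S u)%nat -> Cmod (dpoly (1 / 2) t 1 j) ^ 4 <= B4) ->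
  Cmod (zeta (crit t)) ^ 4 <= 1500 ^ 4 * (3 + INR u) ^ 4 * (8 * (1 + B4)).
Proof.
  intros Hz Ht HB.
  assert (PB : 0 <= B4) by (eapply Rle_trans; [|apply (HB 0%nat); lia]; apply pow_le, Cmod_ge_0).
  assert (Z : Cmod (zeta (crit t)) <= 1500 * (1 + harm (2 * 2 ^ u)) * (1 + sqrt (sqrt B4))).
  { apply zeta_half_line_bound; auto.
    - pose proof (Nat.pow_nonzero 2 u). lia.
    - rewrite INR_pow2. lra.
    - intros j Hj. apply pow4_le_root; auto; [apply Cmod_ge_0|]. apply (HB j). simpl. lia. }
  pose proof (harm_pow2 (S u)) as Hh. change (2 ^ S u)%nat with (2 * 2 ^ u)%nat in Hh. rewrite S_INR in Hh.
  pose proof (harm_mono 0 (2 * 2 ^ u) ltac:(lia)) as Hh0. change (harm 0) with 0 in Hh0.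
  pose proof (sqrt_pos (sqrt B4)) as PS. pose proof (pos_INR u) as Pu.
  apply Rle_trans with ((1500 * (3 + INR u) * (1 + sqrt (sqrt B4))) ^ 4).
  - apply pow_incr. split; [apply Cmod_ge_0|]. eapply Rle_trans; [exact Z|].
    apply Rmult_le_compat_r; [lra|]. apply Rmult_le_compat_l; lra.
  - rewrite !Rpow_mult_distr. apply Rmult_le_compat_l.
    + apply Rmult_le_pos; apply pow_le; lra.
    + pose proof (pow4_convex 1 (sqrt (sqrt B4))) as H. rewrite root_pow4 in H by auto.
      replace (1 ^ 4) with 1 in H by ring. exact H.
Qed.

Lemma zeta_half_line_sup zeta t u : is_riemann_zeta zeta -> (2 ^ u) ^ 2 <= t <= 4 * (2 ^ u) ^ 2 ->
  Cmod (zeta (crit t)) ^ 4 <= 10 ^ 19 * (3 + INR u) ^ 9 * (2 ^ u * sqrt (2 ^ u)).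
Proof.
  intros Hz Ht. pose proof (pos_INR u) as Pu. pose proof (pow_R1_Rle 2 u ltac:(lra)) as HU.
  assert (HsU : 1 <= sqrt (2 ^ u)) by (rewrite <- sqrt_1; apply sqrt_le_1_alt; lra).
  assert (HUU : 1 <= 2 ^ u * sqrt (2 ^ u)) by nra.
  assert (W0 : 0 <= weyl4 u) by (unfold weyl4; repeat apply Rmult_le_pos; lra).
  set (W := sqrt (sqrt (weyl4 u))). assert (PW : 0 <= W) by apply sqrt_pos.
  (* A prefix consists of full dyadic blocks and one truncated block, which is why [half_line_block]
     allows any length up to 2^i. *)
  assert (G : forall m j, (m <= 2 + u)%nat -> (j < 2 ^ m)%nat -> Cmod (dpoly (1 / 2) t 1 j) <= INR m * W).
  { induction m as [|m IH]; intros j Hm Hj.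
    - simpl in Hj. replace j with 0%nat by lia. unfold dpoly. simpl. rewrite Cmod_0. lra.
    - destruct (Nat.lt_ge_cases j (2 ^ m)) as [Hjm|Hjm].
      + specialize (IH j ltac:(lia) Hjm). rewrite S_INR. lra.
      + pose proof (Nat.pow_nonzero 2 m ltac:(lia)) as Hp. simpl in Hj.
        replace j with ((2 ^ m - 1) + (j - (2 ^ m - 1)))%nat by lia. rewrite dpoly_split.
        replace (1 + (2 ^ m - 1))%nat with (2 ^ m)%nat by lia.
        eapply Rle_trans; [apply Cmod_triangle|]. rewrite S_INR.
        specialize (IH (2 ^ m - 1)%nat ltac:(lia) ltac:(lia)).
        assert (Cmod (dpoly (1 / 2) t (2 ^ m) (j - (2 ^ m - 1))) <= W).
        { apply pow4_le_root; auto; [apply Cmod_ge_0|]. apply half_line_block; auto; lia. }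
        lra. }
  eapply Rle_trans; [apply (zeta_half_line_pow4 zeta t u ((2 + INR u) ^ 4 * weyl4 u)); auto|].
  - intros j Hj. replace ((2 + INR u) ^ 4 * weyl4 u) with (((2 + INR u) * W) ^ 4).
    + apply pow_incr. split; [apply Cmod_ge_0|].
      replace (2 + INR u) with (INR (2 + u)) by (rewrite plus_INR; simpl; ring).
      apply G; [lia|]. change (2 + u)%nat with (S (S u)). pose proof (Nat.pow_nonzero 2 (S u) ltac:(lia)).
      rewrite (Nat.pow_succ_r' 2 (S u)). lia.
    + rewrite Rpow_mult_distr. unfold W. rewrite root_pow4; auto.
  - unfold weyl4. set (V := 2 ^ u * sqrt (2 ^ u)) in *. set (x := 3 + INR u).
    assert (Hx : 3 <= x) by (unfold x; lra).
    assert (H1 : (2 + INR u) ^ 4 <= x ^ 4) by (apply pow_incr; unfold x; lra).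
    assert (P4 : 0 <= (2 + INR u) ^ 4) by (apply pow_le; lra).
    assert (P5 : 1 <= x ^ 5) by (apply pow_R1_Rle; lra).
    assert (H2 : (2 + INR u) ^ 4 * (10 ^ 5 * x * V) <= 10 ^ 5 * (x ^ 5 * V)).
    { replace (10 ^ 5 * (x ^ 5 * V)) with (x ^ 4 * (10 ^ 5 * x * V)) by ring.
      apply Rmult_le_compat_r; [repeat apply Rmult_le_pos; lra|exact H1]. }
    assert (H3 : 1 <= x ^ 5 * V) by nra.
    apply Rle_trans with (1500 ^ 4 * x ^ 4 * (8 * ((10 ^ 5 + 1) * (x ^ 5 * V)))).
    + apply Rmult_le_compat_l; [apply Rmult_le_pos; apply pow_le; lra|lra].
    + assert (0 <= x ^ 9 * V) by (apply Rmult_le_pos; [apply pow_le|]; lra).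
      replace (1500 ^ 4 * x ^ 4 * (8 * ((10 ^ 5 + 1) * (x ^ 5 * V)))) with (1500 ^ 4 * 8 * (10 ^ 5 + 1) * (x ^ 9 * V)) by ring.
      replace (10 ^ 19 * x ^ 9 * V) with (10 ^ 19 * (x ^ 9 * V)) by ring.
      apply Rmult_le_compat_r; lra.
Qed.

(** * The fourth moment on the critical line *)

(** Fourth powers summed over all nodes of the binary tree of dyadic subblocks, as in the
    Rademacher-Menshov inequality. It dominates every prefix at once and, unlike a maximum, is
    integrated term by term. *)
Fixpoint dyadic4 (t : R) (l a : nat) : R :=
  match l with
  | O => Cmod (dpoly (1 / 2) t a 1) ^ 4
  | S l => dyadic4 t l a + dyadic4 t l (a + 2 ^ l) + Cmod (dpoly (1 / 2) t a (2 ^ S l)) ^ 4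
  end.

(* For [n = l + 1] the first weight turns [(l + 1) ^ 3] into [(l + 2) ^ 3], so that an
   induction on the level [l] loses only a power of [l]. *)
Lemma pow4_weighted n x y : 0 < n -> (x + y) ^ 4 <= (1 + 1 / n) ^ 3 * x ^ 4 + (1 + n) ^ 3 * y ^ 4.
Proof.
  intros Hn.
  assert (G : forall x y, (x + y) ^ 2 <= (1 + 1 / n) * x ^ 2 + (1 + n) * y ^ 2).
  { intros a b. apply Rmult_le_reg_l with n; auto.
    replace (n * ((1 + 1 / n) * a ^ 2 + (1 + n) * b ^ 2)) with ((n + 1) * a ^ 2 + n * (1 + n) * b ^ 2) by (field; lra).
    pose proof (pow2_ge_0 (a - n * b)). nra. }
  assert (P : 0 < 1 / n) by (apply Rdiv_lt_0_compat; lra).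
  replace ((x + y) ^ 4) with (((x + y) ^ 2) ^ 2) by ring.
  apply Rle_trans with (((1 + 1 / n) * x ^ 2 + (1 + n) * y ^ 2) ^ 2).
  - apply pow_incr. split; [apply pow2_ge_0|apply G].
  - eapply Rle_trans; [apply G|]. apply Req_le. ring.
Qed.

Lemma dyadic4_nonneg t l a : 0 <= dyadic4 t l a.
Proof.
  revert a. induction l; intros a; cbn [dyadic4]; [apply pow_le, Cmod_ge_0|].
  pose proof (IHl a). pose proof (IHl (a + 2 ^ l)%nat).
  pose proof (pow_le (Cmod (dpoly (1 / 2) t a (2 ^ S l))) 4 (Cmod_ge_0 _)). lra.
Qed.

Lemma dyadic4_block t l a : Cmod (dpoly (1 / 2) t a (2 ^ l)) ^ 4 <= dyadic4 t l a.
Proof.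
  destruct l as [|l]; [apply Rle_refl|]. cbn [dyadic4].
  pose proof (dyadic4_nonneg t l a). pose proof (dyadic4_nonneg t l (a + 2 ^ l)). lra.
Qed.

Lemma dyadic4_prefix t l a j : (j <= 2 ^ l)%nat ->
  Cmod (dpoly (1 / 2) t a j) ^ 4 <= (1 + INR l) ^ 3 * dyadic4 t l a.
Proof.
  revert a j. induction l as [|l IH]; intros a j Hj.
  - simpl in Hj. destruct j as [|j].
    + unfold dpoly at 1. simpl csum. rewrite Cmod_0, pow_i by lia.
      apply Rmult_le_pos; [apply pow_le; simpl; lra|apply dyadic4_nonneg].
    + replace (S j) with 1%nat by lia. cbn [dyadic4]. replace ((1 + INR 0) ^ 3) with 1 by (simpl; ring). lra.
  - pose proof (pos_INR l) as Pl. rewrite S_INR. set (n := 1 + INR l). assert (Hn : 1 <= n) by (unfold n; lra).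
    replace (1 + (INR l + 1)) with (1 + n) by (unfold n; ring).
    pose proof (dyadic4_nonneg t l a) as P1. pose proof (dyadic4_nonneg t l (a + 2 ^ l)) as P2.
    pose proof (pow_le (Cmod (dpoly (1 / 2) t a (2 ^ S l))) 4 (Cmod_ge_0 _)) as P3.
    assert (Pn : 0 <= (1 + n) ^ 3) by (apply pow_le; lra).
    cbn [dyadic4].
    destruct (Nat.le_gt_cases j (2 ^ l)) as [Hjl|Hjl].
    + eapply Rle_trans; [apply IH, Hjl|]. fold n.
      assert (n ^ 3 <= (1 + n) ^ 3) by (apply pow_incr; lra). nra.
    + simpl in Hj. replace j with (2 ^ l + (j - 2 ^ l))%nat by lia. rewrite dpoly_split.
      set (A1 := dpoly (1 / 2) t a (2 ^ l)). set (A2 := dpoly (1 / 2) t (a + 2 ^ l) (j - 2 ^ l)).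
      pose proof (dyadic4_block t l a) as H1. fold A1 in H1.
      pose proof (IH (a + 2 ^ l)%nat (j - 2 ^ l)%nat ltac:(lia)) as H2. fold A2 n in H2.
      (* The recursive part [A2] comes first, to receive the weight close to 1; the complete left
         half [A1] is itself a node of the tree and can afford the large weight. *)
      apply Rle_trans with ((Cmod A2 + Cmod A1) ^ 4).
      { apply pow_incr. split; [apply Cmod_ge_0|]. rewrite (Rplus_comm (Cmod A2)). apply Cmod_triangle. }
      eapply Rle_trans; [apply (pow4_weighted n); lra|].
      assert (Q : (1 + 1 / n) ^ 3 * n ^ 3 = (1 + n) ^ 3) by (field; lra).
      assert (Q0 : 0 <= (1 + 1 / n) ^ 3) by (apply pow_le; assert (0 < 1 / n) by (apply Rdiv_lt_0_compat; lra); lra).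
      assert (Q1 : (1 + 1 / n) ^ 3 * Cmod A2 ^ 4 <= (1 + n) ^ 3 * dyadic4 t l (a + 2 ^ l)).
      { rewrite <- Q, Rmult_assoc. apply Rmult_le_compat_l; auto. }
      assert (Q2 : (1 + n) ^ 3 * Cmod A1 ^ 4 <= (1 + n) ^ 3 * dyadic4 t l a) by (apply Rmult_le_compat_l; auto).
      assert (0 <= (1 + n) ^ 3 * Cmod (dpoly (1 / 2) t a (2 ^ S l)) ^ 4) by (apply Rmult_le_pos; auto).
      lra.
Qed.

Lemma continuous_Cmod_dpoly sg a l k t : continuous (fun t => Cmod (dpoly sg t a l) ^ k) t.
Proof. apply continuous_pow. apply Ccontinuous_Cmod. apply dpoly_continuous. Qed.

Lemma continuous_dyadic4 l a t : continuous (fun t => dyadic4 t l a) t.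
Proof.
  revert a. induction l; intros a.
  - apply continuous_Cmod_dpoly.
  - apply (continuous_plus (V := R_NormedModule)); [apply (continuous_plus (V := R_NormedModule)); auto|].
    apply continuous_Cmod_dpoly.
Qed.

Lemma ex_RInt_cont (f : R -> R) a b : (forall t, continuous f t) -> ex_RInt f a b.
Proof. intros H. apply (@ex_RInt_continuous R_CompleteNormedModule). auto. Qed.

Lemma RInt_Rplus (f g : R -> R) a b : ex_RInt f a b -> ex_RInt g a b ->
  RInt (fun t => f t + g t) a b = RInt f a b + RInt g a b.
Proof. intros Hf Hg. exact (RInt_plus (V := R_CompleteNormedModule) f g a b Hf Hg). Qed.

Lemma RInt_Rscal c (f : R -> R) a b : ex_RInt f a b ->
  RInt (fun t => c * f t) a b = c * RInt f a b.
Proof. intros Hf. exact (RInt_scal (V := R_CompleteNormedModule) f a b c Hf). Qed.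

Lemma exp_inv_ln x : 0 < x -> exp (- (2 * (1 / 2)) * ln x) = / x.
Proof.
  intros Hx. replace (- (2 * (1 / 2)) * ln x) with (- ln x) by field. rewrite exp_Ropp, exp_ln; auto.
Qed.

(** On each of the l + 1 levels the squares of the block sums of 1/n add up to at most the square of
    their total, so every level costs no more than the undivided block. *)
Lemma dyadic4_integral N E T1 T2 : T1 <= T2 -> 1 <= E ->
  (forall m l, (1 <= m <= N ^ 2)%nat -> NoDup l -> (forall a, In a l -> Nat.divide a m) -> INR (length l) <= E) ->
  forall l a, (1 <= a)%nat -> (a + 2 ^ l <= S N)%nat ->
  RInt (fun t => dyadic4 t l a) T1 T2
  <= E ^ 2 * (T2 - T1 + 8 * INR (N ^ 2) * harm (N ^ 2)) * (1 + INR l)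
     * rsum (fun i => / INR (a + i)) (2 ^ l) ^ 2.
Proof.
  intros HT HE Hdiv. set (G := E ^ 2 * (T2 - T1 + 8 * INR (N ^ 2) * harm (N ^ 2))).
  assert (HG : 0 <= G).
  { unfold G. apply Rmult_le_pos; [apply pow2_ge_0|]. pose proof (pos_INR (N ^ 2)).
    pose proof (harm_mono 0 (N ^ 2) ltac:(lia)) as H0. change (harm 0) with 0 in H0.
    assert (0 <= INR (N ^ 2) * harm (N ^ 2)) by (apply Rmult_le_pos; auto). lra. }
  assert (Block : forall l a, (1 <= a)%nat -> (a + l <= S N)%nat ->
     RInt (fun t => Cmod (dpoly (1 / 2) t a l) ^ 4) T1 T2 <= G * rsum (fun i => / INR (a + i)) l ^ 2).
  { intros l a Ha Hl. pose proof (moment_bound (1 / 2) a l 2 N E T1 T2 Ha Hl HT HE Hdiv) as H.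
    fold G in H.
    rewrite (rsum_ext (fun i => exp (- (2 * (1 / 2)) * ln (INR (a + i)))) (fun i => / INR (a + i))) in H; [exact H|].
    intros i _. apply exp_inv_ln, lt_0_INR. lia. }
  assert (Snn : forall a n, (1 <= a)%nat -> 0 <= rsum (fun i => / INR (a + i)) n).
  { intros a n Ha. apply rsum_nonneg. intros i _. left. apply Rinv_0_lt_compat, lt_0_INR. lia. }
  induction l as [|l IH]; intros a Ha Hl.
  - cbn [dyadic4]. change (2 ^ 0)%nat with 1%nat. eapply Rle_trans; [apply Block; auto|].
    simpl INR at 2. rewrite Rplus_0_r, Rmult_1_r. apply Rle_refl.
  - cbn [dyadic4]. simpl in Hl.
    assert (Exd : forall b, ex_RInt (fun t => dyadic4 t l b) T1 T2)
      by (intros b; apply ex_RInt_cont; intros t; apply continuous_dyadic4).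
    rewrite (RInt_Rplus (fun t => dyadic4 t l a + dyadic4 t l (a + 2 ^ l))
        (fun t => Cmod (dpoly (1 / 2) t a (2 ^ S l)) ^ 4)),
      (RInt_Rplus (fun t => dyadic4 t l a) (fun t => dyadic4 t l (a + 2 ^ l))); auto.
    2: apply (ex_RInt_plus (V := R_NormedModule)); auto.
    2: apply ex_RInt_cont; intros t; apply continuous_Cmod_dpoly.
    pose proof (IH a Ha ltac:(lia)) as B1. pose proof (IH (a + 2 ^ l)%nat ltac:(lia) ltac:(lia)) as B2.
    pose proof (Block (2 ^ S l)%nat a Ha ltac:(simpl; lia)) as B3.
    assert (ES : rsum (fun i => / INR (a + i)) (2 ^ S l)
      = rsum (fun i => / INR (a + i)) (2 ^ l) + rsum (fun i => / INR (a + 2 ^ l + i)) (2 ^ l)).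
    { replace (2 ^ S l)%nat with (2 ^ l + 2 ^ l)%nat by (simpl; lia). rewrite rsum_split. f_equal.
      apply rsum_ext. intros i _. now rewrite Nat.add_assoc. }
    rewrite ES in B3 |- *. rewrite S_INR.
    pose proof (Snn a (2 ^ l)%nat Ha) as P1. pose proof (Snn (a + 2 ^ l)%nat (2 ^ l)%nat ltac:(lia)) as P2.
    set (s1 := rsum (fun i => / INR (a + i)) (2 ^ l)) in *.
    set (s2 := rsum (fun i => / INR (a + 2 ^ l + i)) (2 ^ l)) in *.
    pose proof (pos_INR l) as Pl. set (c := G * (1 + INR l)) in *.
    assert (Hc : 0 <= c) by (unfold c; apply Rmult_le_pos; lra).
    replace (G * (1 + (INR l + 1)) * (s1 + s2) ^ 2) with (c * (s1 + s2) ^ 2 + G * (s1 + s2) ^ 2) by (unfold c; ring).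
    assert (c * s1 ^ 2 + c * s2 ^ 2 <= c * (s1 + s2) ^ 2).
    { assert (0 <= c * (s1 * s2)) by (apply Rmult_le_pos; auto; apply Rmult_le_pos; auto). nra. }
    lra.
Qed.

(** * Powers of two with real exponents, and absorption of logarithms *)

Notation P2 := (Rpower 2).

Lemma P2_pos x : 0 < P2 x.
Proof. apply exp_pos. Qed.

Lemma P2_plus x y : P2 (x + y) = P2 x * P2 y.
Proof. apply Rpower_plus. Qed.

Lemma P2_le x y : x <= y -> P2 x <= P2 y.
Proof. intros H. apply Rle_Rpower; lra. Qed.

Lemma P2_ge_1 x : 0 <= x -> 1 <= P2 x.
Proof. intros H. rewrite <- (Rpower_O 2) by lra. apply P2_le, H. Qed.

Lemma P2_INR n : P2 (INR n) = 2 ^ n.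
Proof. apply Rpower_pow. lra. Qed.

Lemma ln2_pos : 0 < ln 2.
Proof. rewrite <- ln_1. apply ln_increasing; lra. Qed.

(** As u has the size of log T, this says that powers of log T are O(T^eps). Each induction step
    spends half of the exponent [d]. *)
Lemma absorb_poly m : forall d, 0 < d -> exists K, 0 < K /\ forall u, (3 + INR u) ^ m <= K * P2 (d * INR u).
Proof.
  induction m as [|m IH]; intros d Hd.
  - exists 1. split; [lra|]. intros u. rewrite Rmult_1_l. simpl. apply P2_ge_1.
    apply Rmult_le_pos; [lra|apply pos_INR].
  - destruct (IH (d / 2) ltac:(lra)) as [K [HK H]]. pose proof ln2_pos as L2.
    assert (Hdl : 0 < d / 2 * ln 2) by (apply Rmult_lt_0_compat; lra).
    exists ((3 + / (d / 2 * ln 2)) * K). split.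
    { apply Rmult_lt_0_compat; auto. assert (0 < / (d / 2 * ln 2)) by (apply Rinv_0_lt_compat; lra). lra. }
    intros u. pose proof (pos_INR u) as Pu. specialize (H u).
    assert (H1 : 3 + INR u <= (3 + / (d / 2 * ln 2)) * P2 (d / 2 * INR u)).
    { assert (E : 1 + d / 2 * INR u * ln 2 <= P2 (d / 2 * INR u)) by apply exp_ineq1_le.
      set (q := d / 2 * ln 2) in *. assert (Pq : 0 < / q) by (apply Rinv_0_lt_compat; lra).
      apply Rle_trans with ((3 + / q) * (1 + q * INR u)).
      - replace ((3 + / q) * (1 + q * INR u)) with (3 + INR u + (/ q + 3 * (q * INR u))) by (field; lra).
        assert (0 <= q * INR u) by (apply Rmult_le_pos; lra). lra.
      - apply Rmult_le_compat_l; [lra|]. eapply Rle_trans; [|exact E]. apply Req_le. unfold q. ring. }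
    replace (d * INR u) with (d / 2 * INR u + d / 2 * INR u) by field. rewrite P2_plus.
    simpl. apply Rle_trans with (((3 + / (d / 2 * ln 2)) * P2 (d / 2 * INR u)) * (K * P2 (d / 2 * INR u))).
    + apply Rmult_le_compat; auto; [lra|apply pow_le; lra].
    + apply Req_le. ring.
Qed.

Lemma divisor_bound_pow2 d : 0 < d -> exists K, 1 <= K /\ forall n m l, (1 <= m <= 2 ^ n)%nat ->
  NoDup l -> (forall a, In a l -> Nat.divide a m) -> INR (length l) <= K * P2 (d * INR n).
Proof.
  intros Hd. destruct (divisor_bound d Hd) as [K [HK H]]. exists (1 + K). split; [lra|].
  intros n m l Hm Hl Hdiv. eapply Rle_trans; [apply (H m l); auto; lia|].
  assert (Hmn : Rpower (INR m) d <= P2 (d * INR n)).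
  { assert (1 <= INR m) by (apply (le_INR 1); lia).
    assert (INR m <= 2 ^ n) by (rewrite <- INR_pow2; apply le_INR; lia).
    replace (P2 (d * INR n)) with (Rpower (2 ^ n) d).
    - apply Rle_Rpower_l; lra.
    - rewrite <- P2_INR, Rpower_mult. f_equal. ring. }
  pose proof (P2_pos (d * INR n)). assert (0 < Rpower (INR m) d) by apply exp_pos. nra.
Qed.

(** A continuous majorant of |zeta(1/2+it)|^4 on the dyadic range, with the largest prefix replaced
    by the tree sum. *)
Definition majorant4 (u : nat) (t : R) : R :=
  1500 ^ 4 * (3 + INR u) ^ 4 * (8 * (1 + (3 + INR u) ^ 3 * dyadic4 t (S u) 1)).

Lemma majorant4_nonneg u t : 0 <= majorant4 u t.
Proof.
  unfold majorant4. pose proof (dyadic4_nonneg t (S u) 1). pose proof (pos_INR u).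
  assert (0 <= (3 + INR u) ^ 3) by (apply pow_le; lra). assert (0 <= (3 + INR u) ^ 4) by (apply pow_le; lra).
  assert (0 <= (3 + INR u) ^ 3 * dyadic4 t (S u) 1) by (apply Rmult_le_pos; auto).
  repeat apply Rmult_le_pos; try lra.
Qed.

Lemma continuous_Rscal c (f : R -> R) t : continuous f t -> continuous (fun t => c * f t) t.
Proof. intros H. exact (continuous_scal_r (V := R_NormedModule) c f t H). Qed.

Lemma continuous_Rplus (f g : R -> R) t : continuous f t -> continuous g t ->
  continuous (fun t => f t + g t) t.
Proof. intros Hf Hg. exact (continuous_plus (V := R_NormedModule) f g t Hf Hg). Qed.

Lemma continuous_majorant4 u t : continuous (majorant4 u) t.
Proof.
  unfold majorant4. apply continuous_Rscal, continuous_Rscal, continuous_Rplus; [apply continuous_const|].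
  apply continuous_Rscal, continuous_dyadic4.
Qed.

Lemma zeta_majorant4 zeta u t : is_riemann_zeta zeta -> (2 ^ u) ^ 2 <= t <= 4 * (2 ^ u) ^ 2 ->
  Cmod (zeta (crit t)) ^ 4 <= majorant4 u t.
Proof.
  intros Hz Ht. apply zeta_half_line_pow4; auto. intros j Hj.
  eapply Rle_trans; [apply (dyadic4_prefix t (S u)), Hj|].
  apply Rmult_le_compat_r; [apply dyadic4_nonneg|]. rewrite S_INR. pose proof (pos_INR u). apply pow_incr. lra.
Qed.

Lemma sqr_pow2 u : (2 ^ u) ^ 2 = P2 (2 * INR u).
Proof. rewrite <- pow_mult, <- P2_INR, mult_INR. f_equal. simpl. ring. Qed.

Lemma majorant4_integral d : 0 < d -> exists K, 0 < K /\ forall u,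
  RInt (majorant4 u) ((2 ^ u) ^ 2) (4 * (2 ^ u) ^ 2) <= K * P2 ((2 + d) * INR u).
Proof.
  intros Hd. destruct (divisor_bound_pow2 (d / 8) ltac:(lra)) as [Kd [HKd Hdiv]].
  (* 11 = 4 + 3 + 4: from the bound by partial sums, from the passage to [dyadic4], and from its
     integral. The other d / 2 goes to the divisor bound, E^2 with exponent d / 8 at (2 U)^2. *)
  destruct (absorb_poly 11 (d / 2) ltac:(lra)) as [Kp [HKp Hpoly]].
  set (c := P2 (d / 8 * 2)).
  exists (1500 ^ 4 * 8 * (3 + 70 * Kd ^ 2 * c ^ 2) * Kp).
  assert (Hc : 1 <= c) by (apply P2_ge_1; lra).
  assert (HKc : 0 <= Kd ^ 2 * c ^ 2) by (apply Rmult_le_pos; apply pow2_ge_0).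
  split. { repeat apply Rmult_lt_0_compat; try lra. }
  intros u. pose proof (pos_INR u) as Pu. set (U2 := (2 ^ u) ^ 2).
  assert (HU2 : 1 <= U2) by (unfold U2; rewrite <- pow_mult; apply pow_R1_Rle; lra).
  unfold majorant4. set (x := 3 + INR u) in *. assert (Hx : 3 <= x) by (unfold x; lra).
  rewrite RInt_Rscal, RInt_Rscal, RInt_Rplus, RInt_Rscal, RInt_const; try (apply ex_RInt_cont; intros t).
  2: apply continuous_dyadic4.
  2: apply continuous_const.
  2: apply continuous_Rscal, continuous_dyadic4.
  2: apply continuous_Rplus; [apply continuous_const|apply continuous_Rscal, continuous_dyadic4].
  2: apply continuous_Rscal, continuous_Rplus; [apply continuous_const|apply continuous_Rscal, continuous_dyadic4].
  unfold scal; simpl (scal _ _); unfold mult; simpl (mult _ _).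
  set (E := Kd * P2 (d / 8 * INR (2 * u + 2))).
  assert (HE : 1 <= E).
  { unfold E. pose proof (P2_ge_1 (d / 8 * INR (2 * u + 2)) ltac:(apply Rmult_le_pos; [lra|apply pos_INR])). nra. }
  pose proof (dyadic4_integral (2 ^ S u) E U2 (4 * U2) ltac:(lra) HE) as HQ.
  assert (EN : ((2 ^ S u) ^ 2 = 2 ^ (2 * u + 2))%nat).
  { rewrite <- Nat.pow_mul_r. f_equal. lia. }
  rewrite EN in HQ. specialize (HQ (fun m l => Hdiv (2 * u + 2)%nat m l) (S u) 1%nat (le_n _) ltac:(lia)).
  rewrite S_INR in HQ. rewrite INR_pow2 in HQ.
  pose proof (harm_pow2 (2 * u + 2)) as H1. rewrite plus_INR, mult_INR in H1. simpl (INR 2) in H1.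
  pose proof (harm_pow2 (S u)) as H2. rewrite S_INR in H2.
  pose proof (harm_mono 0 (2 ^ (2 * u + 2)) ltac:(lia)) as H10. change (harm 0) with 0 in H10.
  pose proof (harm_mono 0 (2 ^ S u) ltac:(lia)) as H20. change (harm 0) with 0 in H20.
  change (rsum (fun i => / INR (1 + i)) (2 ^ S u)) with (harm (2 ^ S u)) in HQ.
  set (h1 := harm (2 ^ (2 * u + 2))) in *. set (h2 := harm (2 ^ S u)) in *.
  assert (E2 : 2 ^ (2 * u + 2) = 4 * U2).
  { unfold U2. rewrite pow_add, <- pow_mult. replace (2 * u)%nat with (u * 2)%nat by lia. ring. }
  rewrite E2 in HQ.
  assert (HQ2 : RInt (fun t => dyadic4 t (S u) 1) U2 (4 * U2) <= 70 * E ^ 2 * U2 * x ^ 4).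
  { eapply Rle_trans; [exact HQ|].
    assert (PE : 0 <= E ^ 2) by apply pow2_ge_0.
    assert (A1 : 4 * U2 - U2 + 8 * (4 * U2) * h1 <= 67 * U2 * x).
    { assert (U2 * h1 <= U2 * (2 * x)) by (apply Rmult_le_compat_l; unfold x; lra).
      assert (U2 * 3 <= U2 * x) by (apply Rmult_le_compat_l; lra). lra. }
    assert (A2 : h2 ^ 2 <= x ^ 2) by (apply pow_incr; unfold x; lra).
    apply Rle_trans with (E ^ 2 * (67 * U2 * x) * x * x ^ 2).
    - assert (A0 : 0 <= U2 * h1) by (apply Rmult_le_pos; [lra|exact H10]).
      assert (A3 : 0 <= 4 * U2 - U2 + 8 * (4 * U2) * h1) by lra.
      assert (A4 : 0 <= E ^ 2 * (4 * U2 - U2 + 8 * (4 * U2) * h1)) by (apply Rmult_le_pos; assumption).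
      apply Rmult_le_compat; [apply Rmult_le_pos; [exact A4|lra]|apply pow2_ge_0| |exact A2].
      apply Rmult_le_compat; [exact A4|lra| |unfold x; lra].
      apply Rmult_le_compat_l; assumption.
    - assert (0 <= E ^ 2 * U2 * x ^ 4) by (apply Rmult_le_pos; [apply Rmult_le_pos; [exact PE|lra]|apply pow_le; lra]).
      replace (E ^ 2 * (67 * U2 * x) * x * x ^ 2) with (67 * (E ^ 2 * U2 * x ^ 4)) by ring. lra. }
  assert (EE : E ^ 2 = Kd ^ 2 * c ^ 2 * P2 (d / 2 * INR u)).
  { unfold E, c.
    replace (d / 8 * INR (2 * u + 2)) with (d / 4 * INR u + d / 8 * 2)
      by (rewrite plus_INR, mult_INR; simpl (INR 2); field).
    rewrite P2_plus. replace (d / 2 * INR u) with (d / 4 * INR u + d / 4 * INR u) by field.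
    rewrite (P2_plus (d / 4 * INR u)). ring. }
  set (p := P2 (d / 2 * INR u)) in *. assert (Hp : 1 <= p) by (apply P2_ge_1; apply Rmult_le_pos; lra).
  assert (X4 : 0 <= x ^ 4) by (apply pow_le; lra). assert (X3 : 0 <= x ^ 3) by (apply pow_le; lra).
  assert (X7 : 1 <= x ^ 7) by (apply pow_R1_Rle; lra). assert (X11 : x ^ 4 <= x ^ 11) by (apply Rle_pow; [lra|lia]).
  specialize (Hpoly u). fold x p in Hpoly.
  rewrite Rmult_1_r.
  apply Rle_trans with (1500 ^ 4 * x ^ 4 * (8 * ((3 + 70 * Kd ^ 2 * c ^ 2) * (U2 * p * x ^ 7)))).
  - apply Rmult_le_compat_l; [apply Rmult_le_pos; auto; apply pow_le; lra|].
    apply Rmult_le_compat_l; [lra|].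
    assert (B1 : x ^ 3 * RInt (fun t => dyadic4 t (S u) 1) U2 (4 * U2) <= 70 * Kd ^ 2 * c ^ 2 * (U2 * p * x ^ 7)).
    { apply Rle_trans with (x ^ 3 * (70 * E ^ 2 * U2 * x ^ 4)); [apply Rmult_le_compat_l; auto|].
      rewrite EE. apply Req_le. ring. }
    assert (B2 : U2 <= U2 * p * x ^ 7).
    { rewrite <- (Rmult_1_r U2) at 1. rewrite Rmult_assoc. apply Rmult_le_compat_l; [lra|]. nra. }
    lra.
  - replace (P2 ((2 + d) * INR u)) with (U2 * p * p).
    2:{ unfold U2, p. rewrite sqr_pow2, <- !P2_plus. f_equal. field. }
    replace (1500 ^ 4 * x ^ 4 * (8 * ((3 + 70 * Kd ^ 2 * c ^ 2) * (U2 * p * x ^ 7))))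
      with ((1500 ^ 4 * 8 * (3 + 70 * Kd ^ 2 * c ^ 2)) * (U2 * p) * x ^ 11) by ring.
    replace (1500 ^ 4 * 8 * (3 + 70 * Kd ^ 2 * c ^ 2) * Kp * (U2 * p * p))
      with ((1500 ^ 4 * 8 * (3 + 70 * Kd ^ 2 * c ^ 2)) * (U2 * p) * (Kp * p)) by ring.
    apply Rmult_le_compat_l; auto.
    apply Rmult_le_pos; [|apply Rmult_le_pos; lra].
    apply Rmult_le_pos; [apply Rmult_le_pos; [apply pow_le|]; lra|].
    replace (70 * Kd ^ 2 * c ^ 2) with (70 * (Kd ^ 2 * c ^ 2)) by ring. lra.
Qed.

(* [apply Rmult_le_pos] alone would unfold numeral powers into products. *)
Ltac split_mult := repeat match goal with
  | |- 0 <= _ * _ => apply Rmult_le_pos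
  | |- 0 < _ * _ => apply Rmult_lt_0_compat
  end.

(** * The eighth-degree moment *)

Lemma exp_ln_pow2 a i : exp (a * ln (INR (2 ^ i))) = P2 (a * INR i).
Proof. rewrite INR_pow2, ln_pow by lra. unfold Rpower. f_equal. ring. Qed.

Lemma Cmod_xpow_pow2_le sg t i k : 0 <= sg -> Cmod (xpow (sg, t) (INR (2 ^ i + k))) <= P2 (- sg * INR i).
Proof.
  intros Hs. rewrite Cmod_xpow. simpl fst. rewrite <- exp_ln_pow2.
  assert (H : ln (INR (2 ^ i)) <= ln (INR (2 ^ i + k))).
  { apply ln_le; [apply lt_0_INR; pose proof (Nat.pow_nonzero 2 i); lia|apply le_INR; lia]. }
  destruct (Rle_lt_or_eq_dec (- sg * ln (INR (2 ^ i + k))) (- sg * ln (INR (2 ^ i)))) as [G|G]; [nra|..].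
  - left. now apply exp_increasing. - rewrite G. lra.
Qed.

Lemma large_block sg k d : 309 / 320 < sg -> (1 <= k)%nat -> 0 < d ->
  exists K, 0 < K /\ forall u i, (2 * u <= i * k <= 6 * u)%nat ->
  RInt (fun t => Cmod (dpoly sg t (2 ^ i) (2 ^ i)) ^ (2 * k)) ((2 ^ u) ^ 2) (4 * (2 ^ u) ^ 2)
  <= K * P2 ((132 / 320 + d) * INR u).
Proof.
  intros Hsg Hk Hd. assert (Pk : 1 <= INR k) by (apply (le_INR 1); auto).
  (* The multiplicity bound E^k has exponent del * (i + 1) k * k = d / 12 * (i k + k), at most d u /
     2 plus a constant because i k <= 6 u. *)
  set (del := d / (12 * INR k)). assert (Hdel : 0 < del) by (apply Rdiv_lt_0_compat; lra).
  destruct (divisor_bound_pow2 del Hdel) as [Kd [HKd Hdiv]].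
  destruct (absorb_poly 1 (d / 2) ltac:(lra)) as [Kp [HKp Hpoly]].
  set (ck := P2 (d / 12 * INR k)). assert (Hck : 1 <= ck) by (apply P2_ge_1; apply Rmult_le_pos; lra).
  set (K1 := Kd ^ k * ck * (11 * 2 ^ k * (6 + INR k) * Kp)).
  assert (P2k : 1 <= 2 ^ k) by (apply pow_R1_Rle; lra).
  assert (HKdk : 1 <= Kd ^ k) by (apply pow_R1_Rle; lra).
  exists K1. split; [unfold K1; repeat apply Rmult_lt_0_compat; lra|].
  intros u i Hik. pose proof (pos_INR u) as Pu. pose proof (pos_INR i) as Pi.
  set (U2 := (2 ^ u) ^ 2).
  assert (HU2 : 1 <= U2) by (unfold U2; rewrite <- pow_mult; apply pow_R1_Rle; lra).
  set (E := Kd * P2 (del * INR (S i * k))).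
  assert (HE : 1 <= E).
  { unfold E. pose proof (P2_ge_1 (del * INR (S i * k)) ltac:(apply Rmult_le_pos; [lra|apply pos_INR])). nra. }
  assert (Hi1 : (1 <= 2 ^ i)%nat) by (pose proof (Nat.pow_nonzero 2 i); lia).
  pose proof (moment_bound sg (2 ^ i) (2 ^ i) k (2 ^ S i) E U2 (4 * U2) Hi1 ltac:(simpl; lia) ltac:(lra) HE) as HQ.
  rewrite <- Nat.pow_mul_r in HQ. specialize (HQ (fun m l => Hdiv (S i * k)%nat m l)).
  eapply Rle_trans; [exact HQ|].
  assert (Rik : INR i * INR k <= 6 * INR u).
  { rewrite <- mult_INR. replace (6 * INR u) with (INR (6 * u)) by (rewrite mult_INR; simpl; ring). apply le_INR. lia. }
  assert (Pik : 0 <= INR i * INR k) by (apply Rmult_le_pos; lra).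
  assert (ESik : INR (S i * k) = INR i * INR k + INR k) by (rewrite mult_INR, S_INR; ring).
  assert (B1 : E ^ k <= Kd ^ k * ck * P2 (d / 2 * INR u)).
  { unfold E. rewrite Rpow_mult_distr, Rmult_assoc. apply Rmult_le_compat_l; [lra|].
    rewrite <- Rpower_pow by apply P2_pos. rewrite Rpower_mult. unfold ck. rewrite <- P2_plus. apply P2_le.
    rewrite ESik. replace (del * (INR i * INR k + INR k) * INR k) with (d / 12 * (INR i * INR k + INR k))
      by (unfold del; field; lra).
    assert (d / 12 * (INR i * INR k) <= d / 12 * (6 * INR u)) by (apply Rmult_le_compat_l; lra). lra. }
  set (X := 2 ^ (i * k)).
  assert (HX : U2 <= X) by (unfold U2, X; rewrite <- pow_mult; apply Rle_pow; [lra|lia]).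
  assert (EN : INR (2 ^ (S i * k)) = X * 2 ^ k).
  { rewrite INR_pow2. unfold X. rewrite <- pow_add. f_equal. lia. }
  specialize (Hpoly u). rewrite pow_1 in Hpoly.
  set (p := P2 (d / 2 * INR u)) in *. assert (Hp : 1 <= p) by (apply P2_ge_1; apply Rmult_le_pos; lra).
  assert (B2 : 4 * U2 - U2 + 8 * INR (2 ^ (S i * k)) * harm (2 ^ (S i * k)) <= X * (11 * 2 ^ k * (6 + INR k) * Kp * p)).
  { pose proof (harm_pow2 (S i * k)) as Hh. rewrite ESik in Hh. rewrite EN.
    assert (Hh2 : harm (2 ^ (S i * k)) <= (6 + INR k) * (3 + INR u)).
    { assert (0 <= INR k * INR u) by (apply Rmult_le_pos; lra). lra. }
    assert (PX : 0 < X * 2 ^ k) by (apply Rmult_lt_0_compat; lra).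
    apply Rle_trans with (11 * (X * 2 ^ k) * ((6 + INR k) * (3 + INR u))).
    - assert (Q1 : X * 2 ^ k * harm (2 ^ (S i * k)) <= X * 2 ^ k * ((6 + INR k) * (3 + INR u))) by (apply Rmult_le_compat_l; lra).
      assert (Q2 : X <= X * 2 ^ k) by nra.
      assert (Q3 : 1 <= (6 + INR k) * (3 + INR u)) by nra.
      assert (Q4 : X * 2 ^ k * 1 <= X * 2 ^ k * ((6 + INR k) * (3 + INR u))) by (apply Rmult_le_compat_l; lra).
      lra.
    - replace (X * (11 * 2 ^ k * (6 + INR k) * Kp * p)) with (11 * (X * 2 ^ k) * ((6 + INR k) * (Kp * p))) by ring.
      apply Rmult_le_compat_l; [lra|]. apply Rmult_le_compat_l; lra. }
  assert (B3 : rsum (fun j => exp (- (2 * sg) * ln (INR (2 ^ i + j)))) (2 ^ i) <= P2 ((1 - 2 * sg) * INR i)).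
  { apply Rle_trans with (rsum (fun _ => P2 (- (2 * sg) * INR i)) (2 ^ i)).
    - apply rsum_le. intros j _.
      pose proof (Cmod_xpow_pow2_le (2 * sg) 0 i j ltac:(lra)) as H. rewrite Cmod_xpow in H. exact H.
    - rewrite rsum_const, INR_pow2, <- P2_INR, <- P2_plus. apply P2_le. lra. }
  assert (P3 : 0 <= rsum (fun j => exp (- (2 * sg) * ln (INR (2 ^ i + j)))) (2 ^ i)).
  { apply rsum_nonneg. intros j _. left. apply exp_pos. }
  (* The exponent is i k (2 - 2 sg), with i k <= 6 u and 2 - 2 * 309 / 320 = 22 / 320; so 132 = 6 *
     22. *)
  assert (B4 : X * rsum (fun j => exp (- (2 * sg) * ln (INR (2 ^ i + j)))) (2 ^ i) ^ k <= P2 (132 / 320 * INR u)).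
  { apply Rle_trans with (X * P2 ((1 - 2 * sg) * INR i) ^ k).
    - apply Rmult_le_compat_l; [lra|]. apply pow_incr. auto.
    - unfold X. rewrite <- P2_INR, <- Rpower_pow by apply P2_pos. rewrite Rpower_mult, <- P2_plus, mult_INR.
      apply P2_le. replace (INR i * INR k + (1 - 2 * sg) * INR i * INR k) with ((INR i * INR k) * (2 - 2 * sg)) by ring.
      assert (INR i * INR k * (2 - 2 * sg) <= INR i * INR k * (22 / 320)) by (apply Rmult_le_compat_l; lra). lra. }
  set (R3 := rsum (fun j => exp (- (2 * sg) * ln (INR (2 ^ i + j)))) (2 ^ i) ^ k) in *.
  assert (PR3 : 0 <= R3) by (apply pow_le; auto).
  assert (PE : 0 <= E ^ k) by (apply pow_le; lra).
  apply Rle_trans with ((Kd ^ k * ck * p) * (X * (11 * 2 ^ k * (6 + INR k) * Kp * p)) * R3).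
  - apply Rmult_le_compat_r; auto. apply Rmult_le_compat; auto.
    assert (0 <= INR (2 ^ (S i * k)) * harm (2 ^ (S i * k))).
    { apply Rmult_le_pos; [apply pos_INR|apply (harm_mono 0); lia]. }
    lra.
  - replace (Kd ^ k * ck * p * (X * (11 * 2 ^ k * (6 + INR k) * Kp * p)) * R3)
      with (K1 * (p * p) * (X * R3)) by (unfold K1; ring).
    replace ((132 / 320 + d) * INR u) with ((d / 2 * INR u + d / 2 * INR u) + 132 / 320 * INR u) by field.
    rewrite P2_plus, P2_plus. fold p. rewrite (Rmult_assoc K1).
    assert (0 <= p * p) by nra. assert (0 < K1) by (unfold K1; repeat apply Rmult_lt_0_compat; lra).
    apply Rmult_le_compat_l; [lra|]. apply Rmult_le_compat_l; [lra|exact B4].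
Qed.

(** [large_block] has a constant depending on k; the exponent changes with the block, so a common
    constant for all k <= q is collected here. *)
Lemma large_blocks sg q d : 309 / 320 < sg -> 0 < d ->
  exists K, 0 < K /\ forall k u i, (1 <= k <= q)%nat -> (2 * u <= i * k <= 6 * u)%nat ->
  RInt (fun t => Cmod (dpoly sg t (2 ^ i) (2 ^ i)) ^ (2 * k)) ((2 ^ u) ^ 2) (4 * (2 ^ u) ^ 2)
  <= K * P2 ((132 / 320 + d) * INR u).
Proof.
  intros Hsg Hd. induction q as [|q [K [HK H]]].
  - exists 1. split; [lra|]. intros k u i Hk. lia.
  - destruct (large_block sg (S q) d Hsg ltac:(lia) Hd) as [K' [HK' H']].
    exists (K + K'). split; [lra|]. intros k u i Hk Hik. pose proof (P2_pos ((132 / 320 + d) * INR u)).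
    destruct (Nat.le_gt_cases k q) as [Hkq|Hkq].
    + eapply Rle_trans; [apply H; auto; lia|]. nra.
    + replace k with (S q) in * by lia. eapply Rle_trans; [apply H'; auto|]. nra.
Qed.

(* Least power, but at least 2, for which [(2 ^ i) ^ k] reaches [T = 4 ^ u]. *)
Definition expo (u i : nat) : nat := Nat.max 2 ((2 * u + i - 1) / i).

(** For k = 2, i < 3 u gives 2 i <= 6 u. For k >= 3 minimality gives i (k - 1) < 2 u, so i < u and i
    k <= 3 u. The lower bound on i keeps k <= 2 q, whatever u is. *)
Lemma expo_spec q u i : (1 <= q)%nat -> (u < i * q)%nat -> (i < 3 * u)%nat ->
  (2 * u <= i * expo u i <= 6 * u)%nat /\ (2 <= expo u i <= 2 * q)%nat.
Proof.
  intros Hq Hui Hi. assert (Hi0 : (1 <= i)%nat) by (destruct i; lia).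
  unfold expo. set (c := ((2 * u + i - 1) / i)%nat).
  pose proof (Nat.div_mod_eq (2 * u + i - 1) i) as E. fold c in E.
  pose proof (Nat.mod_upper_bound (2 * u + i - 1) i ltac:(lia)) as Em.
  set (r := ((2 * u + i - 1) mod i)%nat) in *.
  assert (H1 : (2 * u <= i * c)%nat) by lia. assert (H2 : (i * c <= 2 * u + i - 1)%nat) by lia.
  assert (Hc : (c <= 2 * q)%nat).
  { apply Nat.lt_succ_r. apply (Nat.mul_lt_mono_pos_l i); [lia|]. nia. }
  destruct (Nat.le_gt_cases c 2) as [H3|H3].
  - rewrite Nat.max_l by auto. nia.
  - rewrite Nat.max_r by lia. split; [|lia]. split; [auto|]. nia.
Qed.

(* For [i q <= u] the trivial bound [2 ^ (u / q)] suffices; elsewhere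
   [x ^ 4 <= 1 + x ^ (2 k)] with [k = expo u i >= 2]. *)
Definition big_part (sg : R) (q u i : nat) (t : R) : R :=
  if Nat.leb (i * q) u then 0 else Cmod (dpoly sg t (2 ^ i) (2 ^ i)) ^ (2 * expo u i).

Lemma big_part_nonneg sg q u i t : 0 <= big_part sg q u i t.
Proof. unfold big_part. destruct (Nat.leb _ _); [lra|]. apply pow_le, Cmod_ge_0. Qed.

Lemma continuous_big_part sg q u i t : continuous (big_part sg q u i) t.
Proof.
  unfold big_part. destruct (Nat.leb _ _); [apply continuous_const|apply continuous_Cmod_dpoly].
Qed.

Lemma pow4_le_1_plus_pow x k : 0 <= x -> (2 <= k)%nat -> x ^ 4 <= 1 + x ^ (2 * k).
Proof.
  intros Hx Hk. pose proof (pow_le x (2 * k) Hx). destruct (Rle_lt_dec x 1) as [H1|H1].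
  - assert (x ^ 4 <= 1 ^ 4) by (apply pow_incr; lra). lra.
  - assert (x ^ 4 <= x ^ (2 * k)) by (apply Rle_pow; [lra|lia]). lra.
Qed.

Lemma block_pow4 sg q u i t : 0 <= sg -> (1 <= q)%nat -> (i < 3 * u)%nat ->
  Cmod (dpoly sg t (2 ^ i) (2 ^ i)) ^ 4 <= 2 * P2 (4 * (INR u / INR q)) + big_part sg q u i t.
Proof.
  intros Hs Hq Hi. assert (Pq : 1 <= INR q) by (apply (le_INR 1); auto).
  pose proof (pos_INR u) as Pu.
  assert (HP : 1 <= P2 (4 * (INR u / INR q))).
  { apply P2_ge_1. apply Rmult_le_pos; [lra|]. apply Rdiv_le_0_compat; lra. }
  unfold big_part. destruct (Nat.leb_spec (i * q) u) as [H|H].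
  - assert (B : Cmod (dpoly sg t (2 ^ i) (2 ^ i)) <= P2 (INR u / INR q)).
    { unfold dpoly. eapply Rle_trans; [apply Cmod_csum|].
      apply Rle_trans with (rsum (fun _ => 1) (2 ^ i)).
      - apply rsum_le. intros j _. eapply Rle_trans; [apply Cmod_xpow_pow2_le, Hs|].
        rewrite <- (Rpower_O 2) by lra. apply P2_le. pose proof (pos_INR i). nra.
      - rewrite rsum_const, Rmult_1_r, INR_pow2, <- P2_INR. apply P2_le.
        apply Rle_div_r; [lra|]. rewrite <- mult_INR. apply le_INR. lia. }
    apply Rle_trans with (P2 (INR u / INR q) ^ 4).
    + apply pow_incr. split; [apply Cmod_ge_0|exact B].
    + rewrite <- Rpower_pow by apply P2_pos. rewrite Rpower_mult.
      replace (INR u / INR q * INR 4) with (4 * (INR u / INR q)) by (simpl; ring). lra.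
  - destruct (expo_spec q u i Hq H Hi) as [_ [H2 _]].
    pose proof (pow4_le_1_plus_pow (Cmod (dpoly sg t (2 ^ i) (2 ^ i))) (expo u i) (Cmod_ge_0 _) H2). lra.
Qed.

Lemma dpoly_dyadic sg t m :
  Cmod (dpoly sg t 1 (2 ^ m - 1)) <= rsum (fun i => Cmod (dpoly sg t (2 ^ i) (2 ^ i))) m.
Proof.
  induction m as [|m IH].
  - simpl. unfold dpoly. simpl. rewrite Cmod_0. lra.
  - pose proof (Nat.pow_nonzero 2 m ltac:(lia)).
    replace (2 ^ S m - 1)%nat with ((2 ^ m - 1) + 2 ^ m)%nat by (simpl; lia). rewrite dpoly_split.
    replace (1 + (2 ^ m - 1))%nat with (2 ^ m)%nat by lia. cbn [rsum].
    eapply Rle_trans; [apply Cmod_triangle|]. lra.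
Qed.

Lemma zeta_dyadic_bound zeta sg t u : is_riemann_zeta zeta -> 309 / 320 < sg ->
  (2 ^ u) ^ 2 <= t <= 4 * (2 ^ u) ^ 2 ->
  Cmod (zeta (sg, t)) <= rsum (fun i => Cmod (dpoly sg t (2 ^ i) (2 ^ i))) (3 * u) + (sg + 7).
Proof.
  intros Hz Hsg Ht. pose proof (pos_INR u) as Pu. set (U2 := (2 ^ u) ^ 2) in *.
  assert (HU2 : 1 <= U2) by (unfold U2; rewrite <- pow_mult; apply pow_R1_Rle; lra).
  (* Length T^(3/2): the error |s| N^(-sg) is then bounded since 3 sg >= 2, whereas N = T would
     leave T^(1-sg). *)
  set (N := (2 ^ (3 * u))%nat). assert (HN : (1 <= N)%nat) by (unfold N; pose proof (Nat.pow_nonzero 2 (3 * u)); lia).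
  assert (EU : U2 = P2 (2 * INR u)) by apply sqr_pow2.
  assert (E3 : INR (3 * u) = 3 * INR u) by (rewrite mult_INR; simpl; ring).
  set (s := (sg, t) : C).
  assert (HexpN : exp (- sg * ln (INR N)) <= / U2).
  { unfold N. rewrite exp_ln_pow2, E3, EU, <- Rpower_Ropp. apply P2_le. nra. }
  pose proof (exp_pos (- sg * ln (INR N))) as Hexp0.
  assert (A1 : Cmod (zeta s - zeta_em N s) <= sg + 4).
  { eapply Rle_trans; [apply zeta_approx; auto; unfold s; simpl; lra|].
    assert (Hs : Cmod s <= sg + 4 * U2).
    { eapply Rle_trans; [apply Cmod_le_abs|]. unfold s. simpl. rewrite !Rabs_pos_eq; lra. }
    apply Rle_trans with ((sg + 4 * U2) * / U2).
    - apply Rmult_le_compat; auto; [apply Cmod_ge_0|]. unfold s at 1. simpl fst. lra.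
    - apply Rle_div_l; [lra|]. nra. }
  assert (Exp : Cmod (xpow s (INR N)) = exp (- sg * ln (INR N))) by apply Cmod_xpow.
  assert (HinvU : / U2 <= 1) by (rewrite <- Rinv_1; apply Rinv_le_contravar; lra).
  assert (Hs1 : t <= Cmod (s - RtoC 1)).
  { eapply Rle_trans; [|apply abs_snd_le_Cmod]. simpl. rewrite Ropp_0, Rplus_0_r. apply Rle_abs. }
  assert (A2 : Cmod (zeta_em N s - dpoly sg t 1 (2 ^ (3 * u) - 1)) <= 3).
  { unfold zeta_em. change (csum (fun k => xpow s (INR (S k))) N) with (dpoly sg t 1 (2 ^ (3 * u))).
    (* The term n = N is split off, so that exactly the complete dyadic blocks with i < 3 u
       remain. *)
    replace (dpoly sg t 1 (2 ^ (3 * u))) with (dpoly sg t 1 (2 ^ (3 * u) - 1) + xpow s (INR N))%C.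
    2:{ replace (2 ^ (3 * u))%nat with ((2 ^ (3 * u) - 1) + 1)%nat at 2 by (unfold N in HN; lia).
        rewrite dpoly_split. f_equal. unfold dpoly. cbn [csum].
        replace (1 + (2 ^ (3 * u) - 1) + 0)%nat with N by (unfold N in *; lia). fold s. ring. }
    match goal with |- Cmod ?q <= 3 => replace q
      with (xpow s (INR N) + (RtoC (INR N) * xpow s (INR N) / (s - RtoC 1) - xpow s (INR N) / RtoC 2))%C by ring end.
    assert (N1 : (s - RtoC 1)%C <> RtoC 0) by (apply Cmod_gt_0; lra).
    assert (N2 : RtoC 2 <> RtoC 0) by (intros E; apply (f_equal fst) in E; simpl in E; lra).
    eapply Rle_trans; [apply Cmod_triangle|]. eapply Rle_trans; [apply Rplus_le_compat_l, Cmod_minus_le|].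
    rewrite !Cmod_div, Cmod_mult, !Cmod_R, (Rabs_pos_eq (INR N)), (Rabs_pos_eq 2), Exp
      by (auto; try lra; apply pos_INR).
    assert (INR N * exp (- sg * ln (INR N)) <= U2).
    { unfold N. rewrite exp_ln_pow2, INR_pow2, <- P2_INR, <- P2_plus, EU, E3. apply P2_le. nra. }
    assert (INR N * exp (- sg * ln (INR N)) / Cmod (s - RtoC 1) <= 1) by (apply Rle_div_l; lra).
    lra. }
  pose proof (dpoly_dyadic sg t (3 * u)) as A3.
  replace (zeta s) with ((zeta s - zeta_em N s) + ((zeta_em N s - dpoly sg t 1 (2 ^ (3 * u) - 1))
     + dpoly sg t 1 (2 ^ (3 * u) - 1)))%C by ring.
  eapply Rle_trans; [apply Cmod_triangle|]. eapply Rle_trans; [apply Rplus_le_compat_l, Cmod_triangle|]. lra.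
Qed.

Lemma rsum_pow4 f n : rsum f n ^ 4 <= INR n ^ 3 * rsum (fun i => f i ^ 4) n.
Proof.
  pose proof (rsum_cauchy f n) as H1. pose proof (rsum_cauchy (fun i => f i ^ 2) n) as H2. cbv beta in H2.
  rewrite (rsum_ext (fun i => (f i ^ 2) ^ 2) (fun i => f i ^ 4)) in H2 by (intros; ring).
  pose proof (pos_INR n) as Pn.
  replace (rsum f n ^ 4) with ((rsum f n ^ 2) ^ 2) by ring.
  apply Rle_trans with ((INR n * rsum (fun i => f i ^ 2) n) ^ 2).
  - apply pow_incr. split; [apply pow2_ge_0|exact H1].
  - rewrite Rpow_mult_distr. replace (INR n ^ 3) with (INR n ^ 2 * INR n) by ring. rewrite Rmult_assoc.
    apply Rmult_le_compat_l; [apply pow2_ge_0|exact H2].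
Qed.

Lemma zeta_pow4_bound zeta sg q t u : is_riemann_zeta zeta -> 309 / 320 < sg -> (1 <= q)%nat ->
  (2 ^ u) ^ 2 <= t <= 4 * (2 ^ u) ^ 2 ->
  Cmod (zeta (sg, t)) ^ 4
  <= 8 * (162 + (sg + 7) ^ 4) * (3 + INR u) ^ 4 * P2 (4 * (INR u / INR q))
     + 216 * (3 + INR u) ^ 3 * rsum (fun i => big_part sg q u i t) (3 * u).
Proof.
  intros Hz Hsg Hq Ht. pose proof (pos_INR u) as Pu. assert (Pq : 1 <= INR q) by (apply (le_INR 1); auto).
  assert (HP : 1 <= P2 (4 * (INR u / INR q))).
  { apply P2_ge_1. apply Rmult_le_pos; [lra|]. apply Rdiv_le_0_compat; lra. }
  set (p := P2 (4 * (INR u / INR q))) in *. set (x := 3 + INR u).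
  pose proof (zeta_dyadic_bound zeta sg t u Hz Hsg Ht) as H1.
  set (S1 := rsum (fun i => Cmod (dpoly sg t (2 ^ i) (2 ^ i))) (3 * u)) in *.
  set (Bp := rsum (fun i => big_part sg q u i t) (3 * u)).
  assert (PB : 0 <= Bp) by (apply rsum_nonneg; intros; apply big_part_nonneg).
  assert (E3 : INR (3 * u) = 3 * INR u) by (rewrite mult_INR; simpl; ring).
  assert (H2 : S1 ^ 4 <= 27 * x ^ 3 * (6 * x * p + Bp)).
  { unfold S1. eapply Rle_trans; [apply rsum_pow4|]. rewrite E3.
    assert (HS : rsum (fun i => Cmod (dpoly sg t (2 ^ i) (2 ^ i)) ^ 4) (3 * u) <= 6 * x * p + Bp).
    { apply Rle_trans with (rsum (fun i => 2 * p + big_part sg q u i t) (3 * u)).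
      - apply rsum_le. intros i Hi. apply block_pow4; auto. lra.
      - rewrite rsum_plus, rsum_const, E3. fold Bp. apply Rplus_le_compat_r. unfold x. nra. }
    apply Rmult_le_compat; auto.
    - apply pow_le; lra. - apply rsum_nonneg. intros. apply pow_le, Cmod_ge_0.
    - replace (27 * x ^ 3) with ((3 * x) ^ 3) by ring. apply pow_incr. unfold x. lra. }
  apply Rle_trans with ((S1 + (sg + 7)) ^ 4).
  { apply pow_incr. split; [apply Cmod_ge_0|exact H1]. }
  eapply Rle_trans; [apply pow4_convex|].
  assert (Hx : 1 <= x ^ 4) by (apply pow_R1_Rle; unfold x; lra).
  assert (H4 : 0 <= (sg + 7) ^ 4) by (apply pow_le; lra).
  assert (H5 : (sg + 7) ^ 4 <= (sg + 7) ^ 4 * (x ^ 4 * p)).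
  { rewrite <- (Rmult_1_r ((sg + 7) ^ 4)) at 1. apply Rmult_le_compat_l; auto. nra. }
  replace (8 * (162 + (sg + 7) ^ 4) * x ^ 4 * p + 216 * x ^ 3 * Bp)
    with (8 * (27 * x ^ 3 * (6 * x * p + Bp) + (sg + 7) ^ 4 * (x ^ 4 * p))) by ring.
  lra.
Qed.

Definition integrand (zeta : C -> C) (sg t : R) : R := Cmod (zeta (crit t)) ^ 4 * Cmod (zeta (sg, t)) ^ 4.

Lemma continuous_zeta_line zeta sg t : is_riemann_zeta zeta -> 0 < t ->
  Ccontinuous (fun t => zeta (sg, t)) t.
Proof.
  intros Hz Ht. apply (Ccont_comp_path zeta (fun t => (sg, t))).
  - apply Cdiff_cont, zeta_Cdiff; auto. intros E. apply (f_equal snd) in E. simpl in E. lra.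
  - intros t'. apply Cmod_imag_diff.
Qed.

Lemma ex_RInt_integrand zeta sg a b : is_riemann_zeta zeta -> 0 < a -> a <= b ->
  ex_RInt (integrand zeta sg) a b.
Proof.
  intros Hz Ha Hab. apply (@ex_RInt_continuous R_CompleteNormedModule). intros t.
  rewrite Rmin_left, Rmax_right by lra. intros Ht. unfold integrand.
  apply (continuous_mult (K := R_AbsRing)); apply continuous_pow, Ccontinuous_Cmod;
    apply continuous_zeta_line; auto; lra.
Qed.

Lemma continuous_rsum (f : nat -> R -> R) n t : (forall i, continuous (f i) t) ->
  continuous (fun t => rsum (fun i => f i t) n) t.
Proof.
  intros H. induction n; simpl; [apply continuous_const|]. apply (continuous_plus (V := R_NormedModule)); auto.
Qed.

Lemma RInt_rsum_le (f : nat -> R -> R) n a b c : (forall i t, continuous (f i) t) ->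
  (forall i, (i < n)%nat -> RInt (f i) a b <= c) ->
  RInt (fun t => rsum (fun i => f i t) n) a b <= INR n * c.
Proof.
  intros Hc H. rewrite <- rsum_const. induction n.
  - simpl. rewrite RInt_const. unfold scal; simpl; unfold mult; simpl. lra.
  - cbn [rsum]. rewrite RInt_Rplus by (apply ex_RInt_cont; intros; auto; apply continuous_rsum; auto).
    apply Rplus_le_compat; auto.
Qed.

Lemma dyadic_integral_bound zeta sg e : is_riemann_zeta zeta -> 309 / 320 < sg -> 0 < e ->
  exists K, 0 < K /\ forall u, RInt (integrand zeta sg) ((2 ^ u) ^ 2) (4 * (2 ^ u) ^ 2) <= K * P2 ((2 + e) * INR u).
Proof.
  intros Hz Hsg He.
  (* With q >= 8 / e the short blocks lose at most 2^(e u / 2). In the first part of the estimate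
     the rest of [e] goes in equal parts to the fourth moment and to the powers of u. *)
  destruct (INR_unbounded (8 / e)) as [q0 Hq0]. set (q := S q0).
  assert (Pq : 1 <= INR q) by (apply (le_INR 1); unfold q; lia).
  assert (Hq : 4 / INR q <= e / 2).
  { apply Rle_div_l; [lra|]. assert (H8 : 8 < INR q * e).
    { apply Rlt_le_trans with (INR q0 * e); [apply Rlt_div_l; lra|]. apply Rmult_le_compat_r; [lra|].
      apply le_INR. unfold q. lia. }
    lra. }
  destruct (majorant4_integral (e / 4) ltac:(lra)) as [K1 [HK1 I1]].
  destruct (large_blocks sg (2 * q) (e / 4) Hsg ltac:(lra)) as [K2 [HK2 I2]].
  destruct (absorb_poly 4 (e / 4) ltac:(lra)) as [Ka [HKa Ha]].
  (* 13 = 3 + 9 + 1: convexity over 3 u blocks, the supremum bound, and the number of blocks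
     integrated. *)
  destruct (absorb_poly 13 (e / 4) ltac:(lra)) as [Kb [HKb Hb]].
  set (C0 := 8 * (162 + (sg + 7) ^ 4)).
  assert (HC0 : 0 < C0). { unfold C0. assert (0 <= (sg + 7) ^ 4) by (apply pow_le; lra). lra. }
  exists (C0 * Ka * K1 + 216 * 10 ^ 19 * 3 * Kb * K2). split.
  { apply Rplus_lt_0_compat; split_mult; lra. }
  intros u. pose proof (pos_INR u) as Pu. set (U2 := (2 ^ u) ^ 2).
  assert (HU2 : 1 <= U2) by (unfold U2; rewrite <- pow_mult; apply pow_R1_Rle; lra).
  set (x := 3 + INR u). set (p := P2 (4 * (INR u / INR q))).
  set (V := 2 ^ u * sqrt (2 ^ u)).
  assert (HV : V = P2 (3 / 2 * INR u)).
  { unfold V. rewrite <- P2_INR. rewrite <- Rpower_sqrt by apply P2_pos. rewrite Rpower_mult, <- P2_plus. f_equal. field. }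
  pose proof (P2_pos (3 / 2 * INR u)) as PV. rewrite <- HV in PV.
  (* [c1] multiplies the fourth moment on the critical line; [c2] contains its supremum and
     multiplies the long blocks. *)
  set (c1 := C0 * x ^ 4 * p). set (c2 := 216 * x ^ 3 * (10 ^ 19 * x ^ 9 * V)).
  assert (Pp : 0 < p) by apply P2_pos.
  assert (Px : forall n, 0 < x ^ n) by (intros n; apply pow_lt; unfold x; lra).
  pose proof (Px 3%nat) as Px3. pose proof (Px 4%nat) as Px4. pose proof (Px 9%nat) as Px9.
  assert (Hc1 : 0 <= c1) by (unfold c1; split_mult; lra).
  assert (Hc2 : 0 <= c2) by (unfold c2; split_mult; lra).
  assert (B1 : RInt (integrand zeta sg) U2 (4 * U2)
     <= RInt (fun t => c1 * majorant4 u t + c2 * rsum (fun i => big_part sg q u i t) (3 * u)) U2 (4 * U2)).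
  { apply RInt_le; [lra|apply ex_RInt_integrand; auto; lra| |].
    - apply ex_RInt_cont. intros t. apply (continuous_plus (V := R_NormedModule));
        apply (continuous_mult (K := R_AbsRing)); try apply continuous_const;
        [apply continuous_majorant4|apply continuous_rsum; intros; apply continuous_big_part].
    - intros t Ht. unfold integrand.
      pose proof (zeta_majorant4 zeta u t Hz ltac:(fold U2; lra)) as M1.
      pose proof (zeta_half_line_sup zeta t u Hz ltac:(fold U2; lra)) as M2.
      pose proof (zeta_pow4_bound zeta sg q t u Hz Hsg ltac:(unfold q; lia) ltac:(fold U2; lra)) as M3.
      fold x p C0 V in M2, M3.
      pose proof (pow_le _ 4 (Cmod_ge_0 (zeta (crit t)))) as Z1.
      set (z1 := Cmod (zeta (crit t)) ^ 4) in *.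
      assert (PB : 0 <= rsum (fun i => big_part sg q u i t) (3 * u)) by (apply rsum_nonneg; intros; apply big_part_nonneg).
      set (Bp := rsum (fun i => big_part sg q u i t) (3 * u)) in *.
      apply Rle_trans with (z1 * (C0 * x ^ 4 * p + 216 * x ^ 3 * Bp)); [apply Rmult_le_compat_l; auto|].
      rewrite Rmult_plus_distr_l. apply Rplus_le_compat.
      + fold c1. rewrite Rmult_comm. apply Rmult_le_compat_l; auto.
      + unfold c2. replace (z1 * (216 * x ^ 3 * Bp)) with ((216 * x ^ 3) * Bp * z1) by ring.
        replace (216 * x ^ 3 * (10 ^ 19 * x ^ 9 * V) * Bp) with ((216 * x ^ 3) * Bp * (10 ^ 19 * x ^ 9 * V)) by ring.
        apply Rmult_le_compat_l; auto. apply Rmult_le_pos; auto. lra. }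
  assert (Ex1 : ex_RInt (fun t => c1 * majorant4 u t) U2 (4 * U2)).
  { apply ex_RInt_cont. intros t. apply (continuous_mult (K := R_AbsRing)); [apply continuous_const|apply continuous_majorant4]. }
  assert (Ex2 : ex_RInt (fun t => rsum (fun i => big_part sg q u i t) (3 * u)) U2 (4 * U2)).
  { apply ex_RInt_cont. intros t. apply continuous_rsum. intros. apply continuous_big_part. }
  rewrite RInt_Rplus in B1; [|exact Ex1|apply (ex_RInt_scal (V := R_NormedModule)); exact Ex2].
  rewrite RInt_Rscal in B1 by (apply ex_RInt_cont; apply continuous_majorant4).
  rewrite RInt_Rscal in B1 by exact Ex2.
  pose proof (I1 u) as J1. fold U2 in J1.
  assert (J2 : RInt (fun t => rsum (fun i => big_part sg q u i t) (3 * u)) U2 (4 * U2)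
     <= INR (3 * u) * (K2 * P2 ((132 / 320 + e / 4) * INR u))).
  { apply RInt_rsum_le; [intros; apply continuous_big_part|]. intros i Hi. unfold big_part.
    destruct (Nat.leb_spec (i * q) u) as [H|H].
    - rewrite RInt_const. unfold scal; simpl; unfold mult; simpl. rewrite Rmult_0_r.
      apply Rmult_le_pos; [lra|left; apply P2_pos].
    - destruct (expo_spec q u i ltac:(unfold q; lia) H Hi) as [G1 G2]. apply I2; auto. lia. }
  rewrite mult_INR in J2. simpl (INR 3) in J2.
  specialize (Ha u). specialize (Hb u). fold x in Ha, Hb.
  set (w := P2 (e / 4 * INR u)) in *. assert (Pw : 0 < w) by apply P2_pos.
  set (F := P2 ((2 + e) * INR u)).
  assert (T1 : c1 * RInt (majorant4 u) U2 (4 * U2) <= C0 * Ka * K1 * F).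
  { apply Rle_trans with (C0 * (Ka * w) * p * (K1 * P2 ((2 + e / 4) * INR u))).
    - apply Rmult_le_compat; auto.
      + apply RInt_ge_0; [lra|apply ex_RInt_cont; apply continuous_majorant4|]. intros; apply majorant4_nonneg.
      + unfold c1. apply Rmult_le_compat_r; [lra|]. apply Rmult_le_compat_l; lra.
    - replace (C0 * (Ka * w) * p * (K1 * P2 ((2 + e / 4) * INR u)))
        with (C0 * Ka * K1 * (w * p * P2 ((2 + e / 4) * INR u))) by ring.
      apply Rmult_le_compat_l; [split_mult; lra|].
      unfold w, p, F. rewrite <- !P2_plus. apply P2_le.
      assert (4 * (INR u / INR q) <= e / 2 * INR u).
      { replace (4 * (INR u / INR q)) with (4 / INR q * INR u) by (field; lra). apply Rmult_le_compat_r; lra. }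
      lra. }
  assert (T2 : c2 * RInt (fun t => rsum (fun i => big_part sg q u i t) (3 * u)) U2 (4 * U2) <= 216 * 10 ^ 19 * 3 * Kb * K2 * F).
  { set (y := P2 ((132 / 320 + e / 4) * INR u)) in *. assert (Py : 0 < y) by apply P2_pos.
    apply Rle_trans with (c2 * (3 * x * (K2 * y))).
    - apply Rmult_le_compat_l; auto. eapply Rle_trans; [exact J2|].
      apply Rmult_le_compat_r; [apply Rmult_le_pos; lra|]. unfold x. lra.
    - unfold c2. replace (216 * x ^ 3 * (10 ^ 19 * x ^ 9 * V) * (3 * x * (K2 * y)))
        with (216 * 10 ^ 19 * 3 * K2 * (V * y) * x ^ 13) by ring.
      apply Rle_trans with (216 * 10 ^ 19 * 3 * K2 * (V * y) * (Kb * w)).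
      + apply Rmult_le_compat_l; auto. assert (0 <= V * y) by (apply Rmult_le_pos; lra).
        split_mult; lra.
      + replace (216 * 10 ^ 19 * 3 * K2 * (V * y) * (Kb * w)) with (216 * 10 ^ 19 * 3 * Kb * K2 * (V * y * w)) by ring.
        apply Rmult_le_compat_l; [split_mult; lra|].
        (* The decisive comparison: 3/2 + 132/320 = 612/320 < 2, next to e / 4 + e / 4 <= e. *)
        rewrite HV. unfold y, w, F. rewrite <- !P2_plus. apply P2_le.
        assert (0 <= e * INR u) by (apply Rmult_le_pos; lra). lra. }
  rewrite Rmult_plus_distr_r. lra.
Qed.

(** * From dyadic ranges to [1, T] *)

Lemma integrand_nonneg zeta sg t : 0 <= integrand zeta sg t.
Proof. apply Rmult_le_pos; apply pow_le, Cmod_ge_0. Qed.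

Lemma integral_bound zeta sg eps : is_riemann_zeta zeta -> 309 / 320 < sg -> 0 < eps ->
  exists K, 0 < K /\ forall T, 1 <= T -> RInt (integrand zeta sg) 1 T <= K * Rpower T (1 + eps).
Proof.
  intros Hz Hsg He.
  destruct (dyadic_integral_bound zeta sg eps Hz Hsg He) as [K [HK HI]].
  destruct (absorb_poly 1 eps He) as [Kp [HKp Hp]].
  exists (K * P2 (2 + eps) * Kp). split; [split_mult; auto; apply P2_pos|].
  assert (Sum : forall n, RInt (integrand zeta sg) 1 ((2 ^ n) ^ 2) <= INR n * (K * P2 ((2 + eps) * INR n))).
  { induction n as [|n IH].
    - simpl. rewrite !Rmult_1_r, RInt_point. unfold zero; simpl. lra.
    - assert (E : (2 ^ S n) ^ 2 = 4 * (2 ^ n) ^ 2) by (simpl; ring). rewrite E.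
      assert (H1 : 1 <= (2 ^ n) ^ 2) by (rewrite <- pow_mult; apply pow_R1_Rle; lra).
      rewrite <- (RInt_Chasles (V := R_CompleteNormedModule) _ 1 ((2 ^ n) ^ 2) (4 * (2 ^ n) ^ 2))
        by (apply ex_RInt_integrand; auto; lra).
      unfold plus; simpl (plus _ _). specialize (HI n). rewrite S_INR.
      pose proof (pos_INR n) as Pn.
      assert (Hm : K * P2 ((2 + eps) * INR n) <= K * P2 ((2 + eps) * (INR n + 1))).
      { apply Rmult_le_compat_l; [lra|]. apply P2_le. apply Rmult_le_compat_l; lra. }
      assert (INR n * (K * P2 ((2 + eps) * INR n)) <= INR n * (K * P2 ((2 + eps) * (INR n + 1)))) by (apply Rmult_le_compat_l; auto).
      change (RInt (integrand zeta sg) 1 ((2 ^ n) ^ 2) + RInt (integrand zeta sg) ((2 ^ n) ^ 2) (4 * (2 ^ n) ^ 2)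
        <= (INR n + 1) * (K * P2 ((2 + eps) * (INR n + 1)))).
      lra. }
  intros T HT. pose proof ln2_pos as L2.
  assert (HlT : 0 <= ln T) by (rewrite <- ln_1; apply ln_le; lra).
  (* 4^n <= T < 4^(n+1). The integrand is nonnegative, so the range may be extended to 4^(n+1), a
     union of n + 1 dyadic ranges. *)
  destruct (nfloor_ex (ln T / (2 * ln 2))) as [n [Hn1 Hn2]]; [apply Rdiv_le_0_compat; lra|].
  apply Rle_div_r in Hn1; [|lra]. apply Rlt_div_l in Hn2; [|lra].
  assert (ET : T = exp (ln T)) by (rewrite exp_ln; lra).
  assert (HTn : T <= (2 ^ S n) ^ 2).
  { rewrite sqr_pow2, ET. unfold Rpower. rewrite S_INR. left. apply exp_increasing. lra. }
  apply Rle_trans with (RInt (integrand zeta sg) 1 ((2 ^ S n) ^ 2)).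
  { rewrite <- (RInt_Chasles (V := R_CompleteNormedModule) _ 1 T ((2 ^ S n) ^ 2))
      by (apply ex_RInt_integrand; auto; lra).
    assert (0 <= RInt (integrand zeta sg) T ((2 ^ S n) ^ 2)).
    { apply RInt_ge_0; auto; [apply ex_RInt_integrand; auto; lra|]. intros; apply integrand_nonneg. }
    unfold plus; simpl (plus _ _).
    change (RInt (integrand zeta sg) 1 T <= RInt (integrand zeta sg) 1 T + RInt (integrand zeta sg) T ((2 ^ S n) ^ 2)).
    lra. }
  eapply Rle_trans; [apply Sum|].
  specialize (Hp n). rewrite pow_1 in Hp. pose proof (pos_INR n) as Pn.
  rewrite S_INR. replace ((2 + eps) * (INR n + 1)) with ((2 + eps) + (2 + eps) * INR n) by ring. rewrite P2_plus.
  set (a := P2 (2 + eps)). set (b := P2 ((2 + eps) * INR n)).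
  assert (Pa : 0 < a) by apply P2_pos. assert (Pb : 0 < b) by apply P2_pos.
  apply Rle_trans with (K * a * Kp * (P2 (eps * INR n) * b)).
  - replace ((INR n + 1) * (K * (a * b))) with ((K * a) * b * (INR n + 1)) by ring.
    replace (K * a * Kp * (P2 (eps * INR n) * b)) with ((K * a) * b * (Kp * P2 (eps * INR n))) by ring.
    apply Rmult_le_compat_l; [|lra]. split_mult; lra.
  - apply Rmult_le_compat_l; [split_mult; lra|].
    unfold b. rewrite <- P2_plus. unfold Rpower.
    (* The number of ranges costs 2^(eps n), and together 2^((2 + 2 eps) n) = (4^n)^(1 + eps) <=
       T^(1 + eps). *)
    assert (Hx : (eps * INR n + (2 + eps) * INR n) * ln 2 <= (1 + eps) * ln T).
    { replace ((eps * INR n + (2 + eps) * INR n) * ln 2) with ((1 + eps) * (INR n * (2 * ln 2))) by ring.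
      apply Rmult_le_compat_l; lra. }
    destruct Hx as [Hx|Hx]; [left; now apply exp_increasing|rewrite Hx; lra].
Qed.

Theorem theorem2p3 (zeta : C -> C) (Hzeta : is_riemann_zeta zeta)
    (sigma : R) (Hsigma : 309 / 320 < sigma) (eps : R) (Heps : 0 < eps) :
  exists K : R, 0 < K /\
    forall T : R, 1 <= T ->
      RInt (fun t : R =>
              Cmod (zeta (RtoC (1 / 2) + Ci * RtoC t)%C) ^ 4 *
              Cmod (zeta (RtoC sigma + Ci * RtoC t)%C) ^ 4) 1 T
      <= K * Rpower T (1 + eps).
Proof.
  destruct (integral_bound zeta sigma eps Hzeta Hsigma Heps) as [K [HK H]].
  exists K. split; [exact HK|]. intros T HT.
  assert (E : forall s t : R, (RtoC s + Ci * RtoC t)%C = (s, t)).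
  { intros s t. apply injective_projections; simpl; ring. }
  rewrite (RInt_ext (V := R_CompleteNormedModule) _ (integrand zeta sigma) 1 T).
  - apply H, HT.
  - intros t _. rewrite !E. reflexivity.
Qed.
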